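(* Let $X$ be a proper CAT$(-1)$ space, let $\Gamma\le\operatorname{Isom}(X)$ be finitely generated, non-elementary and discrete with $0<\delta_X(\Gamma)<\infty$, let $A,B\in\Lambda_\Gamma$ be distinct and let $o$ be a point on the geodesic $(A,B)$. Let $\{(H_\beta,\mathcal G_\beta)\}_{\beta\in I}$ be an arbitrary nonempty family in which each $H_\beta\le\Gamma$ and $\mathcal G_\beta$ is a finite connected graph of groups with fundamental group $H_\beta$. For every $\beta\in I$ and $s>0$: (1) If the trim state set $E_{\beta,*}$ is empty, then $\sum_{h\in H_\beta}e^{-sL^{\mathrm{BS}}_{\beta,o}(h)}=V_{\beta,o}(s)$. (2) If $E_{\beta,*}\neq\varnothing$, then whenever the trim coefficient series ($V_{\beta,o}(s)$ and all entries of $u_{\beta,o}(s)$ and $K_{\beta,*,o}(s)$) are finite and $\rho(K_{\beta,*,o}(s))<1$, $$\sum_{h\in H_\beta}e^{-sL^{\mathrm{BS}}_{\beta,o}(h)}=V_{\beta,o}(s)\Big(1+u_{\beta,o}(s)^T(I-K_{\beta,*,o}(s))^{-1}q_\beta\Big),$$ and these conditions are also necessary for convergence of the left-hand series. (3) If $\delta_X(\Gamma)<1$ or the action of $\Gamma$ on $X$ is convex-cobounded, then every finite comparison matrix at every basepoint and at every level of every chosen finite graph-of-groups hierarchy satisfies $$\sup_{y\in X}\ \sup_{\beta,C,\mathcal F}\ \sigma^{\mathrm{ax}}_{\beta,C,\mathcal F}(y)\ \le\ \delta_X(\Gamma)=\dim_H(\Lambda_\Gamma,\rho_o),$$ where $C\in\mathscr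 C_\beta$ and $\mathcal F$ ranges over finite choices of hyperbolic representatives in $C$.
   Context: $\delta_X(\Gamma)=\inf\{s>0:\sum_{g\in\Gamma}e^{-sd(o,go)}<\infty\}$; $\Lambda_\Gamma$ is the limit set; $\rho_o(\xi,\eta)=e^{-(\xi\mid\eta)_o}$ is the Bourdon metric on $\partial X$ and $\dim_H$ is Hausdorff dimension. The action is convex-cobounded if there is $R<\infty$ with $\bigcup_{g,h\in\Gamma}[go,ho]\subseteq\bigcup_{g\in\Gamma}gB_X(o,R)$. A finite graph-of-groups hierarchy is a finite rooted tree of subgroups of $\Gamma$ in which every nonterminal node $H$ carries a finite graph-of-groups decomposition with fundamental group $H$ and selected vertex groups become its children; such node decompositions may be included among the pairs $(H_\beta,\mathcal G_\beta)$. Data attached to a pair $(H,\mathcal G)$ and basepoint $x\in X$ (for $(H_\beta,\mathcal G_\beta)$ all objects carry the extra subscript $\beta$). $\mathcal G$ has finite underlying graph $Y$ and Bass–Serre tree $T$ ($H$ acts without inversions, $H\backslash T=Y$). For an oriented edge $f$ of $Y$: origin $\iota(f)$, terminus $t(f)$, reverse $\bar f$. Fix a base vertex $v_*$ of $Y$, a lift $\tilde v\in T$ of each vertex $v$, a lift $\tilde f$ of each oriented edge $f$ with origin $\widetilde{\iota(f)}$, and $\tau_f\in H$ with $t(\tilde f)=\tau_f\widetilde{t(f)}$, chosen so that $\widetilde{\bar f}=\tau_f^{-1}\overline{\tilde f}$ and $\tau_{\bar f}=\tau_f^{-1}$. Put $G_v=\operatorname{Stab}_H(\tilde v)$, $G_f=\operatorname{Stab}_H(\tilde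 f)\le G_{\iota(f)}$. For $c=rG_f\in G_{\iota(f)}/G_f$ let $L_{f,x}(c)=\min_{h\in G_f}d(x,rh\tau_fx)$; choose $h_f(c)$ attaining it and put $b_f(c)=rh_f(c)\tau_f$. An allowed transition is a triple $(e,f,c)$ of oriented edges $e,f$ with $t(e)=\iota(f)$ and $c\in G_{\iota(f)}/G_f$, where $c\ne G_f$ is required if $f=\bar e$. Let $K_{ef,x}(s)=\sum_{c:(e,f,c)\text{ allowed}}e^{-sL_{f,x}(c)}\in[0,\infty]$ (zero if $t(e)\ne\iota(f)$). A reduced coset-labelled loop based at $v_*$ is a sequence $(f_1,c_1;\dots;f_n,c_n)$, $c_j\in G_{\iota(f_j)}/G_{f_j}$, with $\iota(f_1)=v_*=t(f_n)$ and all $(f_j,f_{j+1},c_{j+1})$ allowed. $E_*$ (the trim state set) is the set of oriented edges occurring in some such loop, and $K_{*,x}(s)$ is the restriction of $K_x(s)$ to $E_*$. Normal form: every $h\in H$ is uniquely $h=b_{f_1}(c_1)\cdots b_{f_n}(c_n)h_*$ with $(f_1,c_1;\dots;f_n,c_n)$ a reduced coset-labelled loop based at $v_*$ ($n\ge0$) and $h_*\in G_{v_*}$; $L^{\mathrm{BS}}_x(h)=\sum_jL_{f_j,x}(c_j)+d(x,h_*x)$. Further, $V_x(s)=\sum_{h\in G_{v_*}}e^{-sd(x,hx)}$; for $f\in E_*$, $(u_x(s))_f=\sum_{c\in G_{v_*}/G_f}e^{-sL_{f,x}(c)}$ if $\iota(f)=v_*$ and $0$ otherwise, and $q_f=1$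 if $t(f)=v_*$ and $0$ otherwise. $\rho$ of a finite matrix is its spectral radius. $\mathscr C$ is the set of strongly connected components $C\subseteq E_*$ of the support digraph of $K_{*,x}$ that contain a directed closed walk of positive length. An isometry $g$ is hyperbolic if $\tau_X(g)=\inf_zd(z,gz)$ is positive and attained; it has a unique axis $\operatorname{Ax}(g)$, and $a_x(g)=\tau_X(g)+2d(x,\operatorname{Ax}(g))$. A finite choice $\mathcal F$ of hyperbolic representatives in $C$ consists, for each $e,f\in C$, of a finite set $\mathcal F_{ef}$ of distinct cosets $c$ with $(e,f,c)$ allowed and, for each $c=rG_f\in\mathcal F_{ef}$, one hyperbolic element $g_{ef,c}=rh\tau_f$ with $h\in G_f$. The comparison matrix is $A^{\mathcal F}_{C,x}(s)_{ef}=\sum_{c\in\mathcal F_{ef}}e^{-sa_x(g_{ef,c})}$, and $\sigma^{\mathrm{ax}}_{C,\mathcal F}(x)=\inf\{s>0:\rho(A^{\mathcal F}_{C,x}(s))<1\}$. *)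

(* Defs.v *)
From HB Require Import structures.
From mathcomp Require Import all_boot all_order all_algebra.
From mathcomp Require Import all_classical all_reals all_analysis.
From mathcomp Require Export complex.

Set Implicit Arguments.
Unset Strict Implicit.
Unset Printing Implicit Defensive.

Import Order.TTheory GRing.Theory Num.Theory.
Import numFieldNormedType.Exports.

Local Open Scope classical_set_scope.
Local Open Scope ring_scope.

Section IsometryGroup.
Context {R : realType} (X : metricType R).

Record isom := Isom {
  isom_fun :> X -> X ;
  isom_dist : forall x y, mdist (isom_fun x) (isom_fun y) = mdist x y ;
  isom_surj : forall y, exists x, isom_fun x = y }.

Lemma isom_inj (g h : isom) : (forall x, g x = h x) -> g = h.
Proof.
case: g => g dg sg; case: h => h dh sh /= /funext gh.
by subst h; congr Isom; exact: Prop_irrelevance.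
Qed.

Lemma isom_funI (g : isom) : injective g.
Proof.
by move=> x y gxy; apply: mdist_positivity; rewrite -(isom_dist g) gxy mdistxx.
Qed.

HB.instance Definition _ := gen_eqMixin isom.
HB.instance Definition _ := gen_choiceMixin isom.

Definition isom_one : isom :=
  @Isom id (fun _ _ => erefl) (fun y => ex_intro _ y erefl).

Program Definition isom_mul (g h : isom) : isom := @Isom (g \o h) _ _.
Next Obligation. by move=> g h x y /=; rewrite !isom_dist. Qed.
Next Obligation.
move=> g h y; have [z <-] := isom_surj g y.
by have [x <-] := isom_surj h z; exists x.
Qed.

Definition isom_inv_fun (g : isom) (y : X) : X := projT1 (cid (isom_surj g y)).

Lemma isom_inv_funK (g : isom) : cancel (isom_inv_fun g) g.
Proof. by move=> y; rewrite /isom_inv_fun; case: cid. Qed.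

Program Definition isom_inv (g : isom) : isom := @Isom (isom_inv_fun g) _ _.
Next Obligation. by move=> g x y; rewrite -(isom_dist g) !isom_inv_funK. Qed.
Next Obligation.
by move=> g y; exists (g y); apply: (@isom_funI g); rewrite isom_inv_funK.
Qed.

Fact isom_mulA : associative isom_mul.
Proof. by move=> f g h; apply: isom_inj. Qed.
Fact isom_mul1 : left_id isom_one isom_mul.
Proof. by move=> f; apply: isom_inj. Qed.
Fact isom_1mul : right_id isom_one isom_mul.
Proof. by move=> f; apply: isom_inj. Qed.
Fact isom_mulV : left_inverse isom_one isom_inv isom_mul.
Proof.
move=> f; apply: isom_inj => x /=.
by apply: (@isom_funI f); rewrite isom_inv_funK.
Qed.
Fact isom_Vmul : right_inverse isom_one isom_inv isom_mul.
Proof. by move=> f; apply: isom_inj => x /=; rewrite isom_inv_funK. Qed.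

HB.instance Definition _ := isGroup.Build isom
  isom_mulA isom_mul1 isom_1mul isom_mulV isom_Vmul.

Definition is_subgroup (G : set isom) : Prop :=
  [/\ G 1%g, (forall g h, G g -> G h -> G (g * h)%g) &
      (forall g, G g -> G g^-1%g)].

Definition finitely_generated (G : set isom) : Prop :=
  exists2 S : set isom, finite_set S & G = smallest is_subgroup S.

(* [Isom(X)] carries the compact-open topology. *)
Definition discrete_isoms (G : set isom) : Prop :=
  let S : set {compact-open, X -> X} := [set isom_fun g | g in G] in
  isolated S = S.

End IsometryGroup.

Section Geometry.
Context {R : realType} (X : metricType R).
Implicit Types (x y z p q r o : X) (c : R -> X) (G : set (isom X)).

Definition proper_space : Prop :=
  forall x (r : R), compact [set y | mdist x y <= r].

Definition geodesic p q c : Prop :=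
  [/\ c 0 = p, c (mdist p q) = q &
      {in `[0, mdist p q] &, forall s t, mdist (c s) (c t) = `|s - t|}].

Definition segment p q : set X :=
  [set z | exists c t, [/\ geodesic p q c, 0 <= t <= mdist p q & z = c t]].

Definition geodesic_space : Prop := forall p q, exists c, geodesic p q c.

(* Upper half-plane model of the hyperbolic plane of curvature -1. *)
Definition hyp_plane : set (R * R) := [set a | 0 < a.2].

Definition arcosh (u : R) : R := ln (u + Num.sqrt (u ^+ 2 - 1)).

Definition hyp_dist (a b : R * R) : R :=
  arcosh (1 + ((a.1 - b.1) ^+ 2 + (a.2 - b.2) ^+ 2) / (2 * a.2 * b.2)).

(* The triangle is [p, q, r] with sides [c1] from [p] to [q] and [c2] from [p]
   to [r]; [a, b, e] is a comparison triangle and [u], [v] are the comparison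
   points of [c1 s] and [c2 t].  Relabelling the vertices covers every pair of
   points on two different sides. *)
Definition cat_minus_one : Prop :=
  geodesic_space /\
  forall p q r c1 c2, geodesic p q c1 -> geodesic p r c2 ->
  forall a b e : R * R, hyp_plane a -> hyp_plane b -> hyp_plane e ->
    hyp_dist a b = mdist p q -> hyp_dist a e = mdist p r ->
    hyp_dist b e = mdist q r ->
  forall s t, 0 <= s <= mdist p q -> 0 <= t <= mdist p r ->
  forall u v : R * R, hyp_plane u -> hyp_plane v ->
    hyp_dist a u = s -> hyp_dist u b = mdist p q - s ->
    hyp_dist a v = t -> hyp_dist v e = mdist p r - t ->
    mdist (c1 s) (c2 t) <= hyp_dist u v.

(* Only the values of a ray on [0, +oo[ matter. *)
Definition ray c : Prop :=
  forall s t, 0 <= s -> 0 <= t -> mdist (c s) (c t) = `|s - t|.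

Definition geodesic_line c : Prop :=
  forall s t, mdist (c s) (c t) = `|s - t|.

Definition asymptotic c c' : Prop :=
  exists K : R, forall t, 0 <= t -> mdist (c t) (c' t) <= K.

Record boundary := Boundary {
  rays : set (R -> X) ;
  raysP : exists2 c, ray c & rays = [set c' | ray c' /\ asymptotic c c'] }.

Definition gromov o x y : R := (mdist o x + mdist o y - mdist x y) / 2.

(* In a CAT(-1) space the limit exists in [0, +oo] and does not depend on the
   representing rays picked by [xget]. *)
Definition gromov_bd o (xi eta : boundary) : \bar R :=
  let c := xget (cst o) (rays xi) in let c' := xget (cst o) (rays eta) in
  lim ((gromov o (c t) (c' t))%:E @[t --> +oo]).

Definition bourdon o (xi eta : boundary) : R :=
  fine (expeR (- gromov_bd o xi eta)).

Definition converges_to_bd o (x : nat -> X) (xi : boundary) : Prop :=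
  forall c, rays xi c -> forall M : R,
    \forall n \near \oo & t \near +oo, M <= gromov o (x n) (c t).

Definition limit_set o G : set boundary :=
  [set xi | exists2 g : nat -> isom X, (forall n, G (g n)) &
              converges_to_bd o (fun n => g n o) xi].

Definition on_line_between o (A B : boundary) : Prop :=
  exists c, [/\ geodesic_line c, rays A c, rays B (fun t => c (- t)) &
                exists t, c t = o].

Definition non_elementary o G : Prop :=
  exists a b e, [/\ limit_set o G a, limit_set o G b & limit_set o G e] /\
                [/\ a <> b, a <> e & b <> e].

Definition critical_exponent o G : \bar R :=
  ereal_inf [set s%:E | s in [set s : R | 0 < s /\
    (\esum_(g in G) (expR (- s * mdist o (g o)))%:E < +oo)%E]].

Definition convex_cobounded o G : Prop :=
  exists r : R,
    \bigcup_(g in G) \bigcup_(h in G) segment (g o) (h o) `<=`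
    \bigcup_(g in G) [set g z | z in ball o r].

Definition translation_length (g : isom X) : R :=
  inf [set mdist z (g z) | z in setT].

Definition hyperbolic (g : isom X) : Prop :=
  0 < translation_length g /\ exists z, mdist z (g z) = translation_length g.

Definition axis (g : isom X) : set X :=
  [set z | exists c, [/\ geodesic_line c,
     (forall t, g (c t) = c (t + translation_length g)) & exists t, z = c t]].

Definition axial_length x (g : isom X) : R :=
  translation_length g + 2 * inf [set mdist x z | z in axis g].

End Geometry.

Section HausdorffDimension.
Context {R : realType} {T : Type} (rho : T -> T -> R).

Definition diameter (U : set T) : \bar R :=
  ereal_sup (0%E |` [set (rho p.1 p.2)%:E | p in U `*` U]).

Definition hausdorff_content (s eps : R) (A : set T) : \bar R :=
  ereal_inf [set (\sum_(0 <= n <oo) poweR (diameter (U n)) s)%E | U in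
    [set U : nat -> set T | A `<=` \bigcup_n U n /\
                            forall n, (diameter (U n) <= eps%:E)%E]].

Definition hausdorff_measure (s : R) (A : set T) : \bar R :=
  ereal_sup [set hausdorff_content s eps A | eps in [set eps : R | 0 < eps]].

Definition hausdorff_dim (A : set T) : \bar R :=
  ereal_inf [set s%:E | s in
    [set s : R | 0 < s /\ hausdorff_measure s A = 0%E]].

End HausdorffDimension.

Definition spectral_radius (R : realType) (n : nat) (M : 'M[R]_n) : R :=
  sup [set complex.Re `|z| | z in
         [set z : complex R | eigenvalue (map_mx (fun x => x%:C%C) M) z]].

Definition mx_on (R : realType) (S : finType) (E : {set S})
    (F : S -> S -> R) : 'M[R]_#|E| :=
  \matrix_(i, j) F (enum_val i) (enum_val j).

Definition col_on (R : realType) (S : finType) (E : {set S})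
    (F : S -> R) : 'cV[R]_#|E| :=
  \col_i F (enum_val i).

Record sgraph (V E : Type) := SGraph {
  org : E -> V ;
  bar : E -> E ;
  barK : involutive bar ;
  bar_neq : forall e, bar e <> e }.

Section Trees.
Context {V E : Type} (T : sgraph V E).

Definition tgt (e : E) : V := org T (bar T e).

Fixpoint walk (a : V) (w : seq E) (b : V) : Prop :=
  if w is e :: w' then org T e = a /\ walk (tgt e) w' b else a = b.

Fixpoint no_backtrack (w : seq E) : Prop :=
  if w is e :: w' then
    (if w' is f :: _ then f <> bar T e else True) /\ no_backtrack w'
  else True.

Definition is_tree : Prop :=
  [/\ inhabited V, (forall a b, exists w, walk a w b) &
      (forall a w, walk a w a -> no_backtrack w -> w = [::])].

End Trees.

(* A pair (H, G): a group [grp] of isometries together with a finite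
   graph-of-groups decomposition of it, given by the action of [grp] without
   inversions on the Bass-Serre tree [gT] with quotient the finite graph [gY]
   ([projV] and [projE] are the quotient maps), and the auxiliary choices of a
   base vertex, of lifts, and of the elements [tau]. *)
Record gog (R : realType) (X : metricType R) := Gog {
  grp : set (isom X) ;
  grpP : is_subgroup grp ;
  gV : finType ;
  gE : finType ;
  gY : sgraph gV gE ;
  tV : Type ;
  tE : Type ;
  gT : sgraph tV tE ;
  gT_tree : is_tree gT ;
  actV : isom X -> tV -> tV ;
  actE : isom X -> tE -> tE ;
  actV1 : forall a, actV 1%g a = a ;
  actE1 : forall e, actE 1%g e = e ;
  actVM : forall g h a, grp g -> grp h -> actV (g * h)%g a = actV g (actV h a) ;
  actEM : forall g h e, grp g -> grp h -> actE (g * h)%g e = actE g (actE h e) ;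
  act_org : forall g e, grp g -> org gT (actE g e) = actV g (org gT e) ;
  act_rev : forall g e, grp g -> bar gT (actE g e) = actE g (bar gT e) ;
  act_noinv : forall g e, grp g -> actE g e <> bar gT e ;
  projV : tV -> gV ;
  projE : tE -> gE ;
  proj_org : forall e, projV (org gT e) = org gY (projE e) ;
  proj_rev : forall e, projE (bar gT e) = bar gY (projE e) ;
  projV_orbit : forall a b,
    projV a = projV b <-> exists2 g, grp g & b = actV g a ;
  projE_orbit : forall e f,
    projE e = projE f <-> exists2 g, grp g & f = actE g e ;
  base : gV ;
  liftV : gV -> tV ;
  liftE : gE -> tE ;
  tau : gE -> isom X ;
  liftVK : forall v, projV (liftV v) = v ;
  liftEK : forall f, projE (liftE f) = f ;
  liftE_org : forall f, org gT (liftE f) = liftV (org gY f) ;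
  tau_grp : forall f, grp (tau f) ;
  liftE_tgt : forall f, tgt gT (liftE f) = actV (tau f) (liftV (tgt gY f)) ;
  liftE_rev : forall f,
    liftE (bar gY f) = actE (tau f)^-1%g (bar gT (liftE f)) ;
  tau_rev : forall f, tau (bar gY f) = (tau f)^-1%g }.

Section TransferData.
Context {R : realType} {X : metricType R} (D : gog X).
Implicit Types (x : X) (s : R) (e f : gE D) (c : set (isom X)).
Implicit Types (w : seq (gE D * set (isom X))).

Definition vgrp (v : gV D) : set (isom X) :=
  [set h | grp D h /\ actV h (liftV v) = liftV v].

Definition egrp f : set (isom X) :=
  [set h | grp D h /\ actE h (liftE f) = liftE f].

Definition cosets (v : gV D) f : set (set (isom X)) :=
  [set [set (r * h)%g | h in egrp f] | r in vgrp v].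

(* For [c = r G_f] the elements [r h], [h] in [G_f], are exactly the elements
   [k] of [c]. *)
Definition edge_length x f c : R :=
  inf [set mdist x ((k * tau f)%g x) | k in c].

(* [m f c] stands for [r h_f(c)] where [c = r G_f]. *)
Definition minimizing_choice x (m : gE D -> set (isom X) -> isom X) : Prop :=
  forall f c, cosets (org (gY D) f) f c ->
    c (m f c) /\ forall k, c k ->
      mdist x ((m f c * tau f)%g x) <= mdist x ((k * tau f)%g x).

Definition allowed e f c : Prop :=
  [/\ tgt (gY D) e = org (gY D) f, cosets (org (gY D) f) f c &
      (f = bar (gY D) e -> c <> egrp f)].

Definition transfer x s e f : \bar R :=
  \esum_(c in [set c | allowed e f c]) (expR (- s * edge_length x f c))%:E.

Fixpoint reduced_from e w : Prop :=
  if w is (f, c) :: w' then allowed e f c /\ reduced_from f w'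
  else tgt (gY D) e = base D.

Definition reduced_loop w : Prop :=
  if w is (f, c) :: w' then
    [/\ org (gY D) f = base D, cosets (org (gY D) f) f c & reduced_from f w']
  else True.

Definition trim : {set gE D} :=
  [set f | `[< exists2 w, reduced_loop w & f \in map fst w >]]%SET.

(* The Bass-Serre length of [h] is read off from its normal form, which is
   unique by Bass-Serre theory; [m] is the minimizing choice at [x]. *)
Definition normal_form (m : gE D -> set (isom X) -> isom X)
    (h : isom X) w (h0 : isom X) : Prop :=
  [/\ reduced_loop w, vgrp (base D) h0 &
      h = (\big[*%g/1%g]_(p <- w) (m p.1 p.2 * tau p.1) * h0)%g].

Definition bs_length x (m : gE D -> set (isom X) -> isom X)
    (h : isom X) : R :=
  xget 0 [set l | exists w h0, normal_form m h w h0 /\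
    l = \sum_(p <- w) edge_length x p.1 p.2 + mdist x (h0 x)].

Definition bs_series x m s : \bar R :=
  \esum_(h in grp D) (expR (- s * bs_length x m h))%:E.

Definition vertex_series x s : \bar R :=
  \esum_(h in vgrp (base D)) (expR (- s * mdist x (h x)))%:E.

Definition start_series x s f : \bar R :=
  if org (gY D) f == base D then
    \esum_(c in cosets (base D) f) (expR (- s * edge_length x f c))%:E
  else 0%E.

Definition end_vec f : R := (tgt (gY D) f == base D)%:R.

Definition transfer_mx x s : 'M[R]_#|trim| :=
  mx_on trim (fun e f => fine (transfer x s e f)).

Definition trim_series_finite x s : Prop :=
  [/\ (vertex_series x s < +oo)%E,
      (forall f, f \in trim -> (start_series x s f < +oo)%E) &
      (forall e f, e \in trim -> f \in trim -> (transfer x s e f < +oo)%E)].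

(* [1 + u^T (I - K)^-1 q] *)
Definition resolvent_factor x s : R :=
  1 + ((col_on trim (fun f => fine (start_series x s f)))^T
       *m invmx (1%:M - transfer_mx x s) *m col_on trim end_vec) 0 0.

Definition support_digraph x : rel (gE D) := fun e f =>
  [&& e \in trim, f \in trim &
      `[< exists2 s : R, 0 < s & transfer x s e f <> 0%E >]].

Definition cyclic_component x (C : {set gE D}) : Prop :=
  (exists2 e, e \in trim &
     C = [set f | connect (support_digraph x) e f &&
                  connect (support_digraph x) f e]%SET) /\
  (exists e p, [/\ p <> [::], path (support_digraph x) e p,
                   last e p = e & {subset e :: p <= C}]).

(* [F e f] is the finite set of cosets and [g e f c] the representative of
   [c] in [F e f]. *)
Definition hyperbolic_choice (C : {set gE D})
    (F : gE D -> gE D -> set (set (isom X)))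
    (g : gE D -> gE D -> set (isom X) -> isom X) : Prop :=
  forall e f, e \in C -> f \in C ->
    finite_set (F e f) /\
    forall c, F e f c ->
      [/\ allowed e f c, hyperbolic (g e f c) &
          exists2 k, c k & g e f c = (k * tau f)%g].

Definition comparison_mx (C : {set gE D})
    (F : gE D -> gE D -> set (set (isom X)))
    (g : gE D -> gE D -> set (isom X) -> isom X) x s : 'M[R]_#|C| :=
  mx_on C (fun e f => \sum_(c \in F e f) expR (- s * axial_length x (g e f c))).

Definition axial_exponent C F g x : \bar R :=
  ereal_inf [set s%:E | s in
    [set s : R | 0 < s /\ spectral_radius (comparison_mx C F g x s) < 1]].

End TransferData.

Definition axial_exponents (R : realType) (X : metricType R)
    (P : gog X -> Prop) : set (\bar R) :=
  [set sigma | exists (y : X) (D : gog X), P D /\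
     exists C F g, [/\ cyclic_component y C, @hyperbolic_choice R X D C F g &
                       sigma = axial_exponent C F g y]].

(* [ch v] is the child at the vertex [v], or [None] when the vertex group of
   [v] is not selected. *)
Inductive hierarchy (R : realType) (X : metricType R) :=
  | Terminal of set (isom X)
  | Node (D : gog X) of (gV D -> option (hierarchy X)).

Section Hierarchies.
Context {R : realType} {X : metricType R}.

Definition hroot (t : hierarchy X) : set (isom X) :=
  match t with Terminal H => H | Node D _ => grp D end.

Fixpoint well_formed (t : hierarchy X) : Prop :=
  match t with
  | Terminal H => is_subgroup H
  | Node D ch => forall v, match ch v with
      | Some t' => hroot t' = vgrp v /\ well_formed t'
      | None => True
      end
  end.

Fixpoint node_of (t : hierarchy X) (D' : gog X) : Prop :=
  match t with
  | Terminal _ => False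
  | Node D ch => D' = D \/ exists v, match ch v with
      | Some t' => node_of t' D'
      | None => False
      end
  end.

Definition hierarchy_in (G : set (isom X)) (t : hierarchy X) : Prop :=
  well_formed t /\ hroot t `<=` G.

End Hierarchies.

(* Main.v *)
Require Import Defs.
From mathcomp Require Import all_boot all_order all_algebra.
From mathcomp Require Import all_classical all_reals all_analysis.
From mathcomp Require Import finmap ring lra.

(** The assertions rest on the uniqueness of reduced walks in a tree and on the
   comparison of triangles with those of the hyperbolic plane.

   _The Bass-Serre series._ In a tree there is exactly one reduced walk between
   two vertices. A reduced coset-labelled word lifts to a reduced walk in the
   Bass-Serre tree, so words with the same end vertex and the same product up to
   the group of that vertex coincide ([elem_inj]), and every group element has
   a normal form ([normal_form_exists]). Hence the group is in bijection with the
   pairs of a reduced loop and an element of the base vertex group, lengths add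
   up, and the series is the product of the vertex series and of the sum over
   reduced loops ([bs_series_prod]). The transitions of a loop are trim, so the
   loops with first edge [f] and last edge [g] sum to [u_f] times the entry at
   [f], [g] of [1 + K + K^2 + ...]. For a nonnegative matrix the powers are
   summable if and only if the spectral radius is below [1], and then they sum to
   the resolvent ([spectral_radius_lt1], [neumann_cvg]): as [t] goes from [0] to
   [1], the solution of [y = 1 + t K y] stays nonnegative, and it
   bounds the partial sums. Conversely each trim transition lies on a loop, so a
   convergent loop sum bounds every path sum ([loop_sum_finite]).

   _Axial exponents._ A hyperbolic isometry [g] has an axis, so [d(y, g y)] is at
   most its axial length. Distinct words between the same edges have distinct
   products, again by uniqueness of reduced walks. For [s] above the critical
   exponent the powers of a comparison matrix are therefore summable, with sum
   bounded by the Poincare series, and the spectral radius is below [1]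
   ([axial_exponent_le]).

   _Dimension._ All the geometry comes from the comparison of a cevian of a
   triangle with its image in the half-plane, that is, from Stewart's inequality
   ([stewart]). It yields the triangle inequality
   [e^-(x|z) <= e^-(x|y) + e^-(y|z)] for points of the space
   ([exp_gromov_triangle]), and visual estimates on the boundary follow from those
   on the orbit.

   For the upper bound one covers the limit set by finitely many visual pieces of
   the far orbit ([hausdorff_measure_orbit_eq0]). If the action is
   convex-cobounded, the pieces are shadows of the orbit points at distance about
   [T], and [sum d^s] is at most a constant times a tail of the Poincare series. If
   the critical exponent is below [1], the pieces are subtrees of a spanning tree for
   the word length: consecutive vertices are at bounded distance, so the visual
   diameter of a subtree is at most a constant times the sum of [e^-d(o, g o)] over
   its vertices, and [x -> x^s] is subadditive for [s <= 1].

   For the lower bound let [s] be below the critical exponent. No direction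
   carries more than a fixed proportion of the Poincare series, because translating
   by a suitable element moves orbit points away from it ([away_sum]). So every
   orbit point has many further ones that turn away from the direction of the
   base point and are far from each other, enough for the weight [e^(-s d(o, g o))]
   of a vertex to be at most the sum over its children ([kids_exist]). If a cover
   has small total size, one can pass from each vertex to a child whose shadow
   meets little of it, and the limit of this branch lies outside the cover
   ([limit_set_measure_neq0]). *)

Set Implicit Arguments.
Unset Strict Implicit.
Unset Printing Implicit Defensive.

Import Order.TTheory GRing.Theory Num.Theory.
Import numFieldNormedType.Exports.

Local Open Scope classical_set_scope.
Local Open Scope ring_scope.

(** * Unordered sums *)

Section EsumTools.
Local Open Scope ereal_scope.
Context {R : realType}.

Lemma esum_subset {T : choiceType} (A B : set T) (f : T -> \bar R) :
  A `<=` B -> \esum_(i in A) f i <= \esum_(i in B) f i.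
Proof.
move=> AB; apply: ge_ereal_sup => /= _ [F [finF FA] <-].
by apply: esum_ge; exists F => //; split => // x /FA/AB.
Qed.

Lemma esum_inj_le {T T' : choiceType} (A : set T) (B : set T') (e : T -> T') (f : T' -> \bar R) :
  set_inj A e -> (forall x, A x -> B (e x)) ->
  \esum_(i in A) f (e i) <= \esum_(j in B) f j.
Proof.
move=> ei AB; rewrite -(esum_image A e f ei); apply: esum_subset.
by move=> _ [x Ax <-]; exact: AB.
Qed.

Lemma esum_ge1 {T : choiceType} (A : set T) (f : T -> \bar R) x :
  (forall i, 0 <= f i) -> A x -> f x <= \esum_(i in A) f i.
Proof.
move=> f0 Ax; rewrite -(@esum_set1 R T x f)//; apply: esum_subset.
by move=> _ ->.
Qed.

Lemma esumZ_le {T : choiceType} (c : \bar R) (A : set T) (f : T -> \bar R) :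
  0 <= c -> (forall i, 0 <= f i) ->
  \esum_(i in A) (c * f i) <= c * \esum_(i in A) f i.
Proof.
move=> c0 f0; apply: ge_ereal_sup => /= _ [F [finF FA] <-].
rewrite -ge0_mule_fsumr//.
by rewrite lee_wpmul2l//; apply: esum_ge; exists F.
Qed.

(** The reverse of [esumZ_le] follows by scaling back with [c^-1]; for [c = +oo]
   both sides are infinite as soon as one term is not zero. *)
Lemma esumZ {T : choiceType} (c : \bar R) (A : set T) (f : T -> \bar R) :
  0 <= c -> (forall i, 0 <= f i) ->
  \esum_(i in A) (c * f i) = c * \esum_(i in A) f i.
Proof.
move=> c0 f0; apply/eqP; rewrite eq_le esumZ_le//=.
case: c c0 => [c| |] //= c0.
  have [/eqP ->|cn0] := boolP (c == 0%R).
    by rewrite mul0e; apply: esum_ge0 => i Ai; rewrite mul0e.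
  have {cn0}c0 : (0 < c)%R by rewrite lt0r cn0 -lee_fin.
  have ci : 0 <= (c^-1)%:E by rewrite lee_fin invr_ge0 ltW.
  have := @esumZ_le _ (c^-1)%:E A (fun i => c%:E * f i) ci.
  have e i : (c^-1)%:E * (c%:E * f i) = f i.
    by rewrite muleA -EFinM mulVf ?gt_eqF// mul1e.
  rewrite (eq_esum (fun i _ => e i)) => h.
  have c0' : 0 <= c%:E by rewrite lee_fin ltW.
  have {}h := h (fun i => mule_ge0 c0' (f0 i)).
  apply: (le_trans (lee_wpmul2l _ h)); first by rewrite lee_fin ltW.
  by rewrite muleA -EFinM mulfV ?gt_eqF// mul1e.
have [[x [Ax fx]]|nx] := pselect (exists x, A x /\ f x != 0).
  apply: (@le_trans _ _ (+oo * f x)).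
    by rewrite [+oo * f x]gt0_mulye ?leey// lt0e fx f0.
  apply: (@esum_ge1 _ A (fun i => +oo * f i)) => // i.
  by rewrite mule_ge0.
rewrite esum1 ?mule0; first by apply: esum_ge0 => i _; rewrite mule_ge0.
move=> i Ai; apply/eqP; apply: contrapT => /negP h; apply: nx; by exists i.
Qed.

Lemma esum_prod {S T : choiceType} (A : set S) (B : set T) (f : S -> \bar R) (g : T -> \bar R) :
  (forall i, 0 <= f i) -> (forall i, 0 <= g i) ->
  \esum_(k in A `*` B) (f k.1 * g k.2) = (\esum_(i in A) f i) * (\esum_(j in B) g j).
Proof.
move=> f0 g0.
rewrite -(@esum_esum R S T A (fun=> B) (fun i j => f i * g j)); last first.
  by move=> *; rewrite mule_ge0.
rewrite (eq_esum (fun i _ => esumZ B (f0 i) g0)) muleC -esumZ//; last first.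
  by apply: esum_ge0 => *; exact: g0.
by apply: eq_esum => i _; rewrite muleC.
Qed.

Lemma esum_finite_set {T : choiceType} (A : set T) (f : T -> \bar R) (e : R) :
  (0 < e)%R -> (forall i, A i -> e%:E <= f i) -> \esum_(i in A) f i < +oo -> finite_set A.
Proof.
move=> e0 fe fin; apply: contrapT => /(@infinite_set_fset _ A) inf.
have f0 i : A i -> 0 <= f i by move=> /fe; apply: le_trans; rewrite lee_fin ltW.
have S0 : 0 <= \esum_(i in A) f i by apply: esum_ge0.
have /fineK SE : \esum_(i in A) f i \is a fin_num by rewrite ge0_fin_numE.
set s := fine _ in SE; pose n := (Num.truncn (s / e)).+1.
have [B BA nB] := inf n.
have : (e * n%:R)%:E <= \esum_(i in A) f i.
  apply: esum_ge; exists [set` B]; first by split.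
  apply: (@le_trans _ _ (\sum_(i \in [set` B]) e%:E)); last first.
    by apply: lee_fsum => // i Bi; apply: fe; apply: BA.
  rewrite fsbig_finite//= set_fsetK sumEFin big_const_seq count_predT iter_addr_0.
  by rewrite lee_fin -[(e *+ _)%R]mulr_natr ler_pM2l// ler_nat.
rewrite -SE lee_fin leNgt mulrC -ltr_pdivrMr//.
have s0 : (0 <= s / e)%R by rewrite divr_ge0 ?(ltW e0)//; rewrite -lee_fin SE.
by have /Num.Theory.truncn_itv/andP[_ ->] := s0.
Qed.

Lemma esum_tail {T : choiceType} (A : set T) (f : T -> \bar R) (e : R) :
  (0 < e)%R -> (forall i, 0 <= f i) -> \esum_(i in A) f i < +oo ->
  exists F, [/\ finite_set F, F `<=` A & \esum_(i in A `&` ~` F) f i <= e%:E].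
Proof.
move=> e0 f0 fin.
have S0 : 0 <= \esum_(i in A) f i by apply: esum_ge0.
have Sf : \esum_(i in A) f i \is a fin_num by rewrite ge0_fin_numE.
have [_ [F [finF FA] <-] hF] := ub_ereal_sup_adherent e0 Sf.
exists F; split => //.
have := esumID F A f (fun i _ => f0 i); rewrite (setIidr FA) (@esum_fset _ _ F)// => E.
have t0 : 0 <= \esum_(i in A `&` ~` F) f i by apply: esum_ge0.
have F0 : 0 <= \sum_(i \in F) f i by apply: fsume_ge0.
move: hF; rewrite -/(esum _ _) E.
rewrite E in Sf.
move: (\sum_(i \in F) f i) (\esum_(i in A `&` ~` F) f i) F0 t0 Sf => [a| |] [b| |]//= _ _ _.
rewrite !lte_fin lee_fin; lra.
Qed.

Lemma sum_esum_disjoint_le {S T : choiceType} (r : seq S) (K : S -> set T) (A : set T)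
    (f : T -> \bar R) : uniq r -> (forall i, 0 <= f i) ->
  (forall h, h \in r -> K h `<=` A) ->
  (forall h h' x, h \in r -> h' \in r -> K h x -> K h' x -> h = h') ->
  \sum_(h <- r) \esum_(x in K h) f x <= \esum_(x in A) f x.
Proof.
move=> + f0; elim: r A => [|h r IH] A /=; first by rewrite big_nil => *; apply: esum_ge0.
move=> /andP[hr ur] KA dis; rewrite big_cons (esumID (K h) A f (fun i _ => f0 i)).
apply: leeD.
  by apply: esum_subset => x Kx; split => //; apply: (KA h) => //; rewrite inE eqxx.
apply: IH => // [h' h'r|h1 h2 x h1r h2r]; last by apply: dis; rewrite inE ?h1r ?h2r orbT.
move=> x Kx; split; first by apply: (KA h') => //; rewrite inE h'r orbT.
move=> Khx; have e : h = h' by apply: (dis h h' x); rewrite ?inE ?eqxx ?h'r ?orbT.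
by rewrite e h'r in hr.
Qed.

(** A term is at most the sum [S], so that [f i <= S^(1-s) (f i)^s]. *)
Lemma power_esum_le {T : choiceType} (A : set T) (f : T -> R) (s : R) :
  (0 < s)%R -> (s <= 1)%R -> (forall i, (0 < f i)%R) ->
  \esum_(i in A) (f i)%:E < +oo ->
  ((fine (\esum_(i in A) (f i)%:E)) `^ s)%:E <= \esum_(i in A) ((f i) `^ s)%:E.
Proof.
move=> s0 s1 f0 fin.
have f0' i : 0 <= (f i)%:E by rewrite lee_fin ltW.
have S0 : 0 <= \esum_(i in A) (f i)%:E by apply: esum_ge0.
have /fineK SE : \esum_(i in A) (f i)%:E \is a fin_num by rewrite ge0_fin_numE.
set S := fine _ in SE *.
have : (0 <= S)%R by rewrite -lee_fin SE.
rewrite le_eqVlt => /orP[/eqP <-|Sp].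
  by rewrite powR0 ?gt_eqF//; apply: esum_ge0 => i _; rewrite lee_fin powR_ge0.
have h : S%:E <= (S `^ (1 - s))%:E * \esum_(i in A) ((f i) `^ s)%:E.
  rewrite -esumZ ?lee_fin ?powR_ge0//; last by move=> i; rewrite lee_fin powR_ge0.
  rewrite SE; apply: le_esum => i Ai; rewrite -EFinM lee_fin.
  have fS : (f i <= S)%R.
    by rewrite -lee_fin SE; apply: (@esum_ge1 _ A (fun i => (f i)%:E)).
  apply: (@le_trans _ _ ((f i) `^ (1 - s) * (f i) `^ s)%R).
    by rewrite -powRD ?subrK ?powRr1 ?(ltW (f0 i))// (gt_eqF (f0 i)) implybT.
  rewrite ler_wpM2r ?powR_ge0//; apply: ge0_ler_powR; rewrite ?nnegrE ?(ltW Sp)//.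
    by rewrite subr_ge0.
  by rewrite ltW.
move: h; have Sp1 : (0 < S `^ (1 - s))%R by rewrite powR_gt0.
have -> : S%:E = (S `^ (1 - s))%:E * (S `^ s)%:E.
  by rewrite -EFinM -powRD ?subrK ?powRr1 ?(ltW Sp)// (gt_eqF Sp) implybT.
by rewrite lee_pmul2l// lte_fin.
Qed.

End EsumTools.

(** * Nonnegative matrices and their spectral radius *)

Section NonnegativeMatrices.
Context {R : realType} {n : nat}.
Implicit Types (K N : 'M[R]_n) (t : R) (z : complex R) (y : 'cV[R]_n).

Definition cmx N : 'M[complex R]_n := map_mx (fun x => x%:C%C) N.

Definition entry_sum N : R := \sum_i \sum_j `|N i j|.

Lemma entry_sum_ge N i j : `|N i j| <= entry_sum N.
Proof.
rewrite /entry_sum (bigD1 i)//= (bigD1 j)//= -addrA lerDl addr_ge0//.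
  by rewrite sumr_ge0.
by rewrite sumr_ge0// => *; rewrite sumr_ge0.
Qed.

Lemma norm_realC (x : R) : `|x%:C%C| = (`|x|)%:C%C.
Proof. by rewrite normc_def /= expr0n/= addr0 sqrtr_sqr. Qed.

Lemma eigenvalue_le N z : eigenvalue (cmx N) z -> complex.Re `|z| <= entry_sum N.
Proof.
case/eigenvalueP => v vN v0.
pose S : complex R := \sum_j `|v ord0 j|.
have S0 : 0 < S.
  have /rV0Pn[j vj] := v0; rewrite /S (bigD1 j)//=.
  by rewrite ltr_pwDl ?normr_gt0// sumr_ge0.
have : `|z| * S <= (entry_sum N)%:C%C * S.
  rewrite /S mulr_sumr.
  apply: (@le_trans _ _ (\sum_j \sum_i `|v ord0 i| * (`|N i j|)%:C%C)).
    apply: ler_sum => j _; rewrite -normrM.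
    have -> : z * v ord0 j = \sum_i v ord0 i * (N i j)%:C%C.
      have /rowP/(_ j) := vN; rewrite !mxE => <-.
      by apply: eq_bigr => i _; rewrite !mxE.
    apply: le_trans (ler_norm_sum _ _ _) _; apply: ler_sum => i _.
    by rewrite normrM norm_realC.
  rewrite exchange_big /= mulr_sumr; apply: ler_sum => i _.
  rewrite -mulr_sumr mulrC ler_wpM2r// -rmorph_sum /= lecR.
  rewrite /entry_sum [leRHS](bigD1 i)//= lerDl sumr_ge0// => *.
  by rewrite sumr_ge0.
by rewrite (ler_pM2r S0) lecE/= => /andP[].
Qed.

Lemma cmxX N k : cmx (N ^+ k) = cmx N ^+ k.
Proof. by rewrite /cmx (rmorphXn (map_mx (real_complex R))). Qed.

Lemma eigenvalueX N z k : eigenvalue (cmx N) z -> eigenvalue (cmx (N ^+ k)) (z ^+ k).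
Proof.
case/eigenvalueP => v vN v0; apply/eigenvalueP; exists v => //.
rewrite cmxX; elim: k => [|k IH]; first by rewrite !expr0 scale1r mulmx1.
by rewrite exprSr mulmxA IH -scalemxAl vN scalerA -exprSr.
Qed.

Lemma norm_Re z : `|z| = (complex.Re `|z|)%:C%C.
Proof. by rewrite normc_def. Qed.

Lemma modX z k : complex.Re `|z ^+ k| = complex.Re `|z| ^+ k.
Proof. by rewrite normrX norm_Re -rmorphXn. Qed.

(** Summability makes the entries of some power [K^k] small, hence its
   eigenvalues, and these include the [k]-th powers of those of [K]. *)
Lemma spectral_radius_lt1 K :
  (exists B, forall m, \sum_(k < m) entry_sum (K ^+ k) <= B) ->
  spectral_radius K < 1.
Proof.
move=> [B hB].
have S0 k : 0 <= entry_sum (K ^+ k) by rewrite sumr_ge0// => *; rewrite sumr_ge0.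
have [k [k0 hk]] : exists k, (0 < k)%N /\ entry_sum (K ^+ k) <= 2^-1.
  apply: contrapT => /forallNP H.
  have B0 : 0 <= B by apply: le_trans (hB 0%N); rewrite big_ord0.
  pose m := (Num.truncn (2 * B)).+1.
  have m2 : 2 * B < m%:R.
    by have /Num.Theory.truncn_itv/andP[] : 0 <= 2 * B by rewrite mulr_ge0.
  have := hB m.+1; rewrite big_ord_recl => h.
  have : \sum_(i < m) 2^-1 <= \sum_(i < m) entry_sum (K ^+ bump 0 i).
    apply: ler_sum => i _; rewrite leNgt; apply/negP => lt.
    by apply: (H (bump 0 i)); split => //; rewrite ltW.
  rewrite sumr_const card_ord -mulr_natr; have := S0 0%N; lra.
pose r : R := expR (- (ln 2 / k%:R)).
have r1 : r < 1 by rewrite /r expR_lt1 oppr_lt0 divr_gt0 ?ln_gt0 ?ltr1n ?ltr0n.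
have rk : r ^+ k = 2^-1.
  rewrite /r -expRM_natr mulNr divfK ?pnatr_eq0 -?lt0n// expRN lnK// posrE; lra.
rewrite /spectral_radius; set E := [set _ | _ in _].
have Er x : E x -> x <= r.
  move=> [z /= ez <-]; rewrite -(@ler_pXn2r _ k) ?nnegrE ?expR_ge0//; last first.
    by have := normr_ge0 z; rewrite norm_Re lecR.
  rewrite rk -modX; apply: le_trans hk; apply: eigenvalue_le.
  exact: eigenvalueX.
case: (pselect (E !=set0)) => [E0|/set0P/negP/negPn/eqP ->]; last by rewrite sup0.
by apply: le_lt_trans r1; apply: ge_sup.
Qed.

Lemma real_eigenvalue_lt1 K t (v : 'rV[R]_n) : spectral_radius K < 1 ->
  v != 0 -> v *m K = t *: v -> t < 1.
Proof.
move=> rK v0 vK; apply: le_lt_trans rK.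
apply: (@le_trans _ _ (complex.Re `|t%:C%C|)).
  by rewrite norm_realC /= ler_norm.
rewrite /spectral_radius; apply: ub_le_sup.
  by exists (entry_sum K) => _ [z /= ez <-]; exact: eigenvalue_le.
exists t%:C%C => //=; apply/eigenvalueP; exists (map_mx (real_complex R) v).
  by rewrite -map_mxM vK map_mxZ.
by rewrite map_mx_eq0.
Qed.

Section Resolvent.
Context (K : 'M[R]_n) (K0 : forall i j, 0 <= K i j) (rK : spectral_radius K < 1).

(** Cramer's rule with polynomial entries: [d t] is the determinant of [1 - t K],
   and the solution of [y = 1 + t K y] has coordinates [p i t / d t], so that it
   moves continuously with [t]. *)
Let P : 'M[{poly R}]_n := 1%:M - 'X *: map_mx polyC K.
Let d : {poly R} := \det P.
Let p (i : 'I_n) : {poly R} := (\adj P *m (const_mx 1 : 'cV_n)) i 0.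

Let PE t : map_mx (horner_eval t) P = 1%:M - t *: K.
Proof.
apply/matrixP => i j; rewrite !mxE /horner_eval hornerD hornerN hornerM hornerX hornerC.
by case: (i == j); rewrite !hornerE.
Qed.

Let dE t : d.[t] = \det (1%:M - t *: K).
Proof. by rewrite -PE det_map_mx. Qed.

Let pE t : (1%:M - t *: K) *m (\col_i (p i).[t]) = d.[t] *: const_mx 1.
Proof.
have -> : \col_i (p i).[t] = \adj (1%:M - t *: K) *m const_mx 1.
  rewrite -PE; apply/colP => i; rewrite mxE [RHS]mxE /p mxE.
  transitivity ((\sum_j \adj P i j).[t]).
    by congr (_.[t]); apply: eq_bigr => j _; rewrite [X in _ * X]mxE mulr1.
  rewrite horner_sum; apply: eq_bigr => j _.
  by rewrite [const_mx 1 _ _]mxE mulr1 -map_mx_adj [RHS]mxE.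
by rewrite mulmxA mul_mx_adj mul_scalar_mx dE.
Qed.

(** A root [u] of [d] in ]0, 1] would make [u^-1 >= 1] an eigenvalue of [K]. *)
Let d_gt0 t : 0 <= t <= 1 -> 0 < d.[t].
Proof.
have d0 : d.[0] = 1 by rewrite dE scale0r subr0 det1.
have dn u : 0 <= u <= 1 -> d.[u] != 0.
  move=> /andP[]; rewrite le_eqVlt => /orP[/eqP <-|u0 u1]; first by rewrite d0 oner_eq0.
  rewrite dE; apply/negP => /eqP/eqP/det0P[v v0].
  rewrite mulmxBr mulmx1 -scalemxAr => /eqP; rewrite subr_eq0 => /eqP vK.
  have := @real_eigenvalue_lt1 K u^-1 v rK v0.
  rewrite {2}vK scalerA mulVf ?gt_eqF// scale1r => /(_ erefl).
  by rewrite invf_lt1// ltNge u1.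
move=> /andP[t0 t1]; rewrite ltNge; apply/negP => dt.
have [] := @polyrcf.poly_ivt R d 0 t t0; first by rewrite d0 mul1r.
move=> u; rewrite in_itv/= => /andP[u0 ut]; apply/negP.
by rewrite /root dn// u0 (le_trans ut).
Qed.

(** As [t] runs through [0, 1], the solution of [y = 1 + t K y] cannot leave the
   cone of nonnegative vectors, since inside the cone it satisfies [y >= 1]. *)
Let p_ge i : d.[1] <= (p i).[1].
Proof.
have gap t : 0 <= t <= 1 -> (forall j, 0 <= (p j).[t]) -> forall j, d.[t] <= (p j).[t].
  move=> /andP[t0 t1] pos j; have /colP/(_ j) := pE t.
  rewrite mulmxBl mul1mx !mxE mulr1 => <-; rewrite gerBl sumr_ge0// => k _.
  by rewrite !mxE !mulr_ge0.
pose f t := \big[Num.min/1]_j ((p j).[t] - d.[t] / 2).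
have fc : continuous f.
  rewrite /f; elim: (index_enum _) => [|j s IH] x.
    under [X in continuous_at _ X]eq_fun do rewrite big_nil; exact: cvg_cst.
  under [X in continuous_at _ X]eq_fun do rewrite big_cons.
  apply: (@continuous_min R R (fun t => (p j).[t] - d.[t] / 2)); last exact: IH.
  apply: cvgB; first exact: continuous_horner.
  by apply: cvgM; [exact: continuous_horner|exact: cvg_cst].
have fP t : 0 <= t <= 1 -> 0 < f t \/ f t < 0.
  move=> ht; have dt := d_gt0 ht.
  case: (pselect (forall j, 0 <= (p j).[t])) => [pos|/existsNP[j /negP]].
    left; rewrite /f; elim/big_ind: _ => [//|x y x0 y0|j _]; first by rewrite lt_min x0.
    by have := gap t ht pos j; lra.
  rewrite -ltNge => pj; right; rewrite /f (bigD1 j)//=.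
  by rewrite gt_min; apply/orP; left; lra.
have f0 : 0 < f 0.
  rewrite /f; elim/big_ind: _ => [//|x y x0 y0|j _]; first by rewrite lt_min x0.
  have /colP/(_ j) := pE 0; rewrite scale0r subr0 mul1mx !mxE mulr1 => ->.
  have := @d_gt0 0; rewrite lexx ler01 => /(_ isT); lra.
have f1 : 0 < f 1.
  case: (fP 1); rewrite ?lexx ?ler01// => f1.
  have [|c] := @IVT R f 0 1 0 ler01 (continuous_subspaceT fc).
    by rewrite ge_min le_max (ltW f0) (ltW f1) orbT.
  rewrite in_itv/= => hc fc0; have := fP c hc; rewrite fc0 ltxx; by case.
apply: gap; rewrite ?lexx ?ler01// => j.
have d1 : 0 < d.[1] by apply: d_gt0; rewrite lexx ler01.
have : f 1 <= (p j).[1] - d.[1] / 2 by rewrite /f (bigD1 j)//= ge_min lexx.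
lra.
Qed.

Let d1_gt0 : 0 < d.[1]. Proof. by apply: d_gt0; rewrite lexx ler01. Qed.

Lemma unit_sub_lt1 : 1%:M - K \in unitmx.
Proof.
rewrite unitmxE unitfE; have := d1_gt0.
by rewrite dE scale1r; apply: contraTneq => ->; rewrite ltxx.
Qed.

Lemma powers_ge0 k i j : 0 <= (K ^+ k) i j.
Proof.
elim: k i j => [|k IH] i j; first by rewrite expr0 mxE ler0n.
by rewrite exprS mxE sumr_ge0// => l _; rewrite mulr_ge0.
Qed.

(** Iterating [y = 1 + K y] exhibits the row sums of the partial sums of the
   powers of [K] as lower bounds of the nonnegative solution [y]. *)
Lemma powers_summable : exists B, forall m, \sum_(k < m) entry_sum (K ^+ k) <= B.
Proof.
pose y : 'cV[R]_n := \col_i ((p i).[1] / d.[1]).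
have yE : y = const_mx 1 + K *m y.
  apply/colP => i; have /colP/(_ i) := pE 1.
  rewrite scale1r mulmxBl mul1mx !mxE mulr1 => h.
  apply: (@mulfI _ d.[1]); first by rewrite gt_eqF.
  rewrite mulrDr mulr1 mulrC divfK ?gt_eqF// -[X in X + _]h addrC mulr_sumr.
  set A := \sum_j _; set C := \sum_j _.
  suff AeqC : A = C by rewrite AeqC; ring.
  by apply: eq_bigr => j _; rewrite !mxE; field; rewrite gt_eqF.
have y0 i : 0 <= y i 0 by rewrite mxE divr_ge0// ?(ltW d1_gt0)// (le_trans (ltW d1_gt0) (p_ge i)).
exists (\sum_i y i 0) => m.
rewrite /entry_sum exchange_big; apply: ler_sum => i _ /=.
suff -> : y i 0 = \sum_(k < m) \sum_j `|(K ^+ k) i j| + (K ^+ m *m y) i 0.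
  by rewrite lerDl mxE sumr_ge0// => j _; rewrite mulr_ge0// powers_ge0.
elim: m => [|m IH]; first by rewrite big_ord0 add0r expr0 mul1mx.
rewrite big_ord_recr /= -addrA IH; congr (_ + _).
rewrite {1}yE mulmxDr mxE exprSr mulmxA; congr (_ + _).
by rewrite mxE; apply: eq_bigr => j _; rewrite mxE mulr1 ger0_norm// powers_ge0.
Qed.

Lemma neumann_sum m : \sum_(k < m) K ^+ k = invmx (1%:M - K) *m (1%:M - K ^+ m).
Proof.
apply: (canRL (mulKmx unit_sub_lt1)).
elim: m => [|m IH]; first by rewrite big_ord0 mulmx0 expr0 subrr.
by rewrite big_ord_recr /= mulmxDr IH mulmxBl mul1mx exprS addrA subrK.
Qed.

Lemma entry_sum_cvg0 : entry_sum (K ^+ k) @[k --> \oo] --> (0 : R).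
Proof.
have [B hB] := powers_summable.
apply: cvg_series_cvg_0; apply: nondecreasing_is_cvgn.
  apply/nondecreasing_seqP => k; rewrite /series/= big_nat_recr//= lerDl.
  by rewrite sumr_ge0// => *; rewrite sumr_ge0.
by exists B => _ [k _ <-]; rewrite /series/= big_mkord.
Qed.

Lemma row_power_col_le (w : 'rV[R]_n) (q : 'cV[R]_n) N :
  `|(w *m N *m q) 0 0| <= (\sum_i \sum_j `|w 0 i| * `|q j 0|) * entry_sum N.
Proof.
rewrite mxE; under eq_bigr do rewrite mxE mulr_suml.
rewrite exchange_big /=; apply: le_trans (ler_norm_sum _ _ _) _.
rewrite mulr_suml; apply: ler_sum => i _.
apply: le_trans (ler_norm_sum _ _ _) _; rewrite mulr_suml; apply: ler_sum => j _.
rewrite !normrM mulrAC ler_wpM2l ?mulr_ge0// entry_sum_ge //.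
Qed.

(** The partial sums differ from the limit by a term in [K^m], which tends to [0]
   because the powers are summable. *)
Lemma neumann_cvg (u : 'rV[R]_n) (q : 'cV[R]_n) :
  \sum_(k < m) (u *m K ^+ k *m q) 0 0 @[m --> \oo] -->
  (u *m invmx (1%:M - K) *m q) 0 0.
Proof.
set L := (_ *m q) 0 0; pose w := u *m invmx (1%:M - K).
have -> : (fun m => \sum_(k < m) (u *m K ^+ k *m q) 0 0) =
    (fun m => L - (w *m K ^+ m *m q) 0 0).
  apply/funext => m; transitivity ((u *m (\sum_(k < m) K ^+ k) *m q) 0 0).
    by rewrite mulmx_sumr mulmx_suml summxE.
  by rewrite neumann_sum mulmxA -/w mulmxBr mulmx1 mulmxBl mxE [X in _ + X]mxE.
rewrite -[X in _ --> X]subr0; apply: cvgB; first exact: cvg_cst.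
apply/cvgr0Pnorm_lt => e e0.
set C := \sum_i \sum_j `|w 0 i| * `|q j 0|.
have C0 : 0 <= C by rewrite sumr_ge0// => *; rewrite sumr_ge0// => *; rewrite mulr_ge0.
have /cvgr0Pnorm_lt/(_ (e / (C + 1))) := entry_sum_cvg0.
rewrite divr_gt0 ?ltr_wpDl// => /(_ isT); apply: filterS => m hm.
apply: le_lt_trans (row_power_col_le _ _ _) _.
move: hm; rewrite ltr_pdivlMr ?ltr_wpDl// => hm; apply: le_lt_trans hm.
rewrite mulrC -/C; have := ler_norm (entry_sum (K ^+ m)).
by have := normr_ge0 (entry_sum (K ^+ m)); nra.
Qed.

End Resolvent.
End NonnegativeMatrices.

(** * Sums over labelled paths in a finite graph *)

Section Words.
Context {R : realType} {E : finType} {L : choiceType}.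
(** A path starting after the edge [e] lists the edges that follow, each with a
   label; [ok] and [wt] tell which labels are possible on two consecutive edges,
   and with which weight. *)
Context (ok : E -> E -> L -> Prop) (wt : E -> E -> L -> R).
Hypothesis wt_gt0 : forall e f c, 0 < wt e f c.
Implicit Types (e f g : E) (c : L) (w : seq (E * L)) (k : nat).
Local Open Scope ereal_scope.

Fixpoint wpath e w : Prop :=
  if w is (f, c) :: w' then ok e f c /\ wpath f w' else True.

Fixpoint weight e w : R :=
  if w is (f, c) :: w' then (wt e f c * weight f w')%R else 1%R.

Definition last_edge e w : E := last e (map fst w).

Definition label_sum e f : \bar R := \esum_(c in ok e f) (wt e f c)%:E.

Definition paths e f : set (seq (E * L)) := [set w | wpath e w /\ last_edge e w = f].

Definition paths_n k e f : set (seq (E * L)) := [set w | paths e f w /\ size w = k].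

Definition path_sum e f : \bar R := \esum_(w in paths e f) (weight e w)%:E.

Definition path_sum_n k e f : \bar R := \esum_(w in paths_n k e f) (weight e w)%:E.

Lemma weight_gt0 e w : (0 < weight e w)%R.
Proof. by elim: w e => [|[f c] w IH] e //=; rewrite mulr_gt0. Qed.

Lemma weight_ge0 e w : 0 <= (weight e w)%:E.
Proof. by rewrite lee_fin ltW// weight_gt0. Qed.

Lemma label_sum_ge0 e f : 0 <= label_sum e f.
Proof. by apply: esum_ge0 => c _; rewrite lee_fin ltW. Qed.

Lemma path_sum_ge0 e f : 0 <= path_sum e f.
Proof. by apply: esum_ge0 => w _; exact: weight_ge0. Qed.

Lemma path_sum_n_ge0 k e f : 0 <= path_sum_n k e f.
Proof. by apply: esum_ge0 => w _; exact: weight_ge0. Qed.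

Lemma wpath_cat e w w' : wpath e (w ++ w') <-> wpath e w /\ wpath (last_edge e w) w'.
Proof.
elim: w e => [|[f c] w IH] e /=; first by split => // -[].
by rewrite IH; split => [[h [h1 h2]]|[[h h1] h2]].
Qed.

Lemma last_edge_cat e w w' : last_edge e (w ++ w') = last_edge (last_edge e w) w'.
Proof. by rewrite /last_edge map_cat last_cat. Qed.

Lemma weight_cat e w w' : weight e (w ++ w') = (weight e w * weight (last_edge e w) w')%R.
Proof.
by elim: w e => [|[f c] w IH] e /=; [rewrite mul1r|rewrite IH mulrA].
Qed.

Lemma path_sumE e f : path_sum e f = \sum_(0 <= k <oo) path_sum_n k e f.
Proof.
rewrite nneseries_esumT; last by move=> k; exact: path_sum_n_ge0.
rewrite /path_sum_n -esum_bigcupT.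
- congr (esum _ _); apply/seteqP; split => w; first by move=> h; exists (size w).
  by case=> k _ [].
- by apply/trivIsetP => i j _ _ ij; apply/seteqP; split => // w [[_ wi] [_ wj]]; rewrite -wi -wj eqxx in ij.
- by move=> w; exact: weight_ge0.
Qed.

Lemma path_sum0 e f : path_sum_n 0 e f = ((e == f)%:R)%:E.
Proof.
rewrite /path_sum_n; have [<-|ef] := eqVneq e f.
  rewrite (_ : paths_n 0 e e = [set [::]]); first by rewrite esum_set1.
  by apply/seteqP; split => [w [_ /size0nil]|_ ->].
rewrite (_ : paths_n 0 e f = set0); first by rewrite esum_set0.
apply/seteqP; split => // w [[_ h] /size0nil w0]; rewrite w0 /last_edge /= in h.
by rewrite h eqxx in ef.
Qed.

Lemma esum_finType (F : E -> \bar R) : (forall e, 0 <= F e) ->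
  \esum_(e in [set: E]) F e = \sum_e F e.
Proof.
move=> F0; rewrite esum_fset//; last exact: finite_finset.
rewrite [RHS]fsbig_seq ?index_enum_uniq//.
rewrite (_ : [set: E] = [set` index_enum E])//.
by apply/seteqP; split => // x _ /=; rewrite mem_index_enum.
Qed.

(** The first step has a weight [a] and a constraint [A] of its own, because the
   first step of a loop follows no other edge. *)
Lemma esum_first_step (A : set (E * L)) (a : E * L -> R) (P : E -> set (seq (E * L))) :
  (forall p, 0 < a p)%R ->
  \esum_(w in [set w | exists p w', [/\ w = p :: w', A p & P p.1 w']])
    (if w is p :: w' then a p * weight p.1 w' else 1)%R%:E =
  \sum_f (\esum_(c in [set c | A (f, c)]) (a (f, c))%:E) * (\esum_(w in P f) (weight f w)%:E).
Proof.
move=> a0.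
have a0' p : 0 <= (a p)%:E by rewrite lee_fin ltW.
pose B : set ((E * L) * seq (E * L)) := A `*`` (fun p => P p.1).
rewrite (reindex_esum B _ (fun x => x.1 :: x.2)); last first.
  split.
  - by move=> [p w'] [/= Ap Pw]; exists p, w'.
  - by move=> [p w] [p' w'] _ _ [-> ->].
  - by move=> _ [p [w' [-> Ap Pw]]]; exists (p, w').
rewrite -(@esum_esum _ _ _ A (fun p => P p.1) (fun p w => (a p * weight p.1 w)%:E)%R); last first.
  by move=> p w _ _; rewrite lee_fin mulr_ge0 ?(ltW (a0 p))// ltW// weight_gt0.
under eq_esum => p _.
  rewrite (eq_esum (fun w _ => EFinM (a p) (weight p.1 w))) esumZ//; last first.
    by move=> w; exact: weight_ge0.
  over.
rewrite -esum_finType; last first.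
  move=> f; apply: mule_ge0; apply: esum_ge0 => // w _; exact: weight_ge0.
rewrite (eq_esum (b := fun f => \esum_(c in [set c | A (f, c)])
    ((a (f, c))%:E * \esum_(w in P f) (weight f w)%:E))); last first.
  move=> f _; rewrite muleC -esumZ//.
    by apply: eq_esum => c _; rewrite muleC.
  by apply: esum_ge0 => w _; exact: weight_ge0.
rewrite (@esum_esum _ _ _ _ _ (fun f c => (a (f, c))%:E * \esum_(w in P f) (weight f w)%:E)); last first.
  by move=> f c _ _; apply: mule_ge0 => //; apply: esum_ge0 => w _; exact: weight_ge0.
rewrite (_ : _ `*`` _ = A); first by apply: eq_esum => -[f c] _.
by apply/seteqP; split => -[f c] //= [].
Qed.

Lemma path_sumS k e f :
  path_sum_n k.+1 e f = \sum_g label_sum e g * path_sum_n k g f.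
Proof.
rewrite /label_sum.
have := @esum_first_step [set p | ok e p.1 p.2] (fun p => wt e p.1 p.2)
  (fun g => paths_n k g f) (fun p => wt_gt0 _ _ _) => /= <-.
rewrite /path_sum_n (_ : paths_n k.+1 e f = [set w | exists p w',
    [/\ w = p :: w', ok e p.1 p.2 & paths_n k p.1 f w']]).
  by apply: eq_esum => -[|[g c] w] //= [p [w' []]].
apply/seteqP; split => [[|[g c] w] [[//= [h1 h2] h3] [h4]]|w [[g c] [w' [-> h1 [[h2 h3] h4]]]]].
  by exists (g, c), w.
by split; [split|rewrite /= h4].
Qed.

Lemma path_weight_le e f w : paths e f w -> (weight e w)%:E <= path_sum e f.
Proof.
by move=> h; apply: (@esum_ge1 _ _ _ (fun w => (weight e w)%:E)) => // w'; exact: weight_ge0.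
Qed.

(** Prolongation by fixed paths at both ends is injective, so that path sums
   between two edges control those between edges that lie between them. *)
Lemma path_sum_prolong e e' f f' u v : paths e e' u -> paths f f' v ->
  (weight e u * weight f v)%:E * path_sum e' f <= path_sum e f'.
Proof.
move=> [pu lu] [pv lv]; rewrite /path_sum -esumZ; last 2 first.
- by rewrite lee_fin mulr_ge0// ltW// weight_gt0.
- by move=> w; exact: weight_ge0.
rewrite (eq_esum (b := fun w => (weight e (u ++ (w ++ v)))%:E)); last first.
  move=> w [pw lw]; rewrite -EFinM !weight_cat lu lw; congr EFin; ring.
apply: (@esum_inj_le _ _ _ _ _ (fun w => u ++ (w ++ v)) (fun w => (weight e w)%:E)).
  move=> w w' _ _ /eqP; rewrite eqseq_cat// eqxx /= => h.
  have sz : size w = size w' by have := congr1 size (eqP h); rewrite !size_cat => /addIn.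
  by move: h; rewrite eqseq_cat// => /andP[/eqP].
move=> w [pw lw]; split; last by rewrite !last_edge_cat lu lw.
by rewrite !wpath_cat lu lw.
Qed.

Lemma label_sum_le e f : label_sum e f <= path_sum e f.
Proof.
rewrite /label_sum; rewrite (eq_esum (b := fun c => (weight e [:: (f, c)])%:E)); last first.
  by move=> c _; rewrite /= mulr1.
apply: (@esum_inj_le _ _ _ _ _ (fun c => [:: (f, c)]) (fun w => (weight e w)%:E)).
  by move=> c c' _ _ [].
by move=> c okc; split.
Qed.

Section TransferMatrix.
Context (C : {set E}).
Hypothesis okC : forall e f c, ok e f c -> f \in C.
Hypothesis fin : forall e f, e \in C -> f \in C -> label_sum e f < +oo.

Definition label_mx : 'M[R]_#|C| := mx_on C (fun e f => fine (label_sum e f)).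

Lemma label_mx_ge0 i j : (0 <= label_mx i j)%R.
Proof. by rewrite mxE fine_ge0// label_sum_ge0. Qed.

Lemma path_sum_mx k i j :
  path_sum_n k (enum_val i) (enum_val j) = ((label_mx ^+ k)%R i j)%:E.
Proof.
elim: k i => [|k IH] i.
  by rewrite path_sum0 expr0 mxE (inj_eq enum_val_inj).
rewrite path_sumS exprS mxE -sumEFin.
transitivity (\sum_(g in C) label_sum (enum_val i) g * path_sum_n k g (enum_val j)).
  rewrite [RHS]big_mkcond; apply: eq_bigr => g _; case: ifPn => // gC.
  rewrite /label_sum (_ : ok (enum_val i) g = set0) ?esum_set0 ?mul0e//.
  by apply/seteqP; split => // c /okC; rewrite (negPf gC).
rewrite big_enum_val; apply: eq_bigr => g _; rewrite IH EFinM mxE fineK//.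
by rewrite ge0_fin_numE ?fin ?enum_valP// label_sum_ge0.
Qed.

(** Sorted by length, a path sum is the sum over [k] of an entry of the [k]-th
   power of the matrix. *)
Lemma path_sum_spectral : (forall e f, e \in C -> f \in C -> path_sum e f < +oo) ->
  (spectral_radius label_mx < 1)%R.
Proof.
move=> pfin; apply: spectral_radius_lt1.
exists (\sum_(i < #|C|) \sum_(j < #|C|) fine (path_sum (enum_val i) (enum_val j)))%R => m.
rewrite /entry_sum exchange_big; apply: ler_sum => i _ /=.
rewrite exchange_big; apply: ler_sum => j _ /=.
have pE : (fine (path_sum (enum_val i) (enum_val j)))%:E = path_sum (enum_val i) (enum_val j).
  by rewrite fineK// ge0_fin_numE ?pfin ?enum_valP// path_sum_ge0.
rewrite -lee_fin pE -sumEFin path_sumE.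
rewrite -[X in X <= _](big_mkord xpredT (fun k => (`|(label_mx ^+ k) i j|%R)%:E)).
rewrite (eq_bigr (fun k => path_sum_n k (enum_val i) (enum_val j))); last first.
  by move=> k _; rewrite path_sum_mx ger0_norm// -lee_fin -path_sum_mx path_sum_n_ge0.
by apply: nneseries_lim_ge => k *; exact: path_sum_n_ge0.
Qed.

Lemma path_sum_resolvent i j : (spectral_radius label_mx < 1)%R ->
  path_sum (enum_val i) (enum_val j) = ((invmx (1%:M - label_mx)) i j)%:E.
Proof.
move=> rho; rewrite path_sumE; apply/cvg_lim => //.
have := @neumann_cvg _ _ _ label_mx_ge0 rho (delta_mx ord0 i) (delta_mx j ord0).
have entry (N : 'M[R]_#|C|) : ((@delta_mx R 1 #|C| 0 i *m N *m @delta_mx R #|C| 1 j 0) 0 0 = N i j)%R.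
  by rewrite -rowE -colE !mxE.
rewrite entry => h.
rewrite (_ : (fun m => _) = (fun m => (\sum_(k < m) (label_mx ^+ k) i j)%R%:E)).
  apply: cvg_EFin; first exact: nearW.
  apply: cvg_trans h; apply: near_eq_cvg; apply: nearW => m /=.
  by apply: eq_bigr => k _; rewrite entry.
apply/funext => m; rewrite -sumEFin big_mkord; apply: eq_bigr => k _.
by rewrite path_sum_mx.
Qed.

End TransferMatrix.
End Words.

(** * Reduced walks in a tree *)

Section TreeWalks.
Context {V E : Type} (T : sgraph V E).
Implicit Types (a b : V) (e f : E) (w u : seq E).

Lemma tgt_bar e : tgt T (bar T e) = org T e.
Proof. by rewrite /tgt barK. Qed.

Lemma walk_cat a b c w u : walk T a w b -> walk T b u c -> walk T a (w ++ u) c.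
Proof. by elim: w a => [|e w IH] a /= => [->//|[-> /IH h] /h]. Qed.

Lemma walk_end a b c w : walk T a w b -> walk T a w c -> b = c.
Proof. by elim: w a => [|e w IH] a /= => [<- <-|[_ h1] [_ h2]] //; exact: IH h1 h2. Qed.

Fixpoint rev_walk w : seq E :=
  if w is e :: w' then rcons (rev_walk w') (bar T e) else [::].

Lemma walk_rev a b w : walk T a w b -> walk T b (rev_walk w) a.
Proof.
elim: w a => [|e w IH] a /=; first by move=> ->.
move=> [<- /IH h]; rewrite -cats1; apply: walk_cat h _ => /=; split => //.
by rewrite tgt_bar.
Qed.

Lemma no_backtrack_rcons2 w e f : no_backtrack T (rcons w e) -> f <> bar T e ->
  no_backtrack T (rcons (rcons w e) f).
Proof.
elim: w => [|g [|h w] IH] /= nb fe; first by [].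
- by case: nb => h1 _; split => //; split.
- by case: nb => h1 h2; split => //; exact: IH.
Qed.

Lemma no_backtrack_rev w : no_backtrack T w -> no_backtrack T (rev_walk w).
Proof.
elim: w => [|e [|f w] IH] //= [fe nb].
apply: no_backtrack_rcons2; first exact: IH.
by move=> h; apply: fe; rewrite h barK.
Qed.

Lemma no_backtrack_cat w e f u : no_backtrack T (rcons w e) -> no_backtrack T (f :: u) ->
  f <> bar T e -> no_backtrack T (rcons w e ++ f :: u).
Proof.
elim: w => [|g [|h w] IH] nb nu fe.
- by split.
- by case: nb => h1 _; split => //; split.
- by case: nb => h1 h2; split => //; exact: IH.
Qed.

Lemma no_backtrack_tail e w : no_backtrack T (e :: w) -> no_backtrack T w.
Proof. by case. Qed.

Context (treeT : is_tree T).

(** At the place where two reduced walks with the same ends separate, one of them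
   reversed and the other form a reduced closed walk. *)
Lemma reduced_walk_unique a b w u : walk T a w b -> walk T a u b ->
  no_backtrack T w -> no_backtrack T u -> w = u.
Proof.
have [_ _ acyc] := treeT.
elim: w a u => [|e w IH] a u.
  by move=> /= <- wu _ /(acyc _ _ wu) ->.
case: u => [|f u] ww wu nw nu.
  by move: wu => /= e'; rewrite e' in ww; have := acyc _ _ ww nw.
have [ef|ef] := pselect (e = f).
  subst f; congr cons; move: ww wu => [_ ww] [_ wu].
  exact: IH ww wu (no_backtrack_tail nw) (no_backtrack_tail nu).
exfalso; have := no_backtrack_rev nw => /= nr.
have h : no_backtrack T (rcons (rev_walk w) (bar T e) ++ f :: u).
  by apply: no_backtrack_cat => //; rewrite barK => h; apply: ef.
have := walk_cat (walk_rev ww) wu => hw.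
by have := acyc _ _ hw h; move=> /(congr1 size); rewrite size_cat /= addnS.
Qed.

Lemma reduced_walk_exists a b : exists w, walk T a w b /\ no_backtrack T w.
Proof.
have [_ conn _] := treeT; have [w] := conn a b.
elim: w a => [|e w IH] a /=; first by move=> ->; exists [::].
move=> [oe /IH[[|f u] [wu nu]]]; first by exists [:: e].
have [fe|fe] := pselect (f = bar T e).
  exists u; split; last exact: no_backtrack_tail nu.
  by move: wu => /= [_]; rewrite fe tgt_bar oe.
by exists (e :: f :: u); split => //; split.
Qed.

End TreeWalks.

(** * Normal forms in the fundamental group of a graph of groups *)

Section NormalForms.
Context {R : realType} {X : metricType R} (D : gog X).
Implicit Types (g h k : isom X) (v : gV D) (f : gE D) (c : set (isom X)).
Implicit Types (w : seq (gE D * set (isom X))).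

Let G1 : grp D 1%g. Proof. by case: (grpP D). Qed.
Let GM g h : grp D g -> grp D h -> grp D (g * h)%g.
Proof. by case: (grpP D) => _ + _; exact. Qed.
Let GV g : grp D g -> grp D g^-1%g. Proof. by case: (grpP D) => _ _; exact. Qed.

Lemma actVK g a : grp D g -> actV g^-1%g (actV g a) = a :> tV D.
Proof. by move=> Gg; rewrite -actVM ?mulVg ?actV1//; exact: GV. Qed.

Lemma actEK g a : grp D g -> actE g^-1%g (actE g a) = a :> tE D.
Proof. by move=> Gg; rewrite -actEM ?mulVg ?actE1//; exact: GV. Qed.

Lemma proj_actV g a : grp D g -> projV (actV g a : tV D) = projV a.
Proof. by move=> Gg; apply/esym/projV_orbit; exists g. Qed.

Lemma proj_actE g a : grp D g -> projE (actE g a : tE D) = projE a.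
Proof. by move=> Gg; apply/esym/projE_orbit; exists g. Qed.

Lemma tgt_actE g a : grp D g -> tgt (gT D) (actE g a) = actV g (tgt (gT D) a).
Proof. by move=> Gg; rewrite /tgt act_rev// act_org. Qed.

Lemma cosets_grp v f c k : cosets v f c -> c k -> grp D k.
Proof. by move=> [r [Gr _] <-] [h [Gh _] <-]; exact: GM. Qed.

Lemma cosets_vgrp f c k : cosets (org (gY D) f) f c -> c k -> vgrp (org (gY D) f) k.
Proof.
move=> [r [Gr rv] <-] [h [Gh he] <-]; split; first exact: GM.
by rewrite actVM// -liftE_org -act_org// he liftE_org.
Qed.

Lemma coset_eq f c k : cosets (org (gY D) f) f c -> c k -> c = [set (k * h)%g | h in egrp f].
Proof.
move=> [r [Gr rv] <-] [h [Gh he] <-]; apply/seteqP; split => _ [l [Gl le] <-].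
  exists (h^-1 * l)%g; last by rewrite -mulgA mulVKg.
  split; first by apply: GM => //; exact: GV.
  by rewrite actEM//; [rewrite le -{1}he actEK|exact: GV].
exists (h * l)%g; last by rewrite mulgA.
by split; [exact: GM|rewrite actEM// le].
Qed.

(** In a lifted walk the step after [g (lift f)] starts at the translate by
   [g tau f] of a chosen vertex lift; this is the form that a backtracking step
   takes there. *)
Lemma bar_lift g f : grp D g ->
  bar (gT D) (actE g (liftE f)) = actE (g * tau f)%g (liftE (bar (gY D) f)).
Proof.
move=> Gg; have Gt := tau_grp f.
rewrite liftE_rev -actEM; [|exact: GM|exact: GV].
by rewrite -mulgA mulgV mulg1 act_rev.
Qed.

Section Labels.
(** Admissible labels [ok] and coset representatives [rp] are left abstract, in
   order to cover both the representatives of minimal length in normal forms and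
   the hyperbolic ones in comparison matrices. The previous edge is an option,
   as nothing precedes the first edge of a loop. *)
Context (ok : option (gE D) -> gE D -> set (isom X) -> Prop).
Context (rp : option (gE D) -> gE D -> set (isom X) -> isom X).
Hypothesis okP : forall e f c, ok e f c ->
  [/\ cosets (org (gY D) f) f c, c (rp e f c) &
      forall e0, e = Some e0 -> f = bar (gY D) e0 -> c <> egrp f].

Fixpoint rpath v e w : Prop :=
  if w is (f, c) :: w' then
    [/\ org (gY D) f = v, ok e f c & rpath (tgt (gY D) f) (Some f) w']
  else True.

Fixpoint elem e w : isom X :=
  if w is (f, c) :: w' then (rp e f c * tau f * elem (Some f) w')%g else 1%g.

Fixpoint tree_walk g e w : seq (tE D) :=
  if w is (f, c) :: w' then
    actE (g * rp e f c)%g (liftE f) :: tree_walk (g * rp e f c * tau f)%g (Some f) w'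
  else [::].

Fixpoint end_vertex v w : gV D :=
  if w is (f, c) :: w' then end_vertex (tgt (gY D) f) w' else v.

Lemma rpath_cat v e w w' : rpath v e (w ++ w') <->
  rpath v e w /\ rpath (end_vertex v w) (last e (map (fun p => Some p.1) w)) w'.
Proof.
elim: w v e => [|[f c] w IH] v e /=; first by split => // -[].
split => [[h1 h2 /IH[h3 h4]]|[[h1 h2 h3] h4]]; first by [].
by split => //; apply/IH.
Qed.

Lemma end_vertex_cat v w w' : end_vertex v (w ++ w') = end_vertex (end_vertex v w) w'.
Proof. by elim: w v => [|[f c] w IH] v /=. Qed.

Lemma rp_grp e f c : ok e f c -> grp D (rp e f c).
Proof. by move=> /okP[cc ck _]; exact: cosets_grp cc ck. Qed.

Lemma elem_grp v e w : rpath v e w -> grp D (elem e w).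
Proof.
elim: w v e => [|[f c] w IH] v e /=; first by [].
move=> [_ /rp_grp h1 /IH h2]; apply: GM => //; apply: GM => //; exact: tau_grp.
Qed.

Lemma walk_tree_walk g v e w : grp D g -> rpath v e w ->
  walk (gT D) (actV g (liftV v)) (tree_walk g e w)
    (actV (g * elem e w)%g (liftV (end_vertex v w))).
Proof.
elim: w v e g => [|[f c] w IH] v e g Gg /=; first by rewrite mulg1.
move=> [fv okf pw]; have Gk := rp_grp okf; have [cc ck _] := okP okf.
have [_ kv] := cosets_vgrp cc ck; have Gt := tau_grp f.
split; first by rewrite act_org; [rewrite liftE_org actVM// kv fv|exact: GM].
have := IH (tgt (gY D) f) (Some f) (g * rp e f c * tau f)%g (GM (GM Gg Gk) Gt) pw.
rewrite !mulgA; congr (walk _ _ _ _).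
by rewrite tgt_actE; [rewrite liftE_tgt -actVM//; exact: GM|exact: GM].
Qed.

(** A backtracking step would put the representative of its coset into [G_f]. *)
Lemma tree_walk_reduced g v e w : grp D g -> rpath v e w ->
  no_backtrack (gT D) (tree_walk g e w).
Proof.
elim: w v e g => [|[f c] w IH] v e g Gg //= [fv okf pw].
have Gk := rp_grp okf; have Gt := tau_grp f.
split; last exact: (IH _ _ _ (GM (GM Gg Gk) Gt) pw).
case: w pw {IH} => [|[f' c'] w] //= [fv' okf' _].
have Gk' := rp_grp okf'; have Gg2 := GM (GM Gg Gk) Gt.
rewrite bar_lift; last exact: GM.
move=> h; have [cc' ck' nt'] := okP okf'.
have ff : f' = bar (gY D) f.
  by have := congr1 (@projE R X D) h; rewrite !proj_actE ?liftEK//; exact: GM.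
apply: (nt' f erefl ff); rewrite (coset_eq cc' ck').
move: h; rewrite actEM// -ff => /(congr1 (actE (g * rp e f c * tau f)^-1%g)).
rewrite !actEK// => hk.
apply/seteqP; split => [_ [l [Gl le] <-]|l [Gl le]].
  by split; [exact: GM|rewrite actEM// le].
exists ((rp (Some f) f' c')^-1 * l)%g; last by rewrite mulVKg.
split; first by apply: GM => //; exact: GV.
by rewrite actEM//; [rewrite le -{1}hk actEK|exact: GV].
Qed.

(** The edge [k (lift f)] determines the coset [k G_f], since [G_f] is the
   stabiliser of [lift f]. *)
Lemma tree_walk_inj g v v' e w w' : grp D g -> rpath v e w -> rpath v' e w' ->
  tree_walk g e w = tree_walk g e w' -> w = w'.
Proof.
elim: w v v' e g w' => [|[f c] w IH] v v' e g [|[f' c'] w'] Gg //=.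
move=> [fv okf pw] [fv' okf' pw'] [h hw].
have Gk := rp_grp okf; have Gk' := rp_grp okf'.
have [cc ck _] := okP okf; have [cc' ck' _] := okP okf'.
have ff : f = f'.
  by have := congr1 (@projE R X D) h; rewrite !proj_actE ?liftEK//; exact: GM.
subst f'.
have ec : c = c'.
  rewrite (coset_eq cc ck) (coset_eq cc' ck').
  move: h; rewrite !actEM// => /(congr1 (actE g^-1%g)); rewrite !actEK// => h.
  set k := rp e f c in Gk h *; set k' := rp e f c' in Gk' h *.
  apply/seteqP; split => _ [l [Gl le] <-].
    exists (k'^-1 * k * l)%g; last by rewrite -mulgA mulVKg.
    split; first by apply: GM => //; apply: GM => //; exact: GV.
    by rewrite actEM//; [rewrite le actEM//; [rewrite h actEK|exact: GV]|apply: GM => //; exact: GV].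
  exists (k^-1 * k' * l)%g; last by rewrite -mulgA mulVKg.
  split; first by apply: GM => //; apply: GM => //; exact: GV.
  by rewrite actEM//; [rewrite le actEM//; [rewrite -h actEK|exact: GV]|apply: GM => //; exact: GV].
subst c'; congr cons; apply: (IH _ _ _ _ _ _ pw pw' hw).
by apply: GM; [exact: GM|exact: tau_grp].
Qed.

(** Reduced words with the same end vertex and the same product, up to the group
   of that vertex, lift to reduced walks with the same ends in the tree, where such
   walks are unique. *)
Lemma elem_inj v e w w' h h' : rpath v e w -> rpath v e w' ->
  end_vertex v w = end_vertex v w' ->
  vgrp (end_vertex v w) h -> vgrp (end_vertex v w) h' ->
  (elem e w * h = elem e w' * h')%g -> w = w'.
Proof.
move=> pw pw' ev [Gh hv] [Gh' hv'] eh.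
have Ge := elem_grp pw; have Ge' := elem_grp pw'.
apply: (tree_walk_inj G1 pw pw').
have w1 := walk_tree_walk G1 pw; have w2 := walk_tree_walk G1 pw'.
rewrite !mul1g in w1 w2.
apply: (reduced_walk_unique (gT_tree D) w1 _ (tree_walk_reduced G1 pw) (tree_walk_reduced G1 pw')).
by rewrite -[liftV (end_vertex v w)]hv -actVM// eh actVM// hv' ev.
Qed.

Hypothesis ok_all : forall e f c, cosets (org (gY D) f) f c ->
  (forall e0, e = Some e0 -> f = bar (gY D) e0 -> c <> egrp f) -> ok e f c.

(** Labels are read off a reduced walk edge by edge; the last hypothesis forbids
   its first edge to undo the edge [e] that precedes it. *)
Lemma tree_walk_surj g v e u b : grp D g ->
  walk (gT D) (actV g (liftV v)) u b -> no_backtrack (gT D) u ->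
  (forall e0 E u', e = Some e0 -> u = E :: u' -> E <> actE g (liftE (bar (gY D) e0))) ->
  exists w, rpath v e w /\ tree_walk g e w = u.
Proof.
elim: u g v e => [|E u IH] g v e Gg /=; first by move=> _ _ _; exists [::].
move=> [oE wu] [jE nu] he.
pose f := projE E.
have [r' Gr' Er'] : exists2 r', grp D r' & E = actE r' (liftE f).
  by apply/projE_orbit; rewrite liftEK.
have ov : actV r' (liftV (org (gY D) f)) = actV g (liftV v).
  by rewrite -oE Er' act_org// liftE_org.
have fv : org (gY D) f = v.
  by have := congr1 (@projV R X D) ov; rewrite !proj_actV// !liftVK.
have GVg := GV Gg.
pose r := (g^-1 * r')%g.
have Gr : grp D r := GM GVg Gr'.
have rv : vgrp (org (gY D) f) r.
  by split => //; rewrite actVM// ov actVK// fv.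
pose c := [set (r * h)%g | h in egrp f].
have cc : cosets (org (gY D) f) f c by exists r.
have okf : ok e f c.
  apply: ok_all => // e0 ee fb ce; apply: (he e0 E u ee erefl).
  have : c r by exists 1%g; [split => //; exact: actE1|rewrite mulg1].
  by rewrite ce => -[_ hr]; rewrite Er' -fb -[in RHS]hr -actEM// /r mulVKg.
have [_ ck _] := okP okf; have Gk := rp_grp okf; have Gt := tau_grp f.
have kE : actE (g * rp e f c)%g (liftE f) = E.
  case: ck => h [Gh hh] <-; rewrite Er' mulgA actEM//; last exact: GM.
  by rewrite hh /r mulVKg.
have [||||w [pw tw]] := IH (g * rp e f c * tau f)%g (tgt (gY D) f) (Some f).
- by apply: GM => //; exact: GM.
- move: wu; rewrite -kE tgt_actE; [|exact: GM].
  by rewrite liftE_tgt -actVM//; exact: GM.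
- exact: nu.
- move=> e0 E' u' [<-] eu; move: jE; rewrite eu -kE bar_lift//; exact: GM.
by exists ((f, c) :: w); split; [split|rewrite /= kE tw].
Qed.

Lemma normal_form_exists g v : grp D g ->
  exists w h, [/\ rpath v None w, end_vertex v w = v, vgrp v h & g = (elem None w * h)%g].
Proof.
move=> Gg; have [u [wu nu]] := reduced_walk_exists (gT_tree D) (liftV v) (actV g (liftV v)).
have [||w [pw tw]] := @tree_walk_surj 1%g v None u (actV g (liftV v)) G1 _ nu.
- by rewrite actV1.
- by [].
have Ge := elem_grp pw.
have := walk_tree_walk G1 pw; rewrite actV1 tw mul1g => w2.
have ends : actV (elem None w) (liftV (end_vertex v w)) = actV g (liftV v).
  exact: walk_end w2 wu.
have ev : end_vertex v w = v.
  by have := congr1 (@projV R X D) ends; rewrite !proj_actV// !liftVK.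
exists w, ((elem None w)^-1 * g)%g; split => //; last by rewrite mulVKg.
split; first by apply: GM => //; exact: GV.
by rewrite actVM//; [rewrite -ends ev actVK|exact: GV].
Qed.

End Labels.
End NormalForms.

(** * The Bass-Serre series and the transfer matrix *)

Section BassSerreSeries.
Context {R : realType} {X : metricType R} (D : gog X) (x : X) (s : R).
Context (m : gE D -> set (isom X) -> isom X) (m_min : minimizing_choice x m).
Implicit Types (g h k : isom X) (v : gV D) (f : gE D) (c : set (isom X)).
Implicit Types (w : seq (gE D * set (isom X))).
Local Notation Y := (gY D).

Definition loop_ok (e : option (gE D)) f c : Prop :=
  cosets (org Y f) f c /\ forall e0, e = Some e0 -> f = bar Y e0 -> c <> egrp f.

Let rp (e : option (gE D)) f c := m f c.

Lemma loop_okP (e : option (gE D)) f c : loop_ok e f c ->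
  [/\ cosets (org Y f) f c, c (rp e f c) &
      forall e0, e = Some e0 -> f = bar Y e0 -> c <> egrp f].
Proof. by move=> [cc h]; split => //; have [] := m_min cc. Qed.

Local Notation rpath := (rpath loop_ok).
Local Notation elem := (elem rp).

Lemma reduced_fromE e w : reduced_from e w <->
  rpath (tgt Y e) (Some e) w /\ end_vertex (tgt Y e) w = base D.
Proof.
elim: w e => [|[f c] w IH] e /=; first by split => // -[].
split => [[[h1 h2 h3] /IH[h4 h5]]|[[h1 [h2 h3] h4] h5]].
  by split => //; split => //; split => // e0 [<-].
split; last by apply/IH.
by split => //; exact: h3.
Qed.

Lemma reduced_loopE w : reduced_loop w <->
  rpath (base D) None w /\ end_vertex (base D) w = base D.
Proof.
case: w => [|[f c] w] /=; first by split.
split => [[h1 h2 /reduced_fromE[h3 h4]]|[[h1 [h2 _] h3] h4]]; first by split.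
by split => //; apply/reduced_fromE.
Qed.

Lemma elemE e w : elem e w = (\big[*%g/1%g]_(p <- w) (m p.1 p.2 * tau p.1))%g.
Proof. by elim: w e => [|[f c] w IH] e /=; rewrite ?big_nil// big_cons IH. Qed.

Lemma normal_form_ex h : grp D h -> exists w h0, normal_form m h w h0.
Proof.
move=> Gh; have [|w [h0 [pw ew vh hE]]] := normal_form_exists loop_okP _ (base D) Gh.
  by move=> e f c cc h'.
exists w, h0; split => //; first by apply/reduced_loopE.
by rewrite -(elemE None).
Qed.

Lemma normal_form_inj h w h0 w' h0' :
  normal_form m h w h0 -> normal_form m h w' h0' -> w = w' /\ h0 = h0'.
Proof.
move=> [/reduced_loopE[p e] vh hE] [/reduced_loopE[p' e'] vh' hE'].
rewrite -(elemE None) in hE; rewrite -(elemE None) in hE'.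
have ww : w = w'.
  apply: (elem_inj loop_okP p p' _ (h := h0) (h' := h0')); rewrite ?e ?e'//.
  by rewrite -hE.
split => //; subst w'; rewrite hE' in hE.
by have := congr1 (fun k => ((elem None w)^-1 * k)%g) hE; rewrite !mulKg.
Qed.

Definition loop_length w : R := \sum_(p <- w) edge_length x p.1 p.2.

Lemma bs_lengthE h w h0 : normal_form m h w h0 ->
  bs_length x m h = loop_length w + mdist x (h0 x).
Proof.
move=> nf; rewrite /bs_length; case: xgetP => [l _ [w' [h' [nf' ->]]]|/(_ (loop_length w + mdist x (h0 x)))].
  by have [<- <-] := normal_form_inj nf nf'.
by case; exists w, h0.
Qed.

Lemma normal_form_grp h w h0 : normal_form m h w h0 -> grp D h.
Proof.
move=> [/reduced_loopE[p _] [Gh0 _] ->]; rewrite -(elemE None).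
have [_ GM _] := grpP D; apply: GM => //; exact: (elem_grp loop_okP p).
Qed.

Definition loop_sum : \bar R := \esum_(w in [set w | reduced_loop w]) (expR (- s * loop_length w))%:E.

(** Normal forms identify the group with the pairs of a reduced loop and an
   element of the base vertex group, and the two lengths add up. *)
Lemma bs_series_prod : bs_series x m s = (loop_sum * vertex_series D x s)%E.
Proof.
rewrite /loop_sum /vertex_series -esum_prod; last 2 first.
- by move=> w; rewrite lee_fin expR_ge0.
- by move=> g; rewrite lee_fin expR_ge0.
have nfP (p : seq (gE D * set (isom X)) * isom X) :
    ([set w | reduced_loop w] `*` vgrp (base D)) p ->
    normal_form m (elem None p.1 * p.2)%g p.1 p.2.
  by move=> [rl vh]; split => //; rewrite elemE.
rewrite /bs_series (reindex_esum ([set w | reduced_loop w] `*` vgrp (base D)) _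
  (fun p => (elem None p.1 * p.2)%g)); last first.
  split.
  - by move=> p /nfP /normal_form_grp.
  - move=> [w h] [w' h'] /set_mem/nfP nf /set_mem/nfP nf' e; rewrite e in nf.
    by have /= [-> ->] := normal_form_inj nf nf'.
  - move=> h /normal_form_ex[w [h0 [rl vh hE]]]; exists (w, h0) => //.
    by rewrite hE elemE.
apply: eq_esum => p /nfP nf; rewrite (bs_lengthE nf) -EFinM -expRD; congr (expR _)%:E; ring.
Qed.

Definition edge_weight (e f : gE D) c : R := expR (- s * edge_length x f c).

Lemma edge_weight_gt0 e f c : 0 < edge_weight e f c. Proof. exact: expR_gt0. Qed.

Lemma weightE e w : weight edge_weight e w = expR (- s * loop_length w).
Proof.
elim: w e => [|[f c] w IH] e /=; first by rewrite /loop_length big_nil mulr0 expR0.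
by rewrite IH /loop_length big_cons /edge_weight -expRD mulrDr.
Qed.

Definition trim_ok (e f : gE D) c : Prop := [/\ e \in trim D, f \in trim D & allowed e f c].

Lemma trimP f : f \in trim D <-> exists2 w, reduced_loop w & f \in map fst w.
Proof. by rewrite inE; split => [/asboolP|] //; move=> h; apply/asboolP. Qed.

Lemma loop_split f : f \in trim D -> exists w1 c w2, reduced_loop (w1 ++ (f, c) :: w2).
Proof.
move=> /trimP[w rl /mapP[[f' c] /= pw ->]].
by case/splitPr: pw rl => w1 w2 rl; exists w1, c, w2.
Qed.

Lemma reduced_from_suffix w1 f c w2 : reduced_loop (w1 ++ (f, c) :: w2) -> reduced_from f w2.
Proof.
move=> /reduced_loopE[/rpath_cat[_ /= [_ _ h]]]; rewrite end_vertex_cat /= => ev.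
by apply/reduced_fromE.
Qed.

(** The beginning of a loop through [e], followed by [f] and [w], is a loop. *)
Lemma trim_step e f c w : e \in trim D -> allowed e f c -> reduced_from f w -> f \in trim D.
Proof.
move=> /loop_split[w1 [c0 [w2 /reduced_loopE[/rpath_cat[p1 /= [oe oke _]] _]]]] al rf.
apply/trimP; exists (w1 ++ (e, c0) :: (f, c) :: w); last first.
  by rewrite map_cat mem_cat /= !inE eqxx !orbT.
have rfe : reduced_from e ((f, c) :: w) by [].
have [q1 q2] := (reduced_fromE e ((f, c) :: w)).1 rfe.
apply/reduced_loopE; rewrite end_vertex_cat; split => //.
by apply/rpath_cat; split.
Qed.

Lemma reduced_from_wpath e w : e \in trim D ->
  reduced_from e w <-> wpath trim_ok e w /\ tgt Y (last_edge e w) = base D.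
Proof.
elim: w e => [|[f c] w IH] e te; first by split => [|[]].
split => [[al rf]|[[[_ tf al] pw] h]].
  have tf := trim_step te al rf; have [pw h] := (IH f tf).1 rf.
  by split => //; split.
by split => //; apply/(IH f tf).
Qed.

Lemma reduced_loop_cons f c w :
  reduced_loop ((f, c) :: w) <->
  [/\ f \in trim D, org Y f = base D, cosets (base D) f c & reduced_from f w].
Proof.
split => [rl|[tf h1 h2 h3]]; last by split => //; rewrite h1.
have := rl => -[h1 h2 h3]; split => //; last by rewrite -h1.
by apply/trimP; exists ((f, c) :: w) => //; rewrite inE eqxx.
Qed.

Lemma prefix_path e c w1 w2 : reduced_loop (w1 ++ (e, c) :: w2) ->
  exists f0 c0 u, [/\ f0 \in trim D, org Y f0 = base D, cosets (base D) f0 c0 &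
    paths trim_ok f0 e u].
Proof.
case: w1 => [|[f0 c0] w1] rl.
  have /reduced_loop_cons[tf h1 h2 _] := rl.
  by exists e, c, [::].
have /reduced_loop_cons[tf h1 h2 /(reduced_from_wpath _ tf)[h _]] := rl.
exists f0, c0, (w1 ++ [:: (e, c)]); split => //; split; last first.
  by rewrite last_edge_cat.
have : wpath trim_ok f0 (w1 ++ (e, c) :: w2) := h.
by rewrite -cat_rcons -cats1 => /wpath_cat[].
Qed.

Local Notation psum := (path_sum trim_ok edge_weight).
Local Open Scope ereal_scope.

Lemma start_seriesE f : org Y f = base D ->
  start_series x s f = \esum_(c in cosets (base D) f) (expR (- s * edge_length x f c))%:E.
Proof. by rewrite /start_series => ->; rewrite eqxx. Qed.

Lemma start_series_ge0 f : 0 <= start_series x s f.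
Proof.
rewrite /start_series; case: ifP => // _.
by apply: esum_ge0 => c _; rewrite lee_fin expR_ge0.
Qed.

Lemma closing_sum f : f \in trim D ->
  \esum_(w in [set w | reduced_from f w]) (weight edge_weight f w)%:E =
  \sum_(g in trim D | tgt Y g == base D) psum f g.
Proof.
move=> tf.
have tl w : wpath trim_ok f w -> last_edge f w \in trim D.
  by elim: w f tf => [|[g c] w IH] f tf //= [[_ tg _] pw]; exact: (IH g).
transitivity (\esum_(w in [set w | reduced_from f w])
    \sum_(g in trim D | tgt Y g == base D)
      if w \in [set w | last_edge f w = g] then (weight edge_weight f w)%:E else 0).
  apply: eq_esum => w /(reduced_from_wpath _ tf)[pw lw].
  rewrite (bigD1 (last_edge f w))/=; last by rewrite tl// lw eqxx.
  rewrite ifT ?mem_set// big1 ?adde0// => g /andP[_ ne].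
  by rewrite ifF//; apply/negP => /set_mem /= h; rewrite h eqxx in ne.
rewrite esum_sum; last by move=> w g _ _; case: ifP => // _; apply: weight_ge0; exact: edge_weight_gt0.
apply: eq_bigr => g /andP[tg /eqP bg]; rewrite -esum_mkcondr; congr (esum _ _).
apply/seteqP; split => w [].
  by move=> /(reduced_from_wpath _ tf)[pw _] lw; split.
by move=> pw lw; split => //; apply/(reduced_from_wpath _ tf); rewrite lw.
Qed.

(** A nonempty reduced loop is a coset at the base vertex followed by a path of
   transitions, and both only involve trim edges. *)
Lemma loop_sumE : loop_sum = 1 + \sum_(f in trim D)
  start_series x s f * \sum_(g in trim D | tgt Y g == base D) psum f g.
Proof.
rewrite /loop_sum (esumID [set [::]] _ (fun w => (expR (- s * loop_length w))%:E)); last first.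
  by move=> *; rewrite lee_fin expR_ge0.
congr (_ + _).
  rewrite (_ : _ `&` _ = [set [::]]).
    by rewrite esum_set1 ?lee_fin ?expR_ge0// /loop_length big_nil mulr0 expR0.
  by apply/seteqP; split => [w []//|w ->]; split.
pose A := [set p : gE D * set (isom X) | org Y p.1 = base D /\ cosets (base D) p.1 p.2].
pose a (p : gE D * set (isom X)) := expR (- s * edge_length x p.1 p.2)%R.
have := @esum_first_step R _ _ edge_weight edge_weight_gt0 A a
   (fun f => [set w | reduced_from f w]) (fun p => expR_gt0 _).
rewrite (_ : [set w | exists p w', _] = [set w | reduced_loop w] `&` ~` [set [::]]); last first.
  apply/seteqP; split => [w [[f c] [w' [-> [/= h1 h2] h3]]]|[|[f c] w] [//= [h1 h2 h3] _]].
    by split => //; split => //; rewrite h1.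
  by exists (f, c), w; split => //; split => //=; rewrite -h1.
move=> h; transitivity (\sum_f (\esum_(c in [set c | A (f, c)]) (a (f, c))%:E) *
    (\esum_(w in [set w | reduced_from f w]) (weight edge_weight f w)%:E)).
  rewrite -h; apply: eq_esum => -[|[f c] w] [_ ne]; first by case: ne.
  by rewrite /= weightE /a -expRD /loop_length big_cons mulrDr.
rewrite [RHS]big_mkcond; apply: eq_bigr => f _.
have [hb|hb] := eqVneq (org Y f) (base D); last first.
  rewrite (_ : [set c | A (f, c)] = set0) ?esum_set0 ?mul0e.
    by case: ifP => // _; rewrite /start_series (negPf hb) mul0e.
  by apply/seteqP; split => // c [/= h1]; rewrite h1 eqxx in hb.
have EA : [set c | A (f, c)] = cosets (base D) f.
  by apply/seteqP; split => [c []//|c].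
case: ifPn => tf; first by rewrite EA closing_sum// start_seriesE.
have [nw|/existsNP[w /contrapT rf]] := pselect (forall w, ~ reduced_from f w).
  rewrite (_ : [set w | reduced_from f w] = set0) ?esum_set0 ?mule0//.
  by apply/seteqP; split => // w /nw.
rewrite (_ : [set c | A (f, c)] = set0) ?esum_set0 ?mul0e//.
apply/seteqP; split => // c; rewrite EA => cc.
have /reduced_loop_cons[tf'] : reduced_loop ((f, c) :: w) by split => //; rewrite hb.
by rewrite tf' in tf.
Qed.

Lemma loop_sum_trim0 : trim D = finset.set0 -> loop_sum = 1.
Proof. by rewrite loop_sumE => ->; rewrite big_pred0 ?adde0// => f; rewrite inE. Qed.

Lemma label_sum_transfer e f : e \in trim D -> f \in trim D ->
  label_sum trim_ok edge_weight e f = transfer x s e f.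
Proof.
move=> te tf; rewrite /label_sum /transfer; congr (esum _ _).
by apply/seteqP; split => [c []//|c al]; split.
Qed.

Lemma transfer_mxE : transfer_mx D x s = label_mx trim_ok edge_weight (trim D).
Proof.
apply/matrixP => i j; rewrite !mxE label_sum_transfer ?enum_valP//.
Qed.

Let trim_okC e f c : trim_ok e f c -> f \in trim D. Proof. by case. Qed.

Lemma vertex_series_ge1 : 1 <= vertex_series D x s.
Proof.
have <- : (expR (- s * mdist x ((1%g : isom X) x)))%:E = 1.
  by rewrite /= mdistxx mulr0 expR0.
apply: (@esum_ge1 _ _ _ (fun h : isom X => (expR (- s * mdist x (h x)))%:E)).
  by move=> h; rewrite lee_fin expR_ge0.
by split; [case: (grpP D)|exact: actV1].
Qed.

Lemma loop_sum_resolvent : trim_series_finite D x s ->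
  (spectral_radius (transfer_mx D x s) < 1)%R ->
  loop_sum = (resolvent_factor D x s)%:E.
Proof.
move=> [_ ufin Kfin] rho.
have fin e f : e \in trim D -> f \in trim D -> label_sum trim_ok edge_weight e f < +oo.
  by move=> te tf; rewrite label_sum_transfer// Kfin.
rewrite transfer_mxE in rho.
rewrite loop_sumE /resolvent_factor EFinD transfer_mxE; congr (_ + _).
rewrite mxE -sumEFin.
pose u (i : 'I_#|trim D|) := fine (start_series x s (enum_val i)).
pose N := invmx (1%:M - label_mx trim_ok edge_weight (trim D)).
pose q (i : 'I_#|trim D|) : R := end_vec (enum_val i).
transitivity (\sum_i (u i * \sum_j N i j * q j)%R%:E).
  rewrite big_enum_val; apply: eq_bigr => i _.
  rewrite EFinM /u fineK; last by rewrite ge0_fin_numE ?ufin ?enum_valP// start_series_ge0.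
  congr (_ * _); rewrite big_mkcondr big_enum_val -sumEFin; apply: eq_bigr => j _.
  rewrite (path_sum_resolvent edge_weight_gt0 trim_okC fin)// /q /end_vec -/N.
  by case: ifP => _; rewrite ?mulr1 ?mulr0.
rewrite !sumEFin; congr EFin.
under eq_bigr do rewrite mulr_sumr.
rewrite exchange_big; apply: eq_bigr => j _; rewrite !mxE mulr_suml.
by apply: eq_bigr => i _; rewrite !mxE mulrA.
Qed.

(** Necessity: every trim transition occurs inside some reduced loop, so a
   convergent loop series dominates all path sums. *)
Lemma loop_sum_finite : loop_sum < +oo ->
  [/\ forall f, f \in trim D -> start_series x s f < +oo,
      forall e f, e \in trim D -> f \in trim D -> transfer x s e f < +oo &
      (spectral_radius (transfer_mx D x s) < 1)%R].
Proof.
move=> lfin; have ew0 := edge_weight_gt0.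
have pge e f : 0 <= psum e f by apply: path_sum_ge0.
(* a path from every trim edge back to the base vertex *)
have coreach f : f \in trim D -> exists (v : seq (gE D * set (isom X))) (g : gE D),
    [/\ g \in trim D, tgt Y g = base D & paths trim_ok f g v].
  move=> tf; have [w1 [c [w2 rl]]] := loop_split tf.
  have /(reduced_from_wpath _ tf)[pw lw] := reduced_from_suffix rl.
  exists w2, (last_edge f w2); split => //.
  elim: w2 f tf pw {rl lw} => [|[g d] w2 IH] f tf //= [[_ tg _] pw]; exact: (IH g).
have term f (g : gE D) : f \in trim D -> g \in trim D -> tgt Y g = base D ->
    start_series x s f * psum f g <= loop_sum.
  move=> tf tg bg; rewrite loop_sumE.
  apply: (@le_trans _ _ (\sum_(f in trim D)
    start_series x s f * \sum_(g in trim D | tgt Y g == base D) psum f g)); last by rewrite leeDr.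
  rewrite (bigD1 f)//= (bigD1 g)/=; last by rewrite tg bg eqxx.
  apply: (@le_trans _ _ (start_series x s f * (psum f g +
      \sum_(i in trim D | (tgt Y i == base D) && (i != g)) psum f i))).
    by apply: lee_wpmul2l; [exact: start_series_ge0|rewrite leeDl// sume_ge0].
  rewrite (eq_bigl _ _ (fun i => andbA _ _ _)) leeDl// sume_ge0// => i _.
  by rewrite mule_ge0 ?start_series_ge0// sume_ge0.
have pfin e f : e \in trim D -> f \in trim D -> psum e f < +oo.
  move=> te tf; have [v [g [tg bg pv]]] := coreach f tf.
  have [w1 [c [w2 /prefix_path[f0 [c0 [u [t0 b0 cc pu]]]]]]] := loop_split te.
  have h1 := term f0 g t0 tg bg; have h2 := path_sum_prolong ew0 pu pv.
  have u0 : (edge_weight f0 f0 c0)%:E <= start_series x s f0.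
    rewrite start_seriesE//; apply: (@esum_ge1 _ _ _ (fun c => (edge_weight f0 f0 c)%:E)) => //.
    by move=> c'; rewrite lee_fin ltW.
  have : (edge_weight f0 f0 c0)%:E *
      ((weight edge_weight f0 u * weight edge_weight f v)%:E * psum e f) < +oo.
    apply: le_lt_trans lfin; apply: le_trans h1; apply: lee_pmul => //.
      by rewrite lee_fin ltW.
    by rewrite mule_ge0// lee_fin mulr_ge0// ltW// weight_gt0.
  move: (pge e f); case: (psum e f) => [r| |] h0; [by move=> _; exact: ltry| |by []].
  rewrite !gt0_muley// ?lte_fin// mulr_gt0// weight_gt0//.
split.
- move=> f tf; have [v [g [tg bg pv]]] := coreach f tf.
  have h1 := term f g tf tg bg.
  have h2 := path_weight_le ew0 pv.
  have : start_series x s f * (weight edge_weight f v)%:E < +oo.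
    apply: le_lt_trans lfin; apply: le_trans h1; apply: lee_wpmul2l => //.
    exact: start_series_ge0.
  move: (start_series_ge0 f); case: (start_series x s f) => [r| |] h0; [by move=> _; exact: ltry| |by []].
  by rewrite gt0_mulye// lte_fin weight_gt0.
- move=> e f te tf; rewrite -label_sum_transfer//.
  by apply: le_lt_trans (pfin e f te tf); exact: label_sum_le.
- rewrite transfer_mxE; apply: (path_sum_spectral ew0 trim_okC _ pfin).
  by move=> e f te tf; apply: le_lt_trans (pfin e f te tf); exact: label_sum_le.
Qed.

Lemma loop_sum_ge1 : 1 <= loop_sum.
Proof.
rewrite loop_sumE leeDl// sume_ge0// => f _; rewrite mule_ge0 ?start_series_ge0//.
by rewrite sume_ge0// => g _; apply: path_sum_ge0; exact: edge_weight_gt0.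
Qed.

Lemma bs_series_trim0 : trim D = finset.set0 -> bs_series x m s = vertex_series D x s.
Proof. by move=> t0; rewrite bs_series_prod loop_sum_trim0// mul1e. Qed.

Lemma bs_series_resolvent : trim_series_finite D x s ->
  (spectral_radius (transfer_mx D x s) < 1)%R ->
  bs_series x m s = vertex_series D x s * (resolvent_factor D x s)%:E.
Proof. by move=> fin rho; rewrite bs_series_prod loop_sum_resolvent// muleC. Qed.

Lemma bs_series_finite : bs_series x m s < +oo ->
  trim_series_finite D x s /\ (spectral_radius (transfer_mx D x s) < 1)%R.
Proof.
rewrite bs_series_prod => fin.
have l1 := loop_sum_ge1; have v1 := vertex_series_ge1.
have lfin : loop_sum < +oo.
  apply: le_lt_trans fin; rewrite -[leLHS]mule1; apply: lee_wpmul2l => //.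
  exact: le_trans l1.
have vfin : vertex_series D x s < +oo.
  apply: le_lt_trans fin; rewrite -[leLHS]mul1e; apply: lee_wpmul2r => //.
  exact: le_trans v1.
by have [h1 h2 h3] := loop_sum_finite lfin.
Qed.

End BassSerreSeries.

(** * Comparison triangles and Stewart's inequality *)

Section Hyperbolic.
Context {R : realType}.
Implicit Types (a b l r s t u x y : R).

Definition cosh x : R := (expR x + expR (- x)) / 2.
Definition sinh x : R := (expR x - expR (- x)) / 2.

Lemma expR_mulN x : expR x * expR (- x) = 1.
Proof. by rewrite expRN mulfV// gt_eqF// expR_gt0. Qed.

Lemma cosh_ge1 x : 1 <= cosh x.
Proof.
rewrite /cosh; have := expR_mulN x; have := expR_gt0 x; have := expR_gt0 (- x).
by move: (expR x) (expR (- x)) => u v v0 u0 uv; have := sqr_ge0 (u - v); nra.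
Qed.

Lemma cosh2B1 x : cosh x ^+ 2 - 1 = sinh x ^+ 2.
Proof.
rewrite /cosh /sinh; have := expR_mulN x.
move: (expR x) (expR (- x)) => u v uv.
transitivity (((u - v) / 2) ^+ 2 + (u * v - 1)); first by field.
by rewrite uv subrr addr0.
Qed.

Lemma expR_ge1 x : 0 <= x -> 1 <= expR x.
Proof. by move=> x0; rewrite -(@expR0 R) ler_expR. Qed.

Lemma sinh_ge0 x : 0 <= x -> 0 <= sinh x.
Proof.
by move=> x0; rewrite /sinh divr_ge0// subr_ge0 ler_expR; lra.
Qed.

Lemma sinh_gt0 x : 0 < x -> 0 < sinh x.
Proof.
by move=> x0; rewrite /sinh divr_gt0// subr_gt0 ltr_expR; lra.
Qed.

Lemma coshDsinh x : cosh x + sinh x = expR x.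
Proof. by rewrite /cosh /sinh; field. Qed.

Lemma ler_cosh x y : 0 <= x -> x <= y -> cosh x <= cosh y.
Proof.
move=> x0 xy; rewrite /cosh ler_pM2r ?invr_gt0//.
have := expR_mulN x; have := expR_mulN y; have := expR_gt0 (- x).
have := expR_gt0 (- y); have := expR_ge1 x0.
have : expR x <= expR y by rewrite ler_expR.
move: (expR x) (expR (- x)) (expR y) (expR (- y)) => u u' v v' uv u1 v'0 u'0 vv uu.
have : (v - u) * (1 - u' * v') >= 0.
  rewrite mulr_ge0 ?subr_ge0//; nra.
nra.
Qed.

Lemma cosh_abs x : cosh `|x| = cosh x.
Proof.
case: (ger0P x) => // _.
by rewrite /cosh opprK addrC.
Qed.

Lemma ler_cosh_abs x y : `|x| <= y -> cosh x <= cosh y.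
Proof. by move=> xy; rewrite -cosh_abs; apply: ler_cosh. Qed.

Lemma arcosh_cosh r : 0 <= r -> arcosh (cosh r) = r.
Proof.
move=> r0; rewrite /arcosh cosh2B1 sqrtr_sqr ger0_norm ?sinh_ge0//.
by rewrite coshDsinh expRK.
Qed.

Lemma hyp_dist_eq (p q : R * R) r : 0 <= r ->
  1 + ((p.1 - q.1) ^+ 2 + (p.2 - q.2) ^+ 2) / (2 * p.2 * q.2) = cosh r ->
  hyp_dist p q = r.
Proof. by move=> r0 e; rewrite /hyp_dist e arcosh_cosh. Qed.

Lemma cosh_arcosh u : 1 <= u -> cosh (arcosh u) = u.
Proof.
move=> u1; rewrite /arcosh; set w := Num.sqrt _.
have w0 : 0 <= w by exact: sqrtr_ge0.
have ww : w ^+ 2 = u ^+ 2 - 1 by rewrite sqr_sqrtr//; nra.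
rewrite /cosh expRN lnK ?posrE; last by nra.
have -> : (u + w)^-1 = u - w.
  by apply: (@mulfI _ (u + w)); [rewrite gt_eqF//; nra|rewrite mulfV ?gt_eqF//; nra].
by field.
Qed.

Lemma le_arcosh x u : 0 <= x -> 1 <= u -> x <= arcosh u -> cosh x <= u.
Proof. by move=> x0 u1 xu; rewrite -(cosh_arcosh u1) ler_cosh. Qed.

(** The third vertex of a comparison triangle on the imaginary axis: the
   circles of radii [a] about [i] and [b] about [e^l i] meet. *)
Lemma comparison_vertex l a b : 0 < l -> 0 <= a -> 0 <= b ->
  l <= a + b -> a <= l + b -> b <= l + a ->
  exists x y, [/\ 0 < y,
    x ^+ 2 + y ^+ 2 + 1 = 2 * y * cosh a &
    x ^+ 2 + y ^+ 2 + expR l ^+ 2 = 2 * y * expR l * cosh b].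
Proof.
move=> l0 a0 b0 lab alb bla.
have h1 : 1 < expR l by rewrite expR_gt1.
have b1 : (expR l * expR (- a) + expR (- l) * expR a) / 2 <= cosh b.
  have : cosh (l - a) <= cosh b by apply: ler_cosh_abs; rewrite ler_norml; lra.
  by rewrite {1}/cosh opprB (addrC a) !expRD.
have b2 : cosh b <= (expR l * expR a + expR (- l) * expR (- a)) / 2.
  by rewrite -!expRD -opprD; apply: (ler_cosh b0).
have ll := expR_mulN l; have aa := expR_mulN a.
have Ca : cosh a = (expR a + expR (- a)) / 2 by [].
have := expR_ge1 a0; have := expR_gt0 (-a); have := expR_gt0 (-l).
move: (cosh b) (cosh a) Ca h1 ll aa b1 b2 => C2 C1.
move: (expR l) (expR (- l)) (expR a) (expR (- a)) => h h' A A'.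
move=> -> h1 hh AA b1 b2 h'0 A'0 A1.
have e1 : 2 * A * h * C2 >= h ^+ 2 + A ^+ 2.
  have -> : h ^+ 2 + A ^+ 2 = 2 * A * h * ((h * A' + A * h') / 2).
    rewrite (_ : _ * _ = h ^+ 2 * (A * A') + A ^+ 2 * (h * h')); last by field.
    by rewrite AA hh; ring.
  by apply: ler_wpM2l => //; nra.
have e2 : 2 * A' * h * C2 <= h ^+ 2 + A' ^+ 2.
  have -> : h ^+ 2 + A' ^+ 2 = 2 * A' * h * ((h * A + h' * A') / 2).
    rewrite (_ : _ * _ = h ^+ 2 * (A * A') + A' ^+ 2 * (h * h')); last by field.
    by rewrite AA hh; ring.
  by apply: ler_wpM2l => //; nra.
pose q := 2 * (h * C2 - (A + A') / 2).
have Aq : A * q >= h ^+ 2 - 1.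
  have -> : A * q = 2 * A * h * C2 - A ^+ 2 - A * A' by rewrite /q; field.
  by rewrite AA; lra.
have A'q : A' * q <= h ^+ 2 - 1.
  have -> : A' * q = 2 * A' * h * C2 - A' ^+ 2 - A * A' by rewrite /q; field.
  by rewrite AA; lra.
have h21 : 0 < h ^+ 2 - 1 by nra.
have q0 : 0 < q.
  by rewrite -(pmulr_rgt0 _ (lt_le_trans ltr01 A1)); lra.
pose y := (h ^+ 2 - 1) / q.
have yq : y * q = h ^+ 2 - 1 by rewrite /y divfK// gt_eqF.
have y0 : 0 < y by rewrite /y divr_gt0.
have yA : y <= A by rewrite /y ler_pdivrMr.
have A'y : A' <= y by rewrite /y ler_pdivlMr.
exists (Num.sqrt (y * (A + A') - 1 - y ^+ 2)), y.
rewrite sqr_sqrtr; last first.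
  rewrite -AA (_ : _ - _ = (y - A') * (A - y)); last by ring.
  by rewrite mulr_ge0// subr_ge0.
split=> //; first by field.
move: yq; rewrite /q => yq; nra.
Qed.

End Hyperbolic.

Section Stewart.
Context {R : realType} {X : metricType R}.
Implicit Types (x y p q o : X) (c : R -> X) (s t l : R).

(** In the half-plane model the side [p q] is put on the imaginary axis, where
   the distance to a fixed point is an explicit function of the height, and the
   inequality is the comparison of the cevian from [x] with its image. *)
Lemma stewart : cat_minus_one X -> forall x p q c t, geodesic p q c ->
  0 <= t <= mdist p q ->
  sinh (mdist p q) * cosh (mdist x (c t)) <=
  sinh (mdist p q - t) * cosh (mdist x p) + sinh t * cosh (mdist x q).
Proof.
move=> [geo cat] x p q c t cg tl.
have tl' := tl; case/andP: tl' => t0 tle.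
have := @mdist_ge0 _ _ p q; rewrite le_eqVlt => /orP[/eqP l0|l0].
  have -> : t = 0 by lra.
  by rewrite -l0 subr0 /sinh oppr0 expR0; lra.
have [c2 c2g] := geo p x.
have ax := mdist_ge0 x p; have bx := mdist_ge0 x q.
have := metric_triangle p x q; have := metric_triangle x q p.
have := metric_triangle x p q; rewrite (metric_sym q p) (metric_sym p x) => t1 t2 t3.
have [u [y [y0 e1 e2]]] := comparison_vertex l0 ax bx t3 (ltac:(lra)) (ltac:(lra)).
set l := mdist p q in t0 tle tl l0 t1 t2 t3 e1 e2 cg *.
set a := mdist x p in ax t1 t2 t3 e1 *.
set b := mdist x q in bx t1 t2 t3 e2 *.
have d2 r s : 0 <= r - s ->
    hyp_dist (0, expR s) (0, expR r) = r - s /\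
    hyp_dist (0, expR r) (0, expR s) = r - s.
  move=> rs.
  have E : 1 + (expR s - expR r) ^+ 2 / (2 * expR s * expR r) = cosh (r - s).
    rewrite /cosh opprB !expRD !expRN; have := expR_gt0 r; have := expR_gt0 s.
    move: (expR r) (expR s) => v w w0 v0; field; by rewrite !gt_eqF.
  split; apply: hyp_dist_eq => //=; rewrite subrr expr0n/= add0r //.
  by rewrite -E -(sqrrN (expR r - _)) opprB; congr (_ + _ / _); ring.
have h0 s : hyp_plane (0, expR s) by rewrite /hyp_plane/= expR_gt0.
have Q s : 1 + ((u - 0) ^+ 2 + (y - expR s) ^+ 2) / (2 * y * expR s) =
    (u ^+ 2 + y ^+ 2 + expR s ^+ 2) / (2 * y * expR s).
  have := expR_gt0 s; move: (expR s) => w w0; field; by rewrite !gt_eqF.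
have Qs (v w z1 z2 : R) : 1 + ((v - w) ^+ 2 + (z1 - z2) ^+ 2) / (2 * z1 * z2) =
    1 + ((w - v) ^+ 2 + (z2 - z1) ^+ 2) / (2 * z2 * z1).
  by rewrite -(sqrrN (v - w)) -(sqrrN (z1 - z2)) !opprB; congr (_ + _ / _); ring.
pose V : R * R := (u, y).
have D1 : hyp_dist (0, expR 0) V = a.
  apply: hyp_dist_eq => //=; rewrite Qs Q expR0 expr1n e1.
  by field; rewrite !gt_eqF.
have D2 : hyp_dist (0, expR l) V = b.
  apply: hyp_dist_eq => //=; rewrite Qs Q e2.
  by field; rewrite !gt_eqF ?expR_gt0.
have VV : hyp_dist V V = 0.
  apply: hyp_dist_eq => //=.
  by rewrite !subrr expr0n/= addr0 mul0r addr0 /cosh oppr0 expR0; lra.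
have H : mdist (c t) (c2 a) <= hyp_dist (0, expR t) V.
  apply: (cat p q x c c2 cg c2g (0, expR 0) (0, expR l) V) => //.
  - by have [|-> _] := d2 l 0; rewrite subr0// ltW.
  - by rewrite D1 metric_sym.
  - by rewrite D2 metric_sym.
  - by rewrite (metric_sym p x) ax lexx.
  - by have [|-> _] := d2 t 0; rewrite subr0.
  - by have [|-> _] := d2 l t; rewrite ?subr_ge0.
  - by rewrite VV (metric_sym p x) subrr.
have [_ c2x _] := c2g; rewrite (metric_sym p x) -/a in c2x.
rewrite c2x (metric_sym (c t) x) /hyp_dist /= Qs Q in H.
set S := u ^+ 2 + y ^+ 2 in Q e1 e2 H *.
have := le_arcosh (mdist_ge0 _ _) _ H; move=> {}H.
have {}H : cosh (mdist x (c t)) <= (S + expR t ^+ 2) / (2 * y * expR t).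
  apply: H; rewrite ler_pdivlMr ?mul1r; last by rewrite !mulr_gt0// expR_gt0.
  rewrite /S; have := sqr_ge0 u; have := sqr_ge0 (y - expR t); nra.
have sl := sinh_gt0 l0.
have := ler_wpM2l (ltW sl) H => {}H; apply: (le_trans H).
have C1 : cosh a = (S + 1) / (2 * y).
  by rewrite e1; field; rewrite gt_eqF.
have C2 : cosh b = (S + expR l ^+ 2) / (2 * y * expR l).
  by rewrite e2; field; rewrite !gt_eqF// expR_gt0.
rewrite C1 C2 /sinh opprB !expRD !expRN.
have := expR_gt0 l; have := expR_gt0 t.
move: (expR l) (expR t) => L E E0 L0.
by rewrite le_eqVlt; apply/orP; left; apply/eqP; field; rewrite !gt_eqF.
Qed.

End Stewart.

(** * Consequences of Stewart's inequality *)

Section CatGeometry.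
Context {R : realType} {X : metricType R} (catX : cat_minus_one X).
Implicit Types (x y z p q o w : X) (c : R -> X) (s t l : R).

Lemma gromov_sym o x y : gromov o x y = gromov o y x.
Proof. by rewrite /gromov (metric_sym x y) (addrC (mdist o x)). Qed.

Lemma gromov_ge0 o x y : 0 <= gromov o x y.
Proof.
rewrite /gromov divr_ge0// subr_ge0 (metric_sym o x).
exact: metric_triangle.
Qed.

Lemma gromov_lel o x y : gromov o x y <= mdist o x.
Proof.
rewrite /gromov ler_pdivrMr//; have := metric_triangle o x y; lra.
Qed.

Lemma gromov_ler o x y : gromov o x y <= mdist o y.
Proof. by rewrite gromov_sym gromov_lel. Qed.

Lemma geodesic0 p q c t : geodesic p q c -> 0 <= t <= mdist p q ->
  mdist p (c t) = t.
Proof.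
move=> [<- cq d] /andP[t0 tl]; rewrite d ?in_itv/= ?lexx ?t0 ?tl// ?(le_trans t0)//.
by rewrite sub0r normrN ger0_norm.
Qed.

Lemma geodesic1 p q c t : geodesic p q c -> 0 <= t <= mdist p q ->
  mdist (c t) q = mdist p q - t.
Proof.
move=> [cp cq d] /andP[t0 tl]; rewrite -{1}cq d ?in_itv/= ?lexx ?t0 ?tl// ?(le_trans t0)//.
by rewrite distrC ger0_norm// subr_ge0.
Qed.

(** Passing from [cosh] to [exp] in Stewart's inequality costs no constant. With
   [l = d(p, q)], the coefficients [A = sinh (l - t)], [B = sinh t] and
   [a = d(x, p)], [b = d(x, q)], the product of [A e^a + B e^b] and
   [A e^-a + B e^-b] is at most [sinh^2 l], because [|a - b| <= l]; as a quadratic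
   inequality in [e^d], Stewart's inequality then bounds [sinh l e^d] by the first
   factor. *)
Lemma exp_stewart x p q c t : geodesic p q c -> 0 <= t <= mdist p q ->
  expR (mdist x (c t)) <=
  expR (mdist x p - t) + expR (mdist x q - (mdist p q - t)).
Proof.
move=> cg tl; have St := stewart catX x cg tl.
have := tl; case/andP => t0 tle.
have := @mdist_ge0 _ _ p q; rewrite le_eqVlt => /orP[/eqP l0|l0].
  have t00 : t = 0 by lra.
  rewrite t00; have [-> _ _] := cg.
  by rewrite subr0 lerDl expR_ge0.
have ax := mdist_ge0 x p; have bx := mdist_ge0 x q.
have t1 := metric_triangle x p q; have t2 := metric_triangle x q p.
rewrite (metric_sym q p) in t2.
move: (mdist p q) (mdist x p) (mdist x q) (mdist x (c t)) (mdist_ge0 x (c t))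
  St l0 ax bx t1 t2 tle {cg tl}.
move=> l a b D D0 St l0 a0 b0 bal abl tle.
have S0 := sinh_gt0 l0.
have A0 : 0 <= sinh (l - t) by apply: sinh_ge0; lra.
have B0 := sinh_ge0 t0.
have ABS : sinh (l - t) ^+ 2 + sinh t ^+ 2 + 2 * sinh (l - t) * sinh t * cosh l =
    sinh l ^+ 2.
  rewrite /sinh /cosh opprB !expRD !expRN.
  have := expR_gt0 l; have := expR_gt0 t; move: (expR l) (expR t) => L E E0 L0.
  by field; rewrite !gt_eqF.
have AS : sinh (l - t) <= sinh l * expR (- t).
  rewrite /sinh mulrAC ler_pM2r ?invr_gt0// mulrBl -!expRD lerB// ler_expR; lra.
have BS : sinh t <= sinh l * expR (t - l).
  rewrite /sinh mulrAC ler_pM2r ?invr_gt0// mulrBl -!expRD.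
  by apply: lerB; rewrite ler_expR; lra.
have ab : expR a * expR (- b) + expR (- a) * expR b <= 2 * cosh l.
  have : cosh (a - b) <= cosh l by apply: ler_cosh_abs; rewrite ler_norml; lra.
  by rewrite {1}/cosh opprB (addrC b) !expRD; lra.
have ua : expR (- a) <= expR a by rewrite ler_expR; lra.
have ub : expR (- b) <= expR b by rewrite ler_expR; lra.
have aa := expR_mulN a; have bb := expR_mulN b; have DD := expR_mulN D.
have D1 : 0 < expR D := expR_gt0 D.
rewrite expRD (expRD b) opprB.
rewrite {1}/cosh [cosh a]/cosh [cosh b]/cosh in St.
have ea0 := expR_gt0 a; have eb0 := expR_gt0 b.
move: (expR a) (expR (- a)) (expR b) (expR (- b)) (expR D) (expR (- D)) St
   aa bb DD D1 ua ub ab ea0 eb0 => u u' v v' z z' St uu vv zz z0 ua ub ab u0 v0.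
move: (sinh (l - t)) (sinh t) (sinh l) (cosh l) (expR (- t)) (expR (t - l))
  A0 B0 S0 AS BS ABS ab St => A B S C w1 w2 A0 B0 S0 AS BS ABS ab St.
suff H : S * z <= A * u + B * v.
  rewrite -(ler_pM2l S0); apply: (le_trans H).
  have := ler_wpM2r (ltW u0) AS; have := ler_wpM2r (ltW v0) BS; lra.
rewrite leNgt; apply/negP => H.
have H' : S * z > A * u' + B * v'.
  by have := ler_wpM2l A0 ua; have := ler_wpM2l B0 ub; lra.
have : (S * z - (A * u + B * v)) * (S * z - (A * u' + B * v')) > 0.
  by rewrite mulr_gt0// subr_gt0.
apply/negP; rewrite -leNgt.
have -> : (S * z - (A * u + B * v)) * (S * z - (A * u' + B * v')) =
  (S * z) ^+ 2 - (S * z) * (A * (u + u') + B * (v + v')) +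
  (A ^+ 2 * (u * u') + B ^+ 2 * (v * v') + A * B * (u * v' + u' * v)) by ring.
rewrite uu vv.
have h1 : A * B * (u * v' + u' * v) <= 2 * A * B * C by have := mulr_ge0 A0 B0; nra.
have h2 : (S * z) * (S * (z + z')) <= (S * z) * (A * (u + u') + B * (v + v')).
  by rewrite ler_pM2l ?mulr_gt0//; lra.
have h3 : (S * z) * (S * (z + z')) = (S * z) ^+ 2 + S ^+ 2 by rewrite -[S ^+ 2]mulr1 -zz; ring.
lra.
Qed.

(** The path from [x] to [z] is broken at a point of the segment [o, y]. The best
   height [t] is the mean of the two Gromov products, and then [exp_stewart] gives
   the triangle inequality with no multiplicative constant. *)
Lemma exp_gromov_triangle o x y z :
  expR (- gromov o x z) <= expR (- gromov o x y) + expR (- gromov o y z).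
Proof.
pose a := gromov o x y; pose b := gromov o y z; pose t := (a + b) / 2.
have a0 : 0 <= a := gromov_ge0 _ _ _; have b0 : 0 <= b := gromov_ge0 _ _ _.
have al : a <= mdist o y := gromov_ler _ _ _.
have bl : b <= mdist o y := gromov_lel _ _ _.
have [c cg] := catX.1 o y.
have tl : 0 <= t <= mdist o y by rewrite /t; apply/andP; split; lra.
have hx := exp_stewart x cg tl; have hz := exp_stewart z cg tl.
rewrite -/a -/b.
have dxz : expR (mdist x z) <= expR (mdist x (c t)) * expR (mdist z (c t)).
  by rewrite -expRD ler_expR (metric_sym z); exact: metric_triangle.
rewrite -(@ler_pXn2r _ 2) ?nnegrE ?addr_ge0 ?expR_ge0//.
have ex : expR (mdist x (c t)) <=
    expR (mdist o x) * (expR (- a) + expR (- b)) * expR ((b - a) / 2).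
  apply: (le_trans hx); rewrite mulrDr mulrDl -!expRD [X in X <= _]addrC.
  rewrite (metric_sym x o).
  by apply: lerD; rewrite ler_expR /t /a /b /gromov; lra.
have ez : expR (mdist z (c t)) <=
    expR (mdist o z) * (expR (- a) + expR (- b)) * expR ((a - b) / 2).
  apply: (le_trans hz); rewrite mulrDr mulrDl -!expRD.
  rewrite (metric_sym z o) (metric_sym z y).
  by apply: lerD; rewrite ler_expR /t /a /b /gromov; lra.
have -> : expR (- gromov o x z) ^+ 2 =
    expR (mdist x z) * expR (- mdist o x - mdist o z).
  by rewrite expr2 -!expRD; congr expR; rewrite /gromov; lra.
apply: (@le_trans _ _ (expR (mdist x (c t)) * expR (mdist z (c t)) *
    expR (- mdist o x - mdist o z))); first by rewrite ler_pM2r ?expR_gt0.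
have := ler_pM (expR_ge0 _) (expR_ge0 _) ex ez.
rewrite -(ler_pM2r (expR_gt0 (- mdist o x - mdist o z))) => h; apply: (le_trans h).
set e := expR (- a) + expR (- b).
rewrite [X in X <= _](_ : _ = e ^+ 2 * (expR (mdist o x) * expR (mdist o z) *
  (expR ((b - a) / 2) * expR ((a - b) / 2)) * expR (- mdist o x - mdist o z))); last by ring.
rewrite -!expRD (_ : _ + _ + _ = 0) ?expR0 ?mulr1//; lra.
Qed.

Lemma cosh_ge_sqr t : 0 <= t -> 1 + t ^+ 2 / 8 <= cosh t.
Proof.
move=> t0; rewrite /cosh.
have e1 : 1 + t / 2 <= expR (t / 2) by exact: expR_ge1Dx.
have -> : expR t = expR (t / 2) ^+ 2 by rewrite expr2 -expRD; congr expR; field.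
have -> : expR (- t) = expR (- (t / 2)) ^+ 2 by rewrite expr2 -expRD; congr expR; field.
have := expR_mulN (t / 2).
have : expR (- (t / 2)) <= 1 by rewrite expR_le1; lra.
have := expR_gt0 (- (t / 2)).
move: (expR (t / 2)) (expR (- (t / 2))) e1 => u v u1 v0 v1 uv.
have : (t / 2) ^+ 2 <= (u - v) ^+ 2 by rewrite ler_pXn2r ?nnegrE//; lra.
nra.
Qed.

(** The exponential form of Stewart's inequality bounds [d(x, c' t)] by the Gromov
   product; with this bound the form in [cosh] makes [cosh d(c t, c' t) - 1]
   small, which is quadratic in the distance. *)
Lemma geodesic_fellow o x y c c' t : geodesic o x c -> geodesic o y c' ->
  0 <= t -> t <= mdist o x -> t <= mdist o y ->
  mdist (c t) (c' t) <= 2 * expR (t - gromov o x y).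
Proof.
move=> cg cg' t0; rewrite le_eqVlt => /orP[/eqP tx ty|tx ty].
  (* at the far end the exponential form of the inequality is enough *)
  have ct : c t = x by rewrite tx; case: cg.
  have := @exp_stewart x o y c' t cg'; rewrite t0 ty => /(_ isT).
  rewrite ct (metric_sym x o) -tx subrr expR0.
  have -> : mdist x y - (mdist o y - t) = 2 * (t - gromov o x y).
    by rewrite /gromov -tx; lra.
  have := expR_gt0 (t - gromov o x y).
  have -> : expR (2 * (t - gromov o x y)) = expR (t - gromov o x y) ^+ 2.
    by rewrite expr2 -expRD; congr expR; ring.
  have := mdist_ge0 x (c' t).
  move: (expR _) (mdist x _) => w d d0 w0.
  have e1 := expR_ge1Dx (d / 2).
  have -> : expR d = expR (d / 2) ^+ 2 by rewrite expr2 -expRD; congr expR; field.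
  move: (expR _) e1 => u u1 uw.
  nra.
have tl : 0 <= t <= mdist o y by rewrite t0.
have tlx : 0 <= t <= mdist o x by rewrite t0 ltW.
have h1 := exp_stewart x cg' tl.
have h2 := stewart catX (c' t) cg tlx.
rewrite (metric_sym _ o) (geodesic0 cg' tl) in h2.
rewrite metric_sym.
have L0 : 0 < mdist o x by lra.
have Dl : mdist o x - t <= mdist x (c' t).
  have := metric_triangle o (c' t) x; rewrite (geodesic0 cg' tl) (metric_sym (c' t) x); lra.
rewrite (metric_sym (c' t) x) in h2.
have ew : expR (mdist o x - t) * (1 + expR (t - gromov o x y) ^+ 2) =
   expR (mdist x o - t) + expR (mdist x y - (mdist o y - t)).
  rewrite expr2 -expRD mulrDr mulr1 -expRD (metric_sym x o).
  by congr (_ + expR _); rewrite /gromov; field.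
rewrite -ew {ew} in h1.
have w0 := expR_gt0 (t - gromov o x y).
move: (expR (t - gromov o x y)) (mdist (c' t) (c t)) (mdist_ge0 (c' t) (c t)) w0 h1 h2.
move: (mdist o x) (mdist x (c' t)) L0 Dl tx {tl tlx ty} => L D L0 DL tL w d d0 w0 h1 h2.
have S0 := sinh_gt0 L0; have B0 := sinh_ge0 t0.
have hD : cosh D <= cosh (L - t) + w ^+ 2 * expR (L - t) / 2.
  rewrite /cosh; have : expR (- D) <= expR (- (L - t)) by rewrite ler_expR; lra.
  by lra.
have BS : sinh t * expR (L - t) <= sinh L.
  rewrite /sinh mulrAC ler_pM2r ?invr_gt0// mulrBl -!expRD.
  by apply: lerB; rewrite ler_expR; lra.
have add : sinh (L - t) * cosh t + sinh t * cosh (L - t) = sinh L.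
  rewrite /sinh /cosh opprB !expRD !expRN.
  have := expR_gt0 L; have := expR_gt0 t; move: (expR L) (expR t) => a b b0 a0.
  by field; rewrite !gt_eqF.
have h3 : cosh d <= 1 + w ^+ 2 / 2.
  rewrite -(ler_pM2l S0).
  have : sinh t * cosh D <= sinh t * (cosh (L - t) + w ^+ 2 * expR (L - t) / 2).
    exact: ler_wpM2l.
  have := ler_wpM2l (sqr_ge0 w) BS.
  lra.
have := cosh_ge_sqr d0.
by rewrite -(@ler_pXn2r _ 2) ?nnegrE ?mulr_ge0// ?(ltW w0)//; nra.
Qed.

End CatGeometry.

(** * Axes of hyperbolic isometries *)

Section Axis.
Context {R : realType} {X : metricType R} (catX : cat_minus_one X).
Implicit Types (x y z p q o w : X) (c : R -> X) (s t l : R) (g h : isom X).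

Lemma cosh_le_inv (a b : R) : 0 <= a -> 0 <= b -> cosh a <= cosh b -> a <= b.
Proof.
move=> a0 b0 ab; rewrite -(arcosh_cosh a0) -(arcosh_cosh b0) /arcosh !cosh2B1.
rewrite !sqrtr_sqr !ger0_norm ?sinh_ge0//.
have : sinh a <= sinh b.
  rewrite -(@ler_pXn2r _ 2) ?nnegrE ?sinh_ge0// -!cosh2B1 lerB//.
  by rewrite ler_pXn2r ?nnegrE// ltW// (lt_le_trans ltr01)// cosh_ge1.
by move=> s; rewrite !coshDsinh !expRK -(@ler_expR R) -!coshDsinh lerD.
Qed.

Lemma isomM g h x : (g * h)%g x = g (h x). Proof. by []. Qed.

Lemma isom1 x : (1%g : isom X) x = x. Proof. by []. Qed.

Lemma isomKV g x : g (g^-1%g x) = x.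
Proof. by rewrite -isomM mulgV. Qed.

Lemma mdist_isomV g x y : mdist (g^-1%g x) y = mdist x (g y).
Proof. by rewrite -(isom_dist g) isomKV. Qed.

Lemma geodesic_isom g p q c : geodesic p q c -> geodesic (g p) (g q) (g \o c).
Proof.
by case=> [cp cq d]; split; rewrite /= ?isom_dist ?cp ?cq// => s t hs ht; rewrite isom_dist d.
Qed.

(** In the triangle [w], [g w], [g^2 w] the segment joining the midpoints of the
   first two sides is at most half of the third side. If [m] is the midpoint of
   the first side, then [g m] is that of the second. *)
Lemma midpoint_displacement g w : exists m,
  mdist m (g m) *+ 2 <= mdist w (g (g w)).
Proof.
pose L := mdist w (g w); have := mdist_ge0 w (g w).
rewrite le_eqVlt => /orP[/eqP L0|L0].
  by exists w; rewrite -L0 mul0rn mdist_ge0.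
have [c cg] := catX.1 w (g w); exists (c (L / 2)).
have hL : 0 <= L / 2 <= L by apply/andP; split; rewrite /L; lra.
have gc := geodesic_isom g cg; rewrite -/L in L0.
have dg : mdist (g w) (g (g w)) = L by rewrite isom_dist.
have h1 := stewart catX (c (L / 2)) gc; rewrite dg in h1.
have {h1} h1 := h1 _ hL.
have h2 := stewart catX (g (g w)) cg hL.
rewrite -/L (geodesic1 cg hL) -/L /= in h1.
rewrite (metric_sym (g (g w)) (g w)) dg -/L in h2.
rewrite (_ : L - L / 2 = L / 2) in h1 h2; last by field.
rewrite (metric_sym (g (g w)) (c _)) (metric_sym (g (g w)) w) in h2.
move: (mdist _ (g (c _))) (mdist_ge0 (c (L / 2)) (g (c (L / 2)))) h1 => d d0.
have DL : mdist w (g (g w)) / 2 <= L.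
  by have := metric_triangle w (g w) (g (g w)); rewrite dg -/L; lra.
move: (mdist w (g (g w))) (mdist_ge0 w (g (g w))) DL h2 => D D0 DL.
move: (mdist _ _) => e h2 h1.
suff : d <= D / 2 by rewrite -mulr_natr; lra.
apply: cosh_le_inv => //; first by lra.
have s0 : 0 < sinh (L / 2) by apply: sinh_gt0; lra.
have dbl (a : R) : cosh a = 2 * cosh (a / 2) ^+ 2 - 1 /\ sinh a = 2 * sinh (a / 2) * cosh (a / 2).
  rewrite /cosh /sinh.
  have -> : expR a = expR (a / 2) ^+ 2 by rewrite expr2 -expRD; congr expR; field.
  have -> : expR (- a) = expR (- (a / 2)) ^+ 2 by rewrite expr2 -expRD; congr expR; field.
  have := expR_mulN (a / 2); move: (expR (a / 2)) (expR (- (a / 2))) => u v uv.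
  split; last by field.
  transitivity ((u ^+ 2 + v ^+ 2) / 2 + (u * v - 1)); last by field.
  by rewrite uv subrr addr0.
have kC : cosh (D / 2) <= cosh L by apply: ler_cosh => //; lra.
have := cosh_ge1 (D / 2); have := cosh_ge1 (L / 2).
rewrite (dbl L).2 (dbl L).1 (dbl D).1 in h1 h2 kC.
move: (cosh (L / 2)) (cosh (D / 2)) (sinh (L / 2)) (cosh e) (cosh d) s0 h1 h2 kC.
move=> H k S E C S0 h1 h2 kC H1 k1.
have h1' : 2 * H * C <= H + E by rewrite -(ler_pM2l S0); lra.
have h2' : 2 * H * E <= 2 * k ^+ 2 - 1 + (2 * H ^+ 2 - 1) by rewrite -(ler_pM2l S0); lra.
have H0 : 0 < H by lra.
have h3 : 2 * H ^+ 2 * C <= 2 * H ^+ 2 - 1 + k ^+ 2.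
  have := ler_wpM2l (ltW H0) h1'; lra.
rewrite -(@ler_pM2l _ (2 * H ^+ 2)); last by rewrite mulr_gt0// exprn_gt0.
apply: (le_trans h3).
have : 0 <= (k - 1) * (2 * H ^+ 2 - 1 - k).
  by rewrite mulr_ge0 ?subr_ge0//; lra.
lra.
Qed.

Lemma translation_length_le g w : translation_length g <= mdist w (g w).
Proof.
apply: ge_inf; last by exists w.
by exists 0 => _ [z _ <-]; exact: mdist_ge0.
Qed.

Lemma isomX g n x : (g ^+ n)%g x = iter n g x.
Proof. by elim: n => [|n IH]; rewrite ?expg0// expgS isomM IH. Qed.

(** The midpoint inequality doubles the displacement at each squaring. *)
Lemma displacement_exp2 g k w :
  translation_length g * 2 ^+ k <= mdist w ((g ^+ (2 ^ k))%g w).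
Proof.
elim: k => [|k IH] in w *; first by rewrite expr0 mulr1 expg1 translation_length_le.
have [m hm] := midpoint_displacement (g ^+ (2 ^ k))%g w.
rewrite expnS mul2n -addnn expgnDr isomM; apply: le_trans hm.
by rewrite exprS mulrCA -[leRHS]mulr_natl ler_pM2l.
Qed.

Section HyperbolicAxis.
Variables (g : isom X) (z : X).
Let T := translation_length g.
Hypotheses (T0 : 0 < T) (zT : mdist z (g z) = T).

Lemma orbit_step n : mdist (iter n g z) (iter n.+1 g z) = T.
Proof. by elim: n => [//|n IH]; rewrite [in RHS]/= -IH /= isom_dist. Qed.

Lemma orbit_le i j : mdist (iter i g z) (iter (i + j) g z) <= j%:R * T.
Proof.
elim: j => [|j IH]; first by rewrite addn0 mdistxx mul0r.
rewrite addnS; apply: le_trans (metric_triangle _ (iter (i + j) g z) _) _.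
by rewrite orbit_step -natr1; lra.
Qed.

Lemma orbit_ge n : n%:R * T <= mdist z (iter n g z).
Proof.
have n2 : (n <= 2 ^ n)%N by rewrite ltnW// ltn_expl.
have := displacement_exp2 g n z; rewrite isomX => h.
have := metric_triangle z (iter n g z) (iter (2 ^ n) g z).
have := orbit_le n (2 ^ n - n); rewrite subnKC// natrB// natrX -/T in h *.
by move: h; rewrite mulrC -/T; lra.
Qed.

Variables (c0 : R -> X).
Hypothesis c0g : geodesic z (g z) c0.

Let fl t := Num.truncn (t / T).

Lemma fl_itv t : 0 <= t -> (fl t)%:R * T <= t < (fl t).+1%:R * T.
Proof.
move=> t0; have /Num.Theory.truncn_itv/andP[h1 h2] : 0 <= t / T by rewrite divr_ge0// ltW.
by rewrite -ler_pdivlMr// -ltr_pdivrMr// h1.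
Qed.

(** The consecutive translates of the segment [z, g z], put end to end. *)
Definition half_axis t := iter (fl t) g (c0 (t - (fl t)%:R * T)).

Lemma half_axis_left t : 0 <= t ->
  mdist (iter (fl t) g z) (half_axis t) = t - (fl t)%:R * T.
Proof.
move=> t0; rewrite /half_axis -!isomX isom_dist.
have /andP[h1 h2] := fl_itv t0; apply: (geodesic0 c0g).
by rewrite zT subr_ge0 h1/= lerBlDr; rewrite -natr1 in h2; lra.
Qed.

Lemma half_axis_right t : 0 <= t ->
  mdist (half_axis t) (iter (fl t).+1 g z) = (fl t).+1%:R * T - t.
Proof.
move=> t0; rewrite /half_axis iterSr -!isomX isom_dist.
have /andP[h1 h2] := fl_itv t0; rewrite (geodesic1 c0g) zT; first by rewrite -natr1; ring.
by rewrite subr_ge0 h1/= lerBlDr; rewrite -natr1 in h2; lra.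
Qed.

Lemma half_axis_le s t : 0 <= s -> s <= t -> mdist (half_axis s) (half_axis t) <= t - s.
Proof.
move=> s0 st; have t0 := le_trans s0 st.
have /andP[s1 s2] := fl_itv s0; have /andP[t1 t2] := fl_itv t0.
have := leqP (fl t) (fl s); case => [le|lt].
  have e : fl t = fl s.
    apply/eqP; rewrite eqn_leq le /= -ltnS -(ltr_nat R) -(ltr_pM2r T0); lra.
  have [_ _ d] := c0g; rewrite /half_axis e -!isomX isom_dist d ?in_itv/= ?zT.
  - by rewrite distrC ger0_norm; lra.
  - by rewrite -natr1 in s2; apply/andP; split; lra.
  - by rewrite e -natr1 in t1 t2; apply/andP; split; lra.
have h1 := half_axis_right s0; have h2 := half_axis_left t0.
have := orbit_le (fl s).+1 (fl t - (fl s).+1); rewrite subnKC// natrB// => h3.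
have := metric_triangle (half_axis s) (iter (fl s).+1 g z) (half_axis t).
have := metric_triangle (iter (fl s).+1 g z) (iter (fl t) g z) (half_axis t).
lra.
Qed.

Lemma half_axisE s t : 0 <= s -> s <= t -> mdist (half_axis s) (half_axis t) = t - s.
Proof.
move=> s0 st; apply/eqP; rewrite eq_le half_axis_le//=.
have t0 := le_trans s0 st.
have fl0 : fl 0 = 0%N by rewrite /fl mul0r Num.Theory.truncn0.
have z0 : half_axis 0 = z by rewrite /half_axis fl0 mul0r subrr; case: c0g.
have := half_axis_le (lexx 0) s0; rewrite z0 subr0.
have := half_axis_right t0; have := orbit_ge (fl t).+1.
have := metric_triangle z (half_axis s) (half_axis t).
have := metric_triangle z (half_axis t) (iter (fl t).+1 g z).
lra.
Qed.

Lemma half_axisD t : 0 <= t -> half_axis (t + T) = g (half_axis t).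
Proof.
move=> t0; have e : fl (t + T) = (fl t).+1.
  rewrite /fl mulrDl mulfV ?gt_eqF//.
  have /Num.Theory.truncn_itv/andP[h1 h2] : 0 <= t / T by rewrite divr_ge0// ltW.
  apply/eqP; rewrite Num.Theory.truncn_eq; last by rewrite addr_ge0// divr_ge0// ltW.
  by rewrite -natr1 lerD2r h1 -natr1 ltrD2r.
by rewrite /half_axis e -[(fl t).+1%:R]natr1 /=; congr (g (iter _ g (c0 _))); ring.
Qed.

Lemma half_axisDn n t : 0 <= t -> half_axis (t + n%:R * T) = iter n g (half_axis t).
Proof.
move=> t0; elim: n => [|n IH]; first by rewrite mul0r addr0.
rewrite -natr1 mulrDl mul1r addrA half_axisD ?IH//.
by rewrite addr_ge0// mulr_ge0// ltW.
Qed.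

(** Negative times are reached by applying a negative power of [g]; every power
   that is large enough gives the same point. *)
Definition full_axis t :=
  let n := (Num.truncn (`|t| / T)).+1 in ((g ^+ n)^-1)%g (half_axis (t + n%:R * T)).

Lemma full_axisE n t : 0 <= t + n%:R * T ->
  full_axis t = ((g ^+ n)^-1)%g (half_axis (t + n%:R * T)).
Proof.
move=> tn; rewrite /full_axis; set k := (Num.truncn _).+1.
have tk : 0 <= t + k%:R * T.
  have /Num.Theory.truncn_itv/andP[_] : 0 <= `|t| / T by rewrite divr_ge0// ltW.
  rewrite -/k ltr_pdivrMr// => h; have := ler_norm (- t); rewrite normrN; lra.
have key i j : 0 <= t + i%:R * T -> (i <= j)%N ->
    ((g ^+ i)^-1)%g (half_axis (t + i%:R * T)) = ((g ^+ j)^-1)%g (half_axis (t + j%:R * T)).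
  move=> ti ij; apply: (@isom_funI _ _ (g ^+ j)%g); rewrite isomKV.
  rewrite -{1}(subnK ij) expgnDr isomM isomKV isomX -half_axisDn//.
  by congr half_axis; rewrite natrB//; ring.
by case: (leqP k n) => [kn|/ltnW nk]; [exact: key|rewrite (key n k)].
Qed.

Lemma full_axis_line : geodesic_line full_axis.
Proof.
suff H s t : s <= t -> mdist (full_axis s) (full_axis t) = t - s.
  move=> s t; case: (leP s t) => [st|/ltW ts].
    by rewrite H// distrC ger0_norm// subr_ge0.
  by rewrite metric_sym H// ger0_norm// subr_ge0.
move=> st; pose k := (Num.truncn (`|s| / T)).+1.
have sk : 0 <= s + k%:R * T.
  have /Num.Theory.truncn_itv/andP[_] : 0 <= `|s| / T by rewrite divr_ge0// ltW.
  rewrite -/k ltr_pdivrMr// => h; have := ler_norm (- s); rewrite normrN; lra.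
rewrite (full_axisE sk) (@full_axisE k t); last by lra.
by rewrite isom_dist half_axisE//; lra.
Qed.

Lemma full_axis_translate t : g (full_axis t) = full_axis (t + T).
Proof.
pose k := (Num.truncn (`|t| / T)).+1.
have tk : 0 <= t + k%:R * T.
  have /Num.Theory.truncn_itv/andP[_] : 0 <= `|t| / T by rewrite divr_ge0// ltW.
  rewrite -/k ltr_pdivrMr// => h; have := ler_norm (- t); rewrite normrN; lra.
rewrite (full_axisE tk) (@full_axisE k (t + T)); last by rewrite addrAC addr_ge0// ltW.
rewrite addrAC half_axisD//; apply: (@isom_funI _ _ (g ^+ k)%g).
by rewrite isomKV -isomM -expgSr expgS isomM isomKV.
Qed.

End HyperbolicAxis.

(** The broken geodesic through the orbit of a point of minimal displacement is
   a geodesic line, because displacements double along the powers [g^(2^k)]. *)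
Lemma axis_nonempty g : hyperbolic g -> exists z, axis g z.
Proof.
move=> [T0 [z zT]]; have [c0 c0g] := catX.1 z (g z).
exists (full_axis g c0 0), (full_axis g c0); split; last by exists 0.
  exact: (full_axis_line T0 zT).
by move=> t; rewrite (full_axis_translate T0).
Qed.

(** A path from [x] to [g x]: to the axis, along it, and back. *)
Lemma displacement_le_axial x g : hyperbolic g -> mdist x (g x) <= axial_length x g.
Proof.
move=> hg; have [z0 az0] := axis_nonempty hg.
rewrite /axial_length -lerBlDl -ler_pdivrMl//.
apply: lb_le_inf; first by exists (mdist x z0), z0.
move=> _ [z [c [cl ct [t zt]]] <-].
have := metric_triangle x z (g x); have := metric_triangle z (g z) (g x).
rewrite isom_dist (metric_sym z x) zt ct cl.
rewrite opprD addNKr normrN ger0_norm ?(ltW hg.1)//; lra.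
Qed.

End Axis.

(** * Rays, boundary points and the Bourdon metric *)

Section Rays.
Context {R : realType} {X : metricType R}.
Implicit Types (x y z p q o w : X) (c : R -> X) (s t : R) (xi eta : boundary X).

Lemma rays_ray xi c : rays xi c -> ray c.
Proof. by have [c0 _ ->] := raysP xi; case. Qed.

Lemma ray_dist c s t : ray c -> 0 <= s -> s <= t -> mdist (c s) (c t) = t - s.
Proof.
by move=> rc s0 st; rewrite rc ?(le_trans s0)// distrC ger0_norm// subr_ge0.
Qed.

Lemma asymptotic_sym c c' : asymptotic c c' -> asymptotic c' c.
Proof. by case=> K h; exists K => t t0; rewrite metric_sym h. Qed.

Lemma asymptotic_trans c1 c2 c3 : asymptotic c1 c2 -> asymptotic c2 c3 -> asymptotic c1 c3.
Proof.
case=> K h [K' h']; exists (K + K') => t t0.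
by apply: le_trans (metric_triangle _ (c2 t) _) _; rewrite lerD ?h ?h'.
Qed.

Lemma rays_asymptotic xi c c' : rays xi c -> rays xi c' -> asymptotic c c'.
Proof.
have [c0 _ ->] := raysP xi => -[_ h] [_ h'].
by apply: asymptotic_trans h'; exact: asymptotic_sym.
Qed.

Lemma boundary_ext xi eta : rays xi = rays eta -> xi = eta.
Proof.
case: xi => r rP; case: eta => r' rP' /= e; move: rP rP'; rewrite e => rP rP'.
by rewrite (Prop_irrelevance rP rP').
Qed.

Lemma asymptotic_boundary_eq xi eta c c' :
  rays xi c -> rays eta c' -> asymptotic c c' -> xi = eta.
Proof.
move=> xc ec' cc'; apply: boundary_ext; move: xc ec'.
have [c0 _ ->] := raysP xi; have [c1 _ ->] := raysP eta => -[_ a] [_ b].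
have ab : asymptotic c0 c1.
  apply: asymptotic_trans a _; apply: asymptotic_trans cc' _; exact: asymptotic_sym.
apply/seteqP; split=> d [rd ad]; split=> //.
  by apply: asymptotic_trans ad; exact: asymptotic_sym.
exact: asymptotic_trans ad.
Qed.

Definition rep o xi : R -> X := xget (cst o) (rays xi).

Lemma rep_rays o xi : rays xi (rep o xi).
Proof.
rewrite /rep; have [c cr e] := raysP xi.
have : rays xi c by rewrite e; split=> //; exists 0 => t _; rewrite mdistxx.
by move=> h; apply: (@xgetPex _ (cst o) (rays xi)); exists c.
Qed.

(** Twice the Gromov product is the sum of the terms [d(o, c t) - t] of the two
   rays, which decrease and are bounded, and of [2t - d(c t, c' t)], which
   increases. *)
Lemma gromov_ray_cvg o c c' : ray c -> ray c' ->
  cvg ((gromov o (c t) (c' t))%:E @[t --> +oo]).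
Proof.
move=> rc rc'.
have defect d : ray d -> exists l : R,
    mdist o (d (Num.max 0 t)) - Num.max 0 t @[t --> +oo] --> l.
  move=> rd; eexists; pose f t := - (mdist o (d (Num.max 0 t)) - Num.max 0 t).
  rewrite (_ : (fun t => _) = \- f); last by apply/funext => t; rewrite /f /= opprK.
  apply: cvgN; apply: nondecreasing_cvgr.
    move=> s t st; rewrite /f lerN2.
    have m0 : 0 <= Num.max 0 s by rewrite le_max lexx.
    have m1 : 0 <= Num.max 0 t by rewrite le_max lexx.
    have mm : Num.max 0 s <= Num.max 0 t by rewrite ge_max m1 le_max st orbT.
    have := metric_triangle o (d (Num.max 0 s)) (d (Num.max 0 t)).
    by rewrite ray_dist//; lra.
  exists (mdist o (d 0)) => _ [t _ <-]; rewrite /f.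
  have m1 : 0 <= Num.max 0 t by rewrite le_max lexx.
  have := metric_triangle (d 0) o (d (Num.max 0 t)); rewrite ray_dist//.
  rewrite (metric_sym (d 0) o); lra.
have [a ha] := defect c rc; have [b hb] := defect c' rc'.
pose g t := ((2 * Num.max 0 t - mdist (c (Num.max 0 t)) (c' (Num.max 0 t))) / 2)%:E.
have hg : g t @[t --> +oo] --> ereal_sup (range g).
  apply: nondecreasing_cvge => s t st; rewrite lee_fin ler_pM2r//.
  have m0 : 0 <= Num.max 0 s by rewrite le_max lexx.
  have m1 : 0 <= Num.max 0 t by rewrite le_max lexx.
  have mm : Num.max 0 s <= Num.max 0 t by rewrite ge_max m1 le_max st orbT.
  have := metric_triangle (c (Num.max 0 t)) (c (Num.max 0 s)) (c' (Num.max 0 t)).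
  have := metric_triangle (c (Num.max 0 s)) (c' (Num.max 0 s)) (c' (Num.max 0 t)).
  by rewrite (metric_sym (c (Num.max 0 t)) (c (Num.max 0 s))) !ray_dist//; lra.
pose f t := (mdist o (c (Num.max 0 t)) - Num.max 0 t +
   (mdist o (c' (Num.max 0 t)) - Num.max 0 t)) / 2.
have hf : (f t)%:E @[t --> +oo] --> ((a + b) / 2)%:E.
  apply: cvg_EFin; first by near=> t.
  by apply: cvgMl; apply: cvgD.
apply/cvg_ex; exists (((a + b) / 2)%:E + ereal_sup (range g))%E.
have h := cvgeD (@fin_num_adde_defr R ((a + b) / 2)%:E (ereal_sup (range g)) isT) hf hg.
apply: (cvg_trans _ (h _)); apply: near_eq_cvg.
near=> t; have t0 : 0 <= t by near: t; apply: nbhs_pinfty_ge.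
rewrite /f /g -EFinD (max_idPr t0) /gromov; congr EFin; field.
Unshelve. all: by end_near.
Qed.

Lemma gromov_bd_le o xi eta (D : R) :
  (forall c c', rays xi c -> rays eta c' ->
     \forall t \near +oo, D <= gromov o (c t) (c' t)) ->
  (D%:E <= gromov_bd o xi eta)%E.
Proof.
move=> h; apply: lime_ge.
  by apply: gromov_ray_cvg; apply: rays_ray (rep_rays o _).
have := h _ _ (rep_rays o xi) (rep_rays o eta).
by apply: filterS => t; rewrite lee_fin.
Qed.

Lemma gromov_bd_ge o xi eta (D : R) :
  (forall c c', rays xi c -> rays eta c' ->
     \forall t \near +oo, gromov o (c t) (c' t) <= D) ->
  (gromov_bd o xi eta <= D%:E)%E.
Proof.
move=> h; apply: lime_le.
  by apply: gromov_ray_cvg; apply: rays_ray (rep_rays o _).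
have := h _ _ (rep_rays o xi) (rep_rays o eta).
by apply: filterS => t; rewrite lee_fin.
Qed.

Lemma gromov_bd_ge0 o xi eta : (0 <= gromov_bd o xi eta)%E.
Proof. by apply: gromov_bd_le => c c' _ _; near=> t; exact: gromov_ge0.
Unshelve. all: by end_near. Qed.

Lemma bourdon_le o xi eta (D : R) :
  (forall c c', rays xi c -> rays eta c' ->
     \forall t \near +oo, D <= gromov o (c t) (c' t)) ->
  bourdon o xi eta <= expR (- D).
Proof.
move=> /gromov_bd_le; rewrite /bourdon; have := gromov_bd_ge0 o xi eta.
case: (gromov_bd o xi eta) => [r| |]//= _.
by rewrite !lee_fin ler_expR lerN2.
Qed.

Lemma bourdon_ge o xi eta (D : R) :
  (forall c c', rays xi c -> rays eta c' ->
     \forall t \near +oo, gromov o (c t) (c' t) <= D) ->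
  expR (- D) <= bourdon o xi eta.
Proof.
move=> /gromov_bd_ge; rewrite /bourdon; have := gromov_bd_ge0 o xi eta.
case: (gromov_bd o xi eta) => [r| |]//=.
by rewrite !lee_fin ler_expR lerN2.
Qed.

Lemma gromov_lipschitz o x y z : gromov o x y - mdist y z <= gromov o x z.
Proof.
rewrite /gromov; have := metric_triangle o z y; have := metric_triangle x y z.
rewrite (metric_sym z y); lra.
Qed.

Lemma converges_to_bdP o (x : nat -> X) xi c (M : R) : converges_to_bd o x xi -> rays xi c ->
  exists N T, forall n t, (N <= n)%N -> T <= t -> M <= gromov o (x n) (c t).
Proof.
move=> h xc; have [[A B] /= [[N _ hN] [T [Tr hT]]] AB] := h c xc M.
exists N, (T + 1) => n t Nn Tt; apply: (AB (n, t)); split; first exact: hN.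
by apply: hT; rewrite (lt_le_trans _ Tt)// ltrDl.
Qed.

Lemma converges_to_bd_intro o (x : nat -> X) xi c : rays xi c ->
  (forall M, exists N T, forall n t, (N <= n)%N -> T <= t -> M <= gromov o (x n) (c t)) ->
  converges_to_bd o x xi.
Proof.
move=> xc h c' xc' M; have [K hK] := rays_asymptotic xc xc'.
have [N [T hNT]] := h (M + K).
exists ([set n | (N <= n)%N], [set t | Num.max 0 T < t]).
  by split => /=; [exists N|exists (Num.max 0 T); split => //; exact: num_real].
move=> [n t] /= [Nn]; rewrite gt_max => /andP[t0 Tt].
have := hNT n t Nn (ltW Tt); have := hK t (ltW t0).
by have := gromov_lipschitz o (x n) (c t) (c' t); lra.
Qed.

Lemma gromov_isom o x y (g : isom X) : gromov (g o) (g x) (g y) = gromov o x y.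
Proof. by rewrite /gromov !isom_dist. Qed.

Lemma gromov_swap o x y : gromov o x y = mdist o x - gromov x o y.
Proof. by rewrite /gromov (metric_sym x o); field. Qed.

End Rays.

Section CatRays.
Context {R : realType} {X : metricType R} (catX : cat_minus_one X).
Implicit Types (x y z p q o w : X) (c : R -> X) (s t : R) (xi eta : boundary X).

Lemma exp_gromov_triangle3 o x y z w :
  expR (- gromov o x w) <=
  expR (- gromov o x y) + expR (- gromov o y z) + expR (- gromov o z w).
Proof.
apply: le_trans (exp_gromov_triangle catX o x z w) _.
by rewrite lerD2r exp_gromov_triangle.
Qed.

Lemma gromov_ray_self o c s t : ray c -> 0 <= s -> s <= t ->
  s - mdist o (c 0) <= gromov o (c s) (c t).
Proof.
move=> rc s0 st; have t0 := le_trans s0 st.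
have := metric_triangle (c 0) o (c s); have := metric_triangle (c 0) o (c t).
rewrite /gromov !ray_dist// (metric_sym (c 0) o); lra.
Qed.

(** By the triangle inequality through far points of the two rays, the Gromov
   product of [c t] and [c' t] is [t] up to a constant. *)
Lemma gromov_unbounded_asymptotic o c c' : ray c -> ray c' ->
  (forall M, exists s t, [/\ M <= s, M <= t & M <= gromov o (c s) (c' t)]) -> asymptotic c c'.
Proof.
move=> rc rc' h; pose a := mdist o (c 0); pose b := mdist o (c' 0).
have a0 : 0 <= a := mdist_ge0 _ _; have b0 : 0 <= b := mdist_ge0 _ _.
exists (a + b + 2 * (a + b + ln 3)) => t t0.
have [s [u [ts tu hM]]] := h t.
have h1 := gromov_ray_self o rc t0 ts; have h2 := gromov_ray_self o rc' t0 tu.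
have := exp_gromov_triangle3 o (c t) (c s) (c' u) (c' t).
rewrite (gromov_sym o (c' u) (c' t)) -/a -/b in h1 h2 * => h3.
have : expR (- gromov o (c t) (c' t)) <= expR (- (t - (a + b + ln 3))).
  apply: (le_trans h3); rewrite opprB (addrAC (a + b)) expRD [X in _ * X]lnK ?posrE//.
  have e1 : expR (- gromov o (c t) (c s)) <= expR (a + b - t) by rewrite ler_expR; lra.
  have e2 : expR (- gromov o (c s) (c' u)) <= expR (a + b - t) by rewrite ler_expR; lra.
  have e3 : expR (- gromov o (c' t) (c' u)) <= expR (a + b - t) by rewrite ler_expR; lra.
  lra.
rewrite ler_expR lerN2 /gromov.
have := metric_triangle o (c 0) (c t); have := metric_triangle o (c' 0) (c' t).
rewrite !ray_dist// -/a -/b; lra.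
Qed.

Lemma distinct_boundary_bound o xi eta c c' : rays xi c -> rays eta c' -> xi <> eta ->
  exists M, forall s t, M <= s -> M <= t -> gromov o (c s) (c' t) <= M.
Proof.
move=> xc ec ne; apply: contrapT => /forallNP h; apply: ne.
apply: (asymptotic_boundary_eq xc ec).
apply: (@gromov_unbounded_asymptotic o) (rays_ray xc) (rays_ray ec) _ => M.
have /existsNP[s /existsNP[t /not_implyP[Ms /not_implyP[Mt /negP]]]] := h M.
by rewrite -ltNge => lt; exists s, t; rewrite (ltW lt).
Qed.

Lemma proper_cauchy_limit (properX : proper_space X) (y : nat -> X) :
  (forall e : R, 0 < e -> exists N, forall k l, (N <= k)%N -> (N <= l)%N -> mdist (y k) (y l) <= e) ->
  exists p, forall e : R, 0 < e -> exists N, forall k, (N <= k)%N -> mdist (y k) p <= e.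
Proof.
move=> cy; have [N1 h1] := cy 1 ltr01.
have [|p [_ clp]] := properX (y N1) 1 (y @ \oo) _.
  by exists N1 => //= k N1k; exact: h1.
exists p => e e0; have e20 : 0 < e / 2 by rewrite divr_gt0.
have [N hN] := cy _ e20; exists N => k Nk.
have : (y @ \oo) [set z | exists2 l, (N <= l)%N & z = y l].
  by exists N => //= l Nl; exists l.
have : nbhs p (ball p (e / 2)) by exact: nbhsx_ballx.
move=> nb /clp/(_ nb)[_ [[l Nl ->]]]; rewrite ballEmdist /= => hl.
have := metric_triangle (y k) (y l) p; have := hN k l Nk Nl.
by rewrite (metric_sym (y l) p); lra.
Qed.

(** A sequence with Gromov products tending to infinity converges to a boundary
   point: the geodesics from [o] to its terms converge at each time. *)
Lemma gromov_cauchy_limit (properX : proper_space X) o (x : nat -> X) :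
  (forall M : R, exists N, forall k l, (N <= k)%N -> (N <= l)%N -> M <= gromov o (x k) (x l)) ->
  exists xi, converges_to_bd o x xi.
Proof.
move=> cx.
have /choice[c cP] : forall k, exists c, geodesic o (x k) c by move=> k; exact: catX.1.
have cc t : 0 <= t -> forall e : R, 0 < e -> exists N, forall k l,
    (N <= k)%N -> (N <= l)%N -> mdist (c k t) (c l t) <= e.
  move=> t0 e e0; have [N hN] := cx (Num.max t (t - ln (e / 2))).
  exists N => k l Nk Nl; have := hN k l Nk Nl; rewrite ge_max => /andP[h1 h2].
  apply: le_trans (geodesic_fellow catX (cP k) (cP l) t0 _ _) _.
  - exact: le_trans h1 (gromov_lel _ _ _).
  - exact: le_trans h1 (gromov_ler _ _ _).
  rewrite mulrC -ler_pdivlMr// -[leRHS]lnK ?posrE ?divr_gt0// ler_expR; lra.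
have /choice[d dP] : forall t, exists p, 0 <= t -> forall e : R, 0 < e ->
    exists N, forall k, (N <= k)%N -> mdist (c k t) p <= e.
  move=> t; case: (leP 0 t) => [t0|_]; last by exists o.
  by have [p hp] := proper_cauchy_limit properX (cc t t0); exists p.
have big (M : R) : exists N, forall k, (N <= k)%N -> M <= mdist o (x k).
  have [N hN] := cx M; exists N => k Nk.
  exact: le_trans (hN k k Nk Nk) (gromov_lel _ _ _).
have rd : ray d.
  move=> s t s0 t0; apply/eqP; rewrite -subr_eq0 -normr_le0; apply/ler_addgt0Pr => e e0.
  rewrite add0r; have e20 : 0 < e / 2 by rewrite divr_gt0.
  have [N1 h1] := dP s s0 _ e20; have [N2 h2] := dP t t0 _ e20.
  have [N3 h3] := big (Num.max s t); pose k := maxn N1 (maxn N2 N3).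
  have := h1 k; rewrite leq_max leqnn => /(_ isT) {}h1.
  have := h2 k; rewrite !leq_max leqnn orbT => /(_ isT) {}h2.
  have := h3 k; rewrite !leq_max leqnn !orbT => /(_ isT); rewrite ge_max => /andP[ks kt].
  have [_ _ ck] := cP k; have := ck s t; rewrite !in_itv/= s0 t0 ks kt => /(_ isT isT) <-.
  rewrite ler_norml; have := metric_triangle (c k s) (d s) (c k t).
  have := metric_triangle (d s) (d t) (c k t).
  have := metric_triangle (d s) (c k s) (d t).
  have := metric_triangle (c k s) (c k t) (d t).
  rewrite (metric_sym (d s) (c k s)) (metric_sym (d t) (c k t)); lra.
pose xi := @Boundary R X [set c' | ray c' /\ asymptotic d c'] (ex_intro2 _ _ d rd erefl).
exists xi; apply: (@converges_to_bd_intro _ _ _ _ _ d).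
  by split=> //; exists 0 => t _; rewrite mdistxx.
move=> M; pose M' := M + 1 + ln 2; have [N hN] := cx M'.
exists N, (Num.max 0 M') => n t Nn; rewrite ge_max => /andP[t0 Mt].
have [N1 h1] := dP t t0 1 ltr01; have [N2 h2] := big t.
pose k := maxn N (maxn N1 N2).
have := h1 k; rewrite !leq_max leqnn orbT => /(_ isT) {}h1.
have := h2 k; rewrite !leq_max leqnn !orbT => /(_ isT) {}h2.
have := hN n k Nn; rewrite !leq_max leqnn => /(_ isT) {}hN.
have tk : 0 <= t <= mdist o (x k) by rewrite t0.
have g1 : t <= gromov o (x k) (c k t).
  by rewrite /gromov (geodesic0 (cP k) tk) (metric_sym (x k)) (geodesic1 (cP k) tk); lra.
have g2 : M + 1 <= gromov o (x n) (c k t).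
  rewrite -lerN2 -ler_expR; apply: le_trans (exp_gromov_triangle catX o _ (x k) _) _.
  have : expR (- M') = expR (- (M + 1)) / 2.
    by rewrite /M' opprD expRD expRN (expRN (ln 2)) lnK// posrE.
  have : expR (- gromov o (x n) (x k)) <= expR (- M') by rewrite ler_expR lerN2.
  have : expR (- gromov o (x k) (c k t)) <= expR (- M') by rewrite ler_expR lerN2 (le_trans Mt).
  lra.
have := gromov_lipschitz o (x n) (c k t) (d t); lra.
Qed.

(** Distances between boundary points are read off from approximating orbits. *)
Lemma bourdon_le_orbit o (x y : nat -> X) xi eta (D : R) : 0 < D ->
  converges_to_bd o x xi -> converges_to_bd o y eta ->
  (forall n, exists k l, [/\ (n <= k)%N, (n <= l)%N & expR (- gromov o (x k) (y l)) <= D]) ->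
  bourdon o xi eta <= D.
Proof.
move=> D0 cx cy h; apply/ler_addgt0Pr => e e0.
have De : 0 < D + e by rewrite addr_gt0.
rewrite -[leRHS]lnK ?posrE// -[ln _]opprK; apply: bourdon_le => c c' xc yc.
have [N [T hT]] := converges_to_bdP (- ln (e / 2)) cx xc.
have [N' [T' hT']] := converges_to_bdP (- ln (e / 2)) cy yc.
have [k [l [kN lN kl]]] := h (maxn N N').
near=> t.
have tT : T <= t by near: t; apply: nbhs_pinfty_ge; exact: num_real.
have tT' : T' <= t by near: t; apply: nbhs_pinfty_ge; exact: num_real.
have := hT k t; rewrite (leq_trans (leq_maxl _ _) kN) tT => /(_ isT isT) h1.
have := hT' l t; rewrite (leq_trans (leq_maxr _ _) lN) tT' => /(_ isT isT) h2.
rewrite lerNl -ler_expR lnK ?posrE//.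
have := exp_gromov_triangle3 o (c t) (x k) (y l) (c' t).
have e2 u : - ln (e / 2) <= u -> expR (- u) <= e / 2.
  by move=> hu; rewrite -[leRHS]lnK ?posrE ?divr_gt0// ler_expR lerNl.
rewrite (gromov_sym o (c t) (x k)); have := e2 _ h1; have := e2 _ h2; lra.
Unshelve. all: by end_near.
Qed.

Lemma bourdon_ge_near o xi eta (D : R) p q a b : 0 < D ->
  (forall c, rays xi c -> \forall t \near +oo, expR (- gromov o p (c t)) <= a) ->
  (forall c, rays eta c -> \forall t \near +oo, expR (- gromov o q (c t)) <= b) ->
  D + a + b <= expR (- gromov o p q) ->
  D <= bourdon o xi eta.
Proof.
move=> D0 hp hq h; rewrite -[leLHS]lnK ?posrE// -[ln _]opprK; apply: bourdon_ge => c c' xc yc.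
have := hp c xc; have := hq c' yc; apply: filterS2 => t h1 h2.
rewrite lerNr -ler_expR lnK ?posrE//.
have := exp_gromov_triangle3 o p (c t) (c' t) q.
rewrite (gromov_sym o (c' t) q); lra.
Qed.

End CatRays.

(** * Orbits and the critical exponent *)

Section Orbits.
Context {R : realType} {X : metricType R}.
Implicit Types (x y z p q o : X) (s t : R) (g h k : isom X) (W G : set (isom X)).

Definition len o g : R := mdist o (g o).

Definition poincare o s W : \bar R := \esum_(g in W) (expR (- s * len o g))%:E.

Lemma len_ge0 o g : 0 <= len o g. Proof. exact: mdist_ge0. Qed.

Lemma lenV o g : len o g^-1%g = len o g.
Proof. by rewrite /len metric_sym mdist_isomV. Qed.

Lemma mdist_orbit o g h : mdist (g o) (h o) = len o (g^-1 * h)%g.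
Proof. by rewrite /len isomM -[in RHS](isom_dist g) isomKV. Qed.

Lemma poincare_ge0 o s W : (0 <= poincare o s W)%E.
Proof. by apply: esum_ge0 => g _; rewrite lee_fin expR_ge0. Qed.

Lemma critical_exponent_ge0 o G : (0 <= critical_exponent o G)%E.
Proof.
by apply: le_ereal_inf_tmp => _ [s [s0 _] <-]; rewrite lee_fin ltW.
Qed.

Lemma poincare_fin o s G : (critical_exponent o G < s%:E)%E ->
  (poincare o s G < +oo)%E.
Proof.
case/ereal_inf_lt => _ [t [t0 ht] <-]; rewrite lte_fin => ts.
apply: le_lt_trans ht; apply: le_esum => g _; rewrite lee_fin ler_expR.
by rewrite !mulNr lerN2 ler_wpM2r ?mdist_ge0// ltW.
Qed.

Lemma poincare_inf o s G : 0 < s -> (s%:E < critical_exponent o G)%E ->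
  poincare o s G = +oo%E.
Proof.
move=> s0 sd; apply/eqP; rewrite -leye_eq leNgt; apply/negP => h.
move: sd; rewrite ltNge => /negP; apply; apply: ereal_inf_lbound.
by exists s.
Qed.

Lemma finite_ball o s G (r : R) : 0 < s -> (poincare o s G < +oo)%E ->
  finite_set [set g | G g /\ len o g <= r].
Proof.
move=> s0 fin; apply: (@esum_finite_set _ _ _ (fun g => (expR (- s * len o g))%:E)
   (expR (- s * r))); first exact: expR_gt0.
  by move=> g [_ gr]; rewrite lee_fin ler_expR !mulNr lerN2 ler_wpM2l// ltW.
by apply: le_lt_trans fin; apply: esum_subset => g [].
Qed.

Lemma finite_len_bound o (F : set (isom X)) : finite_set F ->
  exists r : R, 0 <= r /\ forall g, F g -> len o g <= r.
Proof.
move=> /finite_setP[n]; elim: n F => [|n IH] F.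
  by rewrite II0 card_eq0 => /eqP ->; exists 0.
move=> /eq_cardSP[g Fg /IH[r [r0 hr]]]; exists (Num.max r (len o g)).
split=> [|h Fh]; first by rewrite le_max r0.
rewrite le_max; have [->|hg] := pselect (h = g); first by rewrite lexx orbT.
by rewrite hr.
Qed.

Lemma converges_subseq o (x : nat -> X) xi (phi : nat -> nat) :
  (forall n, (n <= phi n)%N) -> converges_to_bd o x xi -> converges_to_bd o (x \o phi) xi.
Proof.
move=> hphi cx; have c := rep_rays o xi.
apply: (converges_to_bd_intro c) => M.
have [N [T h]] := converges_to_bdP M cx c; exists N, T => n t Nn.
by apply: h; exact: leq_trans (hphi n).
Qed.

(** A sequence of isometries whose orbit converges to the boundary leaves every
   bounded set, so one of finitely many sets covering the far part of the group
   contains infinitely many of its terms. *)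
Lemma converging_pigeonhole o G xi (g : nat -> isom X) (r : seq (isom X))
    (K : isom X -> set (isom X)) (T : R) :
  (forall n, G (g n)) -> converges_to_bd o (fun n => g n o) xi ->
  (forall h, G h -> T < len o h -> exists2 k, k \in r & K k h) ->
  exists k, k \in r /\
    exists2 g', (forall n, K k (g' n)) & converges_to_bd o (fun n => g' n o) xi.
Proof.
move=> Gg cg hK; have c := rep_rays o xi.
have [N [t0 hN]] := converges_to_bdP (T + 1) cg c.
have far n : (N <= n)%N -> T < len o (g n).
  move=> Nn; have := hN n t0 Nn (lexx _).
  have := gromov_lel o (g n o) (rep o xi t0); rewrite -/(len o _); lra.
have : exists k, k \in r /\ forall n, exists m, (n <= m)%N /\ K k (g m).
  apply: contrapT => /forallNP no.
  suff [M HM] : exists M, forall k, k \in r -> forall m, (M <= m)%N -> ~ K k (g m).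
    have [k kr] := hK _ (Gg (maxn M N)) (far _ (leq_maxr _ _)).
    exact: (HM k kr _ (leq_maxl _ _)).
  have {}no k : k \in r -> exists n, forall m, (n <= m)%N -> ~ K k (g m).
    move=> kr; apply: contrapT => /forallNP h; apply: (no k); split => // n.
    have /existsNP[m /not_implyP[nm /contrapT Kk]] := h n.
    by exists m.
  elim: r {hK} no => [|k r IH] no; first by exists 0%N.
  have [|M HM] := IH; first by move=> h hr; apply: no; rewrite inE hr orbT.
  have [|n hn] := no k; first by rewrite inE eqxx.
  exists (maxn M n) => h; rewrite inE => /orP[/eqP ->|hr] m; rewrite geq_max => /andP[Mm nm].
    exact: hn.
  exact: HM.
move=> [k [kr /choice[phi hphi]]]; exists k; split => //.
exists (g \o phi) => [n|]; first by have [] := hphi n.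
by apply: (converges_subseq _ cg) => n; have [] := hphi n.
Qed.

(** Coverings of the far orbit become coverings of the limit set: a limit point is
   approached by infinitely many orbit points of one piece, and bounds on the
   visual distances inside a piece pass to the limit. *)
Lemma hausdorff_measure_orbit_eq0 (catX : cat_minus_one X) o G s : 0 < s ->
  (forall e : R, 0 < e -> exists (r : seq (isom X)) (K : isom X -> set (isom X))
      (d : isom X -> R) (T : R),
    [/\ forall h, G h -> T < len o h -> exists2 k, k \in r & K k h,
        forall k, k \in r -> 0 < d k,
        forall k g h, k \in r -> K k g -> K k h -> expR (- gromov o (g o) (h o)) <= d k &
        \sum_(k <- r) (d k) `^ s <= e]) ->
  hausdorff_measure (bourdon o) s (limit_set o G) = 0%E.
Proof.
move=> s0 H; apply/eqP; rewrite eq_le; apply/andP; split; last first.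
  apply: (@le_trans _ _ (hausdorff_content (bourdon o) s 1 (limit_set o G))); last first.
    by apply: ereal_sup_ubound; exists 1 => //=.
  apply: le_ereal_inf_tmp => _ [U _ <-]; apply: nneseries_ge0 => n _ _.
  exact: poweR_ge0.
apply: ge_ereal_sup => _ [eps /= eps0 <-].
apply/lee_addgt0Pr => e e0; rewrite add0e.
have m0 : 0 < Num.min e (eps `^ s) by rewrite lt_min e0 powR_gt0.
have [r [K [d [T [cov dpos dK sumd]]]]] := H _ m0.
have dsmall k : k \in r -> d k <= eps.
  move=> kr; have : d k `^ s <= eps `^ s.
    apply: (@le_trans _ _ (Num.min e (eps `^ s))); last by rewrite ge_min lexx orbT.
    apply: le_trans sumd; rewrite (big_rem k kr)/= lerDl.
    by apply: sumr_ge0 => *; exact: powR_ge0.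
  apply: contraTT; rewrite -!ltNge => lt; apply: gt0_ltr_powR => //.
    by rewrite nnegrE ltW.
  by rewrite nnegrE ltW// dpos.
pose V k := [set xi | exists2 g, (forall n, K k (g n)) & converges_to_bd o (fun n => g n o) xi].
pose U n := if (n < size r)%N then V (nth 1%g r n) else set0.
have diamV k : k \in r -> (diameter (bourdon o) (V k) <= (d k)%:E)%E.
  move=> kr; apply: ge_ereal_sup => x [->|]; first by rewrite lee_fin ltW// dpos.
  move=> [[xi eta] /= [[g gK cg] [h hK ch]] <-]; rewrite lee_fin.
  apply: (bourdon_le_orbit catX (dpos _ kr) cg ch) => n.
  by exists n, n; split => //; exact: dK.
have diam0 : diameter (bourdon o) set0 = 0%E :> \bar R.
  rewrite /diameter (_ : [set _ | _ in _] = set0) ?setU0 ?ereal_sup1//.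
  by apply/seteqP; split => // x [p [[]]].
apply: (@le_trans _ _ (\sum_(0 <= n <oo) poweR (diameter (bourdon o) (U n)) s)%E).
  apply: ereal_inf_lbound; exists U => //; split.
    move=> xi [g Gg cg]; have [k [kr [g' Kg' cg']]] := converging_pigeonhole Gg cg cov.
    exists (index k r) => //=; rewrite /U index_mem kr nth_index//.
    by exists g'.
  move=> n; rewrite /U; case: ifP => nr; last by rewrite diam0 lee_fin ltW.
  by apply: le_trans (diamV _ _) _; rewrite ?lee_fin ?dsmall// mem_nth.
apply: lime_le; first by apply: is_cvg_nneseries => n _ _; exact: poweR_ge0.
near=> N.
apply: (@le_trans _ _ (\sum_(0 <= n < N) (if (n < size r)%N then (d (nth 1%g r n)) `^ s else 0)%:E)%E).
  apply: lee_sum => n _; rewrite /U; case: ifP => nr.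
    have dn := diamV _ (mem_nth 1%g nr); rewrite -poweR_EFin.
    apply: gt0_ler_poweR; rewrite ?(ltW s0)//.
    - by rewrite in_itv/= leey andbT; apply: ereal_sup_ubound; left.
    - by rewrite in_itv/= leey andbT lee_fin ltW// dpos// mem_nth.
  by rewrite diam0 poweR0r// gt_eqF.
rewrite sumEFin lee_fin; apply: (@le_trans _ _ (\sum_(k <- r) (d k) `^ s)); last first.
  by apply: le_trans sumd _; rewrite ge_min lexx.
rewrite (big_nth 1%g) -big_mkcond/=.
have rN : (size r <= N)%N by near: N; exists (size r).
rewrite [leLHS](big_cat_nat (n := size r))//= [X in _ + X]big_nat_cond [X in _ + X]big1 ?addr0.
  rewrite big_nat_cond [leRHS]big_nat_cond le_eqVlt; apply/orP; left; apply/eqP.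
  by apply: eq_bigl => i /=; case: (i < size r)%N.
by move=> i /andP[/andP[h _]]; rewrite ltnNge h.
Unshelve. all: by end_near.
Qed.

Lemma hausdorff_dim_le (T : Type) (rho : T -> T -> R) (A : set T) (d : \bar R) :
  (forall s : R, (d < s%:E)%E -> 0 < s -> hausdorff_measure rho s A = 0%E) ->
  (0 <= d)%E -> (hausdorff_dim rho A <= d)%E.
Proof.
move=> h; case: d h => [d| |] //= h d0; last by rewrite leey.
apply/lee_addgt0Pr => e e0; rewrite -EFinD; apply: ereal_inf_lbound.
have p : 0 < d + e by rewrite ltr_wpDl.
by exists (d + e) => //; split => //; apply: h => //; rewrite lte_fin ltrDl.
Qed.

End Orbits.

(** * Comparison matrices of hyperbolic representatives *)

Section AxialExponents.
Context {R : realType} {X : metricType R} (catX : cat_minus_one X).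
Context (o : X) (G : set (isom X)) (D : gog X) (DG : grp D `<=` G).
Context (C : {set gE D}) (F : gE D -> gE D -> set (set (isom X))).
Context (g : gE D -> gE D -> set (isom X) -> isom X) (hF : hyperbolic_choice C F g).
Context (y : X).
Implicit Types (s : R) (e f : gE D) (c : set (isom X)) (w : seq (gE D * set (isom X))).
Local Notation Y := (gY D).

Definition axial_ok e f c : Prop := [/\ e \in C, f \in C & F e f c].

Lemma axial_okP e f c : axial_ok e f c ->
  [/\ allowed e f c, hyperbolic (g e f c) & c (g e f c * (tau f)^-1)%g].
Proof.
move=> [eC fC Fc]; have [_ /(_ c Fc)[al hyp [k ck gk]]] := hF eC fC.
by split => //; rewrite gk -mulgA mulgV mulg1.
Qed.

Let okB (e : option (gE D)) f c : Prop := if e is Some e0 then axial_ok e0 f c else False.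
Let rp (e : option (gE D)) f c : isom X :=
  if e is Some e0 then (g e0 f c * (tau f)^-1)%g else 1%g.

Let okBP (e : option (gE D)) f c : okB e f c ->
  [/\ cosets (org Y f) f c, c (rp e f c) &
      forall e0, e = Some e0 -> f = bar Y e0 -> c <> egrp f].
Proof.
case: e => [e|] //= /axial_okP[[h1 h2 h3] _ ck]; split => // e0 [<-]; exact: h3.
Qed.

Let wpath_rpath e w : wpath axial_ok e w ->
  rpath okB (tgt Y e) (Some e) w /\ end_vertex (tgt Y e) w = tgt Y (last_edge e w).
Proof.
elim: w e => [|[f c] w IH] e //= [okc pw]; have [h1 h2] := IH f pw.
have [[h3 _ _] _ _] := axial_okP okc; by split => //; split.
Qed.

Definition axial_weight s e f c : R := expR (- s * axial_length y (g e f c)).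

Lemma axial_weight_gt0 s e f c : 0 < axial_weight s e f c. Proof. exact: expR_gt0. Qed.

Lemma axial_weight_le s e w : 0 < s -> wpath axial_ok e w ->
  weight (axial_weight s) e w <= expR (- s * len y (elem rp (Some e) w)).
Proof.
move=> s0; elim: w e => [|[f c] w IH] e /=.
  by rewrite /len isom1 mdistxx mulr0 expR0.
move=> [okc pw]; have [_ hyp _] := axial_okP okc.
apply: (@le_trans _ _ (axial_weight s e f c * expR (- s * len y (elem rp (Some f) w)))).
  by rewrite ler_pM2l ?axial_weight_gt0// IH.
rewrite -expRD ler_expR -mulrDr !mulNr lerN2 ler_pM2l// -(mulgA (g e f c)) mulVg mulg1.
rewrite {1}/len isomM; apply: le_trans (metric_triangle _ (g e f c y) _) _.
by rewrite isom_dist lerD2r; exact: displacement_le_axial.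
Qed.

Lemma poincare_basepoint s : 0 < s -> (poincare o s G < +oo)%E -> (poincare y s G < +oo)%E.
Proof.
move=> s0 fin.
apply: (@le_lt_trans _ _ ((expR (s * (2 * mdist o y)))%:E * poincare o s G)%E).
  rewrite /poincare -esumZ; last 2 first.
  - by rewrite lee_fin expR_ge0.
  - by move=> h; rewrite lee_fin expR_ge0.
  apply: le_esum => h _; rewrite -EFinM -expRD lee_fin ler_expR.
  have t1 := metric_triangle o y (h o); have t2 := metric_triangle y (h y) (h o).
  rewrite isom_dist (metric_sym y o) in t2.
  have : s * len o h <= s * (2 * mdist o y + len y h) by rewrite ler_pM2l//; rewrite /len; lra.
  lra.
move: (poincare_ge0 o s G) fin; case: (poincare o s G) => [r| |]// _ _.
by rewrite -EFinM ltry.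
Qed.

(** The axial length dominates the displacement, and distinct words with the same
   end edges have distinct products: path sums are bounded by the Poincare
   series. *)
Lemma axial_path_sum_fin s e f : 0 < s -> (poincare o s G < +oo)%E ->
  (path_sum axial_ok (axial_weight s) e f < +oo)%E.
Proof.
move=> s0 fin; apply: le_lt_trans (poincare_basepoint s0 fin).
apply: (@le_trans _ _ (\esum_(w in paths axial_ok e f)
    (expR (- s * len y (elem rp (Some e) w)))%:E)%E).
  by apply: le_esum => w [pw _]; rewrite lee_fin axial_weight_le.
apply: (@esum_inj_le _ _ _ _ _ (elem rp (Some e)) (fun h => (expR (- s * len y h))%:E)).
  move=> w w' /set_mem[/wpath_rpath[pw ew] lw] /set_mem[/wpath_rpath[pw' ew'] lw'] eq.
  have v1 (v : gV D) : vgrp v (1%g : isom X) by split; [case: (grpP D)|exact: actV1].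
  apply: (elem_inj okBP pw pw' _ (v1 _) (v1 _)); first by rewrite ew ew' lw lw'.
  by rewrite eq.
by move=> w [/wpath_rpath[pw _] _]; apply: DG; exact: (elem_grp okBP pw).
Qed.

Lemma comparison_mxE s :
  comparison_mx C F g y s = label_mx axial_ok (axial_weight s) C.
Proof.
apply/matrixP => i j; rewrite !mxE /label_sum.
have [finF _] := hF (enum_valP i) (enum_valP j).
rewrite (_ : axial_ok (enum_val i) (enum_val j) = F (enum_val i) (enum_val j)); last first.
  by apply/seteqP; split => [c []//|c Fc]; split => //; exact: enum_valP.
rewrite esum_fset//=; first by rewrite fsumEFin.
by move=> c _; rewrite lee_fin ltW// axial_weight_gt0.
Qed.

Lemma comparison_spectral_lt1 s : 0 < s -> (poincare o s G < +oo)%E ->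
  spectral_radius (comparison_mx C F g y s) < 1.
Proof.
move=> s0 fin; rewrite comparison_mxE.
have pf e f : e \in C -> f \in C -> (path_sum axial_ok (axial_weight s) e f < +oo)%E.
  by move=> _ _; exact: axial_path_sum_fin.
apply: (path_sum_spectral (axial_weight_gt0 s) _ _ pf); first by move=> e f c [].
move=> e f eC fC; apply: le_lt_trans (pf e f eC fC).
by apply: label_sum_le; exact: axial_weight_gt0.
Qed.

Lemma axial_exponent_le : (0 <= critical_exponent o G)%E ->
  (axial_exponent C F g y <= critical_exponent o G)%E.
Proof.
move=> d0; have := @poincare_fin _ _ o ^~ G.
case: (critical_exponent o G) d0 => [d| |] //= d0 hfin; last by rewrite leey.
apply/lee_addgt0Pr => e e0; rewrite -EFinD; apply: ereal_inf_lbound.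
rewrite lee_fin in d0.
have p : 0 < d + e by rewrite ltr_wpDl.
exists (d + e) => //; split => //; apply: comparison_spectral_lt1 => //.
by apply: hfin; rewrite lte_fin ltrDl.
Qed.

End AxialExponents.

Section AxialSup.
Context {R : realType} {X : metricType R}.

Lemma axial_exponents_le (catX : cat_minus_one X) o (G : set (isom X)) (P : gog X -> Prop) :
  (forall D, P D -> grp D `<=` G) ->
  (ereal_sup (axial_exponents P) <= critical_exponent o G)%E.
Proof.
move=> PG; apply: ge_ereal_sup => _ [y [D [PD [C [F [g [_ hF ->]]]]]]].
by apply: (axial_exponent_le catX (PG D PD) hF); exact: critical_exponent_ge0.
Qed.

Lemma node_grp_sub (t : hierarchy X) : forall D, well_formed t -> node_of t D ->
  grp D `<=` hroot t.
Proof.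
move: t; fix IH 1 => -[H|D ch] D' //= wf [->//|[v]].
move: (wf v); case: (ch v) => [t'|] //= [rt wf'] nd h /(IH t' D' wf' nd).
by rewrite rt => -[].
Qed.

End AxialSup.

(** * Upper bound for the dimension of the limit set *)

Section UpperBound.
Context {R : realType} {X : metricType R} (catX : cat_minus_one X).
Context (o : X) (G : set (isom X)) (Gsub : is_subgroup G).
Implicit Types (s : R) (g h k p t x : isom X) (W : set (isom X)).

Lemma sub1 : G 1%g. Proof. by case: Gsub. Qed.
Lemma subM g h : G g -> G h -> G (g * h)%g. Proof. by case: Gsub => _ + _; exact. Qed.
Lemma subV g : G g -> G g^-1%g. Proof. by case: Gsub => _ _; exact. Qed.

(** Convex-cobounded case: every far orbit point lies in the shadow of an orbit
   point at distance about [T], and these shadows have size comparable to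
   [e^-T]. *)
Lemma convex_cobounded_measure0 s : 0 < s -> (poincare o s G < +oo)%E ->
  convex_cobounded o G -> hausdorff_measure (bourdon o) s (limit_set o G) = 0%E.
Proof.
move=> s0 fin [r hr]; apply: (hausdorff_measure_orbit_eq0 catX s0) => e e0.
have r0 : 0 < r.
  have [c cg] := catX.1 o o.
  have : (\bigcup_(g in G) \bigcup_(h in G) segment (g o) (h o)) o.
    exists 1%g; first exact: sub1; exists 1%g; first exact: sub1.
    by exists c, 0; split => //; [rewrite lexx mdist_ge0|case: cg].
  move=> /hr[g Gg [z]]; rewrite ballEmdist /= => oz _.
  exact: le_lt_trans (mdist_ge0 _ _) oz.
pose B : R := 2 * expR (2 * r).
have B0 : 0 < B by rewrite mulr_gt0 ?expR_gt0.
have e'0 : 0 < e / B `^ s by rewrite divr_gt0 ?powR_gt0.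
have [F [finF FG tail]] := esum_tail e'0 (fun g => (expR_ge0 _ : (0 <= (expR (- s * len o g))%:E)%E)) fin.
have [t [t0 ht]] := finite_len_bound o finF.
pose T := t + r + 1.
have finA := finite_ball (T + r) s0 fin.
pose A := [set g | (G g /\ len o g <= T + r) /\ T - r <= len o g].
have fA : finite_set A by apply: sub_finite_set finA => g [].
exists (enum_fset (fset_set A)).
exists (fun k => [set g | [/\ G g, T < len o g & T - r <= gromov o (k o) (g o)]]).
exists (fun k => B * expR (- len o k)), T.
have Ak k : k \in enum_fset (fset_set A) -> A k.
  by move=> kr; apply/set_mem; rewrite -(in_fset_set fA).
split.
- move=> h Gh Th; have [c cg] := catX.1 o (h o).
  have hT : 0 <= T <= mdist o (h o) by rewrite (ltW Th) andbT /T; lra.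
  have : (\bigcup_(g in G) \bigcup_(h in G) segment (g o) (h o)) (c T).
    exists 1%g; first exact: sub1; exists h => //.
    by exists c, T; split.
  move=> /hr[k Gk [z]]; rewrite ballEmdist /= => oz zc.
  have kc : mdist (k o) (c T) < r by rewrite -zc isom_dist.
  have cT := geodesic0 cg hT; have c1 := geodesic1 cg hT.
  have k1 := metric_triangle o (k o) (c T); have k2 := metric_triangle o (c T) (k o).
  rewrite (metric_sym (c T)) in k2.
  exists k.
    have : A k by rewrite /A/= /len; split; [split => //|]; lra.
    by move=> Ak'; rewrite in_fset_set//; exact: mem_set.
  split => //; have := gromov_lipschitz o (h o) (c T) (k o).
  rewrite (gromov_sym o (k o)) (metric_sym (c T)) {1}/gromov cT (metric_sym (h o)) c1.
  rewrite -/(len o h) in hT *; lra.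
- by move=> k _; rewrite mulr_gt0 ?expR_gt0.
- move=> k g h /Ak[[Gk k1] k2] [_ _ gk] [_ _ hk].
  apply: le_trans (exp_gromov_triangle catX o _ (k o) _) _.
  have e1 : expR (- (T - r)) <= expR (2 * r) * expR (- len o k) by rewrite -expRD ler_expR; lra.
  rewrite gromov_sym.
  have e2 : expR (- gromov o (k o) (g o)) <= expR (- (T - r)) by rewrite ler_expR lerN2.
  have e3 : expR (- gromov o (k o) (h o)) <= expR (- (T - r)) by rewrite ler_expR lerN2.
  rewrite /B; lra.
have -> : \sum_(k <- enum_fset (fset_set A)) (B * expR (- len o k)) `^ s =
    B `^ s * \sum_(k <- enum_fset (fset_set A)) expR (- s * len o k).
  rewrite mulr_sumr; apply: eq_bigr => k _.
  by rewrite powRM ?expR_ge0 ?(ltW B0)// -expRM; congr (_ * expR _); ring.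
rewrite mulrC -ler_pdivlMr ?powR_gt0// -lee_fin -sumEFin.
apply: le_trans tail; rewrite -fsbig_finite// -esum_fset//; apply: esum_subset => g [[Gg _] g2].
split => // Fg; have := ht g Fg; rewrite /T in g2; lra.
Qed.

(** * Word-length spanning tree of a finitely generated group *)

Section WordTree.
Context (S : set (isom X)) (finS : finite_set S) (GS : G = smallest (@is_subgroup R X) S).

Definition letters : set (isom X) := S `|` [set g^-1%g | g in S].

Fixpoint word_ball n : set (isom X) :=
  if n is m.+1 then word_ball m `|` [set (p.1 * p.2)%g | p in word_ball m `*` letters]
  else [set 1%g].

Lemma word_ball_mono m n : (m <= n)%N -> word_ball m `<=` word_ball n.
Proof.
move=> /subnK <-; elim: (n - m)%N => [|d IH] // g mg; left; exact: IH.
Qed.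

Lemma letters_sub g : letters g -> G g.
Proof.
have SG h : S h -> G h by move=> Sh; rewrite GS => K [] _ /(_ h Sh).
by case=> [/SG//|[h /SG Gh <-]]; exact: subV.
Qed.

Lemma word_ball_sub n : word_ball n `<=` G.
Proof.
elim: n => [|n IH] g /=; first by move=> ->; exact: sub1.
case=> [/IH//|[[h k] /= [/IH Gh /letters_sub Gk] <-]]; exact: subM.
Qed.

Lemma word_ballM m n g h : word_ball m g -> word_ball n h -> word_ball (m + n) (g * h)%g.
Proof.
elim: n h => [|n IH] h mg /=; first by move=> ->; rewrite mulg1 addn0.
rewrite addnS => -[nh|[[k l] /= [nk Sl] <-]]; first by left; exact: IH.
by right; exists ((g * k)%g, l); [split => //; exact: IH|rewrite /= mulgA].
Qed.

Lemma letter_ball g : letters g -> word_ball 1 g.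
Proof. by move=> Sg; right; exists (1%g, g) => //=; rewrite mul1g. Qed.

Lemma lettersV g : letters g -> letters g^-1%g.
Proof.
by case=> [Sg|[h Sh <-]]; [right; exists g|left; rewrite invgK].
Qed.

Lemma word_ballV n g : word_ball n g -> word_ball n g^-1%g.
Proof.
elim: n g => [|n IH] g /=; first by move=> ->; rewrite invg1.
case=> [/IH|[[h k] /= [nh Sk] <-]]; first by left.
rewrite invgM; have := word_ballM (letter_ball (lettersV Sk)) (IH _ nh).
by rewrite add1n.
Qed.

Lemma word_ball_cover g : G g -> exists n, word_ball n g.
Proof.
rewrite GS => /(_ [set g | exists n, word_ball n g]); apply; split.
  split => [|h k [m mh] [n nk]|h [n nh]]; first by exists 0%N.
    by exists (m + n)%N; exact: word_ballM.
  by exists n; exact: word_ballV.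
by move=> h Sh; exists 1%N; apply: letter_ball; left.
Qed.

Lemma finite_letters : finite_set letters.
Proof. by rewrite finite_setU; split => //; exact: finite_image. Qed.

Lemma finite_word_ball n : finite_set (word_ball n).
Proof.
elim: n => [|n IH] /=; first exact: finite_set1.
rewrite finite_setU; split => //; apply: finite_image; apply: finite_setX => //.
exact: finite_letters.
Qed.

Lemma finite_sub_word_ball (F : set (isom X)) : finite_set F -> F `<=` G ->
  exists n, F `<=` word_ball n.
Proof.
move=> /finite_setP[n]; elim: n F => [|n IH] F.
  by rewrite II0 card_eq0 => /eqP -> _; exists 0%N.
move=> /eq_cardSP[g Fg /IH h] FG.
have [|m hm] := h; first by move=> k [/FG].
have [l gl] := word_ball_cover (FG _ Fg); exists (maxn m l) => k Fk.
have [->|kg] := pselect (k = g); first exact: (word_ball_mono (leq_maxr _ _)).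
by apply: (word_ball_mono (leq_maxl _ _)); apply: hm.
Qed.

Definition sphere n : set (isom X) :=
  if n is m.+1 then word_ball m.+1 `\` word_ball m else [set 1%g].

Lemma sphere_ball n : sphere n `<=` word_ball n.
Proof. by case: n => [|n] //= g []. Qed.

Lemma sphere_not_ball m n g : (m < n)%N -> sphere n g -> ~ word_ball m g.
Proof.
case: n => // n; rewrite ltnS => mn [_ ng] mg; apply: ng; exact: word_ball_mono mg.
Qed.

Lemma sphere_uniq m n g : sphere m g -> sphere n g -> m = n.
Proof.
move=> mg ng; apply/eqP; rewrite eqn_leq; apply/andP; split; rewrite leqNgt.
  by apply/negP => lt; apply: (sphere_not_ball lt mg); exact: sphere_ball.
by apply/negP => lt; apply: (sphere_not_ball lt ng); exact: sphere_ball.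
Qed.

Lemma ball_sphere n g : word_ball n g -> exists2 m, (m <= n)%N & sphere m g.
Proof.
elim: n g => [|n IH] g; first by exists 0%N.
move=> ng; have [/IH[m mn mg]|nng] := pselect (word_ball n g); last by exists n.+1.
by exists m => //; exact: leq_trans mn _.
Qed.

Lemma parent_exists g : exists p, forall n, sphere n.+1 g ->
  sphere n p /\ exists2 t, letters t & g = (p * t)%g.
Proof.
have [[n ng]|none] := pselect (exists n, sphere n.+1 g); last first.
  by exists 1%g => n ng; exfalso; apply: none; exists n.
have [[//|[[p t] [pn St] gpt]] nng] := ng.
exists p => m mg; have /eq_add_S -> := sphere_uniq mg ng; split; last by exists t.
have [l ln pl] := ball_sphere pn; have [<-//|lt] := eqVneq l n.
exfalso; apply: nng; rewrite -gpt; have ltn : (l < n)%N by rewrite ltn_neqAle lt.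
apply: (word_ball_mono ltn); right; exists (p, t) => //; split => //.
exact: sphere_ball.
Qed.

Definition parent g := projT1 (cid (parent_exists g)).

Lemma parentP n g : sphere n.+1 g ->
  sphere n (parent g) /\ exists2 t, letters t & g = (parent g * t)%g.
Proof. by rewrite /parent; case: cid => p /= h ng; exact: h. Qed.

Definition subtree (k m : nat) h : set (isom X) :=
  [set g | exists j, [/\ (j <= m)%N, sphere (k + j) g & iter j parent g = h]].

Lemma iter_parent_sphere (k j : nat) g : sphere (k + j) g -> sphere k (iter j parent g).
Proof.
elim: j g => [|j IH] g; first by rewrite addn0.
by rewrite addnS iterSr => /parentP[/IH].
Qed.

(** Along the branch from [g] to [h] the visual lengths of the edges add up. *)
Lemma branch_visual_length (k m : nat) h g (C : R) : 1 <= C ->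
  (forall t, letters t -> expR (len o t) <= C) ->
  sphere (k + m) g -> iter m parent g = h ->
  ((expR (- gromov o (g o) (h o)))%:E <=
   C%:E * \esum_(x in subtree k m h) (expR (- len o x))%:E)%E.
Proof.
move=> C1 CS; elim: m g => [|m IH] g kg gh.
  move: gh => /= gh; subst h; rewrite /gromov mdistxx subr0 (_ : (_ + _) / 2 = len o g); last by rewrite /len; field.
  apply: (@le_trans _ _ (\esum_(x in subtree k 0 g) (expR (- len o x))%:E)%E).
    apply: (@esum_ge1 _ _ _ (fun x => (expR (- len o x))%:E)); first by move=> x; rewrite lee_fin expR_ge0.
    by exists 0%N.
  apply: lee_pemull; last by rewrite lee_fin.
  by apply: esum_ge0 => x _; rewrite lee_fin expR_ge0.
have kg' : sphere (k + m).+1 g by rewrite -addnS.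
have [kp [t St gt]] := parentP kg'.
have gh' : iter m parent (parent g) = h by rewrite -iterSr.
have {IH} IH := IH _ kp gh'.
apply: (@le_trans _ _ ((expR (- gromov o (g o) (parent g o)))%:E +
   (expR (- gromov o (parent g o) (h o)))%:E)%E).
  by rewrite -EFinD lee_fin exp_gromov_triangle.
have e1 : expR (- gromov o (g o) (parent g o)) <= C * expR (- len o g).
  apply: (@le_trans _ _ (expR (len o t) * expR (- len o g))); last first.
    by rewrite ler_pM2r ?expR_gt0// CS.
  rewrite -expRD ler_expR /gromov (metric_sym (g o)) mdist_orbit.
  have -> : ((parent g)^-1 * g)%g = t by rewrite {2}gt mulKg.
  have := metric_triangle o (parent g o) (g o); rewrite mdist_orbit.
  have -> : ((parent g)^-1 * g)%g = t by rewrite {2}gt mulKg.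
  by rewrite -!/(len o _); lra.
rewrite (esumID [set g] _ (fun x => (expR (- len o x))%:E)); last by move=> *; rewrite lee_fin expR_ge0.
rewrite ge0_muleDr; last 2 first.
- by apply: esum_ge0 => *; rewrite lee_fin expR_ge0.
- by apply: esum_ge0 => *; rewrite lee_fin expR_ge0.
apply: leeD.
  rewrite (_ : _ `&` _ = [set g]).
    by rewrite esum_set1 ?lee_fin ?expR_ge0// -EFinM lee_fin.
  apply/seteqP; split => [x []//|x ->]; split => //.
  by exists m.+1.
apply: le_trans IH _; apply: lee_wpmul2l; first by rewrite lee_fin; lra.
apply: esum_subset => x [j [jm kx xh]]; split; first by exists j; split => //; exact: leqW.
move=> xg; have := sphere_uniq kg; rewrite -xg => /(_ _ kx) /eqP.
by rewrite eqn_add2l => /eqP e; rewrite -e ltnn in jm.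
Qed.

(** Critical exponent below [1]: the subtrees hanging from a word sphere cover the
   far orbit, each has visual diameter at most the sum of its edges, and
   [x -> x^s] is subadditive because [s <= 1]. *)
Lemma small_exponent_measure0 s : 0 < s -> s <= 1 -> (poincare o s G < +oo)%E ->
  hausdorff_measure (bourdon o) s (limit_set o G) = 0%E.
Proof.
move=> s0 s1 fin; apply: (hausdorff_measure_orbit_eq0 catX s0) => e e0.
have [b [b0 hb]] := finite_len_bound o finite_letters.
pose C : R := expR b; have C1 : 1 <= C by rewrite /C expR_ge1.
have CS t : letters t -> expR (len o t) <= C by move=> /hb; rewrite /C ler_expR.
have C0 : 0 < C by rewrite expR_gt0.
have fin1 : (\esum_(g in G) (expR (- len o g))%:E < +oo)%E.
  apply: le_lt_trans fin; apply: le_esum => g _; rewrite lee_fin ler_expR mulNr lerN2.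
  by rewrite -[leRHS]mul1r ler_wpM2r// len_ge0.
have e'0 : 0 < e / (2 * C) `^ s by rewrite divr_gt0 ?powR_gt0 ?mulr_gt0.
have [F [finF FG tail]] := esum_tail e'0 (fun g => (expR_ge0 _ : (0 <= (expR (- s * len o g))%:E)%E)) fin.
have [n hn] := finite_sub_word_ball finF FG.
have fA : finite_set (sphere n.+1).
  by apply: sub_finite_set (finite_word_ball n.+1) => g [].
pose D h := [set g | exists m, subtree n.+1 m h g].
have DG h : D h `<=` G `&` ~` F.
  move=> g [m [j [_ ng _]]]; split; first exact: word_ball_sub (sphere_ball ng).
  by move=> /hn; apply: sphere_not_ball ng; rewrite ltn_addr.
pose f (g : isom X) : R := expR (- len o g).
pose d h : R := 2 * C * fine (\esum_(g in D h) (f g)%:E)%E.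
have f0 g : (0 <= (f g)%:E)%E by rewrite lee_fin expR_ge0.
have finD h : (\esum_(g in D h) (f g)%:E < +oo)%E.
  by apply: le_lt_trans fin1; apply: esum_subset => g /DG[].
have finDE h : (fine (\esum_(g in D h) (f g)%:E))%:E = (\esum_(g in D h) (f g)%:E)%E.
  by apply: fineK; rewrite ge0_fin_numE ?finD//; apply: esum_ge0.
have [T [T0 hT]] := finite_len_bound o (finite_word_ball n).
have Ak k : k \in enum_fset (fset_set (sphere n.+1)) -> sphere n.+1 k.
  by move=> kr; apply/set_mem; rewrite -(in_fset_set fA).
exists (enum_fset (fset_set (sphere n.+1))), D, d, T; split.
- move=> g Gg Tg; have [l lg] := word_ball_cover Gg.
  have [m _ mg] := ball_sphere lg.
  have nm : (n.+1 <= m)%N.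
    rewrite ltnNge; apply/negP => mn; have := hT g (word_ball_mono mn (sphere_ball mg)); lra.
  rewrite -(subnKC nm) in mg; exists (iter (m - n.+1) parent g).
    have sp := iter_parent_sphere mg.
    by rewrite in_fset_set//; exact: mem_set.
  by exists (m - n.+1)%N, (m - n.+1)%N.
- move=> k /Ak nk; rewrite /d mulr_gt0 ?mulr_gt0// -lte_fin finDE.
  apply: (@lt_le_trans _ _ (f k)%:E); first by rewrite lte_fin expR_gt0.
  apply: (@esum_ge1 _ _ (D k) (fun g => (f g)%:E)) => //.
  by exists 0%N, 0%N; split; rewrite ?addn0.
- move=> k g h _ gk hk.
  have half x : D k x -> expR (- gromov o (x o) (k o)) <= C * fine (\esum_(g in D k) (f g)%:E)%E.
    move=> [m [j [_ xj xk]]]; rewrite -lee_fin EFinM finDE.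
    apply: le_trans (branch_visual_length C1 CS xj xk) _.
    apply: lee_wpmul2l; first by rewrite lee_fin; lra.
    by apply: esum_subset => y [i [ij yi yk]]; exists j, i.
  apply: le_trans (exp_gromov_triangle catX o _ (k o) _) _.
  by rewrite (gromov_sym o (k o)) /d; have := half g gk; have := half h hk; lra.
have CC : 0 <= 2 * C by rewrite mulr_ge0// ltW.
have -> : \sum_(k <- enum_fset (fset_set (sphere n.+1))) (d k) `^ s =
    (2 * C) `^ s * \sum_(k <- enum_fset (fset_set (sphere n.+1))) fine (\esum_(g in D k) (f g)%:E)%E `^ s.
  rewrite mulr_sumr; apply: eq_bigr => k _.
  rewrite /d powRM//.
  by rewrite -lee_fin finDE; apply: esum_ge0.
rewrite mulrC -ler_pdivlMr ?powR_gt0 ?mulr_gt0// -lee_fin -sumEFin.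
apply: le_trans tail.
apply: (@le_trans _ _ (\sum_(k <- enum_fset (fset_set (sphere n.+1)))
    \esum_(g in D k) (expR (- s * len o g))%:E)%E).
  apply: lee_sum => k _; apply: le_trans (power_esum_le s0 s1 _ (finD k)) _.
    by move=> i; exact: expR_gt0.
  by apply: le_esum => g _; rewrite lee_fin /f -expRM mulrC mulrN mulNr.
apply: sum_esum_disjoint_le => // h h' x _ _.
move=> [m [j [_ xj <-]]] [m' [j' [_ xj' <-]]].
have /eqP := sphere_uniq xj xj'; by rewrite eqn_add2l => /eqP ->.
Qed.

End WordTree.
End UpperBound.

(** * Orbit points seen away from a given direction *)

Section AwaySums.
Context {R : realType} {X : metricType R} (catX : cat_minus_one X).
Context (o : X) (G : set (isom X)) (Gsub : is_subgroup G).
Implicit Types (s : R) (g h k x : isom X) (p : X).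

(** The elements are terms of two sequences that converge to distinct limit
   points. *)
Lemma separated_pair : non_elementary o G -> exists K : R, forall L : R,
  exists x1 x2, [/\ G x1, G x2, gromov o (x1 o) (x2 o) <= K, L <= len o x1 & L <= len o x2].
Proof.
move=> [a [b [_ [[la lb _] [ab _ _]]]]].
have [g Gg ga] := la; have [h Gh hb] := lb.
have ca := rep_rays o a; have cb := rep_rays o b.
have [M hM] := distinct_boundary_bound catX o ca cb ab.
exists (M + ln 2) => L; pose L' := Num.max L (M + ln 4).
have [N [T hN]] := converges_to_bdP L' ga ca.
have [N' [T' hN']] := converges_to_bdP L' hb cb.
pose t := Num.max M (Num.max T T'); pose n := maxn N N'.
have [Mt Tt Tt'] : [/\ M <= t, T <= t & T' <= t] by rewrite /t !le_max !lexx !orbT.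
have h1 := hN n t (leq_maxl _ _) Tt; have h2 := hN' n t (leq_maxr _ _) Tt'.
have h3 := hM t t Mt Mt.
have := exp_gromov_triangle3 catX o (rep o a t) (g n o) (h n o) (rep o b t) => h4.
exists (g n), (h n); split => //; last 2 first.
- by apply: le_trans (gromov_lel o (g n o) (rep o a t)); apply: le_trans h1; rewrite le_max lexx.
- by apply: le_trans (gromov_lel o (h n o) (rep o b t)); apply: le_trans h2; rewrite le_max lexx.
rewrite -lerN2 -ler_expR opprD expRD [X in _ * X]expRN lnK ?posrE//.
have e1 u : L' <= u -> expR (- u) <= expR (- M) / 4.
  rewrite ge_max => /andP[_ hu]; apply: (@le_trans _ _ (expR (- (M + ln 4)))).
    by rewrite ler_expR lerN2.
  by rewrite opprD expRD [X in _ * X]expRN lnK ?posrE//; lra.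
have := e1 _ h1; have := e1 _ h2; rewrite (gromov_sym o (g n o)).
have : expR (- M) <= expR (- gromov o (rep o a t) (rep o b t)) by rewrite ler_expR lerN2.
lra.
Qed.

Definition orbit_ball (n : R) : set (isom X) := [set g | G g /\ len o g <= n].

Definition away_ball (kappa : R) p (n : R) : set (isom X) :=
  [set g | [/\ G g, len o g <= n & gromov o (g o) p <= kappa]].

Section AwayPair.
Context (x1 x2 : isom X) (Gx1 : G x1) (Gx2 : G x2) (K : R).
Hypothesis x12 : gromov o (x1 o) (x2 o) <= K.
Hypothesis long1 : 2 * K + 8 * ln 2 + 1 <= len o x1.
Hypothesis long2 : 2 * K + 8 * ln 2 + 1 <= len o x2.

Let r := Num.max (len o x1) (len o x2).
(** Both cases in the proof of [away_sum] lead to this threshold. *)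
Definition away_bound := r / 2 + 2 * ln 2 + 1 / 2.

Let ln2_gt0 : 0 < ln 2 :> R. Proof. by rewrite ln_gt0// ltr1n. Qed.
Let exp_ln2 (u : R) : expR (u - ln 2) = expR u / 2.
Proof. by rewrite expRD [X in _ * X]expRN lnK ?posrE. Qed.
Let K_ge0 : 0 <= K. Proof. exact: le_trans (gromov_ge0 _ _ _) x12. Qed.

Lemma away_bound_ge0 : 0 <= away_bound.
Proof.
have r0 : 0 <= r by rewrite /r le_max len_ge0.
by have := ln2_gt0; rewrite /away_bound; lra.
Qed.

(** By the triangle inequality [p] is not close in direction to both [x1 o] and
   [x2 o]; the far one is chosen. *)
Lemma far_translate p : exists x, [/\ G x, 2 * K + 8 * ln 2 + 1 <= len o x,
  len o x <= r & gromov o (x o) p <= K + ln 2].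
Proof.
case: (leP (gromov o (x1 o) p) (K + ln 2)) => [h|h1].
  by exists x1; split => //; rewrite /r le_max lexx.
case: (leP (gromov o (x2 o) p) (K + ln 2)) => [h|h2].
  by exists x2; split => //; rewrite /r le_max lexx orbT.
have := exp_gromov_triangle catX o (x1 o) p (x2 o).
have e1 : expR (- gromov o (x1 o) p) < expR (- K - ln 2) by rewrite ltr_expR; lra.
have e2 : expR (- gromov o (x2 o) p) < expR (- K - ln 2) by rewrite ltr_expR; lra.
have e3 : expR (- K) <= expR (- gromov o (x1 o) (x2 o)) by rewrite ler_expR lerN2.
move: e1 e2; rewrite exp_ln2 (gromov_sym o p); lra.
Qed.

Lemma len_mul_gromov x g :
  len o (x * g)%g = len o x + len o g - 2 * gromov o (x^-1%g o) (g o).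
Proof.
have := mdist_orbit o x^-1%g g; rewrite invgK => <-.
by rewrite /gromov -!/(len _ _) lenV; field.
Qed.

Let shift_inj x (A : set (isom X)) : set_inj A (fun g => (x * g)%g).
Proof. by move=> g h _ _ /(congr1 (fun k => (x^-1 * k)%g)); rewrite !mulKg. Qed.

(** At most a fixed proportion of the Poincare series is concentrated in any
   direction [p]. Translate by [x] with [x o] far from [p]. If [x^-1 o] points
   towards [p], then [g -> x g] shortens by at least [1] every [g] with [g o]
   close to [p]; otherwise it moves [g o] away from [p]. *)
Lemma away_sum p (s n : R) : 0 < s ->
  (poincare o s (orbit_ball n) < +oo)%E ->
  (poincare o s (orbit_ball n) <=
   (Num.max (1 - expR (- s))^-1 (1 + expR (s * r)))%:E *
   poincare o s (away_ball away_bound p (n + r)))%E.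
Proof.
move=> s0 fin; have [x [Gx xlong xr xp]] := far_translate p.
have ln20 := ln2_gt0; have K0 := K_ge0.
set C1 := (1 - _)^-1; set C2 := 1 + _.
set P := poincare _ _ (orbit_ball n) in fin *; set w := poincare _ _ (away_ball _ _ _).
have P0 : (0 <= P)%E := poincare_ge0 _ _ _.
have w0 : (0 <= w)%E := poincare_ge0 _ _ _.
have es1 : 0 < 1 - expR (- s) by rewrite subr_gt0 expR_lt1; lra.
pose N := [set g | orbit_ball n g /\ away_bound < gromov o (g o) p].
have split_le : (P <= w + poincare o s N)%E.
  rewrite /P /poincare (esumID N _ (fun g => (expR (- s * len o g))%:E)); last first.
    by move=> *; rewrite lee_fin expR_ge0.
  rewrite addeC; apply: leeD; apply: esum_subset => g.
    move=> [[Gg gn] nN]; split => //.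
      by apply: le_trans gn _; rewrite lerDl (le_trans _ xr)// len_ge0.
    by rewrite leNgt; apply/negP => h; apply: nN.
  by case.
have r_x : len o x / 2 + 2 * ln 2 + 1 / 2 <= away_bound by rewrite /away_bound; lra.
case: (ltP (len o x / 2 + ln 2 + 1 / 2) (gromov o (x^-1%g o) p)) => hx.
  have short g : N g -> len o (x * g)%g <= len o g - 1.
    move=> [[Gg gn] gp]; rewrite len_mul_gromov.
    suff : len o x / 2 + 1 / 2 <= gromov o (x^-1%g o) (g o) by lra.
    rewrite -lerN2 -ler_expR; apply: le_trans (exp_gromov_triangle catX o _ p _) _.
    have e1 : expR (- gromov o (x^-1%g o) p) <= expR (- (len o x / 2 + 1 / 2) - ln 2).
      by rewrite ler_expR; lra.
    have e2 : expR (- gromov o p (g o)) <= expR (- (len o x / 2 + 1 / 2) - ln 2).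
      by rewrite ler_expR gromov_sym; lra.
    by rewrite exp_ln2 in e1 e2; lra.
  have : (poincare o s N <= (expR (- s))%:E * P)%E.
    apply: (@le_trans _ _ ((expR (- s))%:E * \esum_(g in N) (expR (- s * len o (x * g)%g))%:E)%E).
      rewrite -esumZ ?lee_fin ?expR_ge0//; apply: le_esum => g Ng.
      rewrite -EFinM -expRD lee_fin ler_expR; have := short g Ng; nra.
    apply: lee_wpmul2l; first by rewrite lee_fin expR_ge0.
    apply: (@esum_inj_le _ _ _ N _ (fun g => (x * g)%g) (fun g => (expR (- s * len o g))%:E)).
      exact: shift_inj.
    move=> g Ng; have := short g Ng; case: Ng => [[Gg gn] _] h; split; first exact: subM.
    lra.
  move=> hN; have {}hN : (P <= w + (expR (- s))%:E * P)%E.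
    by apply: le_trans split_le _; rewrite leeD2l.
  apply: (@le_trans _ _ (C1%:E * w)%E); last first.
    by apply: lee_wpmul2r => //; rewrite lee_fin le_max lexx.
  move: fin P0 hN w0; case: P {split_le} => [P| |]// _ _; case: w => [w| |]//; last first.
    by rewrite gt0_muley ?leey// lte_fin invr_gt0.
  rewrite !lee_fin => hN _; rewrite /C1 mulrC ler_pdivlMr//; lra.
have move_away g : N g -> gromov o ((x * g)%g o) p <= K + 2 * ln 2.
  move=> [[Gg gn] gp].
  have e1 : gromov o (x^-1%g o) (g o) <= len o x / 2 + 2 * ln 2 + 1 / 2.
    have e := exp_gromov_triangle catX o (x^-1%g o) (g o) p.
    have a1 : expR (- (len o x / 2 + ln 2 + 1 / 2)) <= expR (- gromov o (x^-1%g o) p).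
      by rewrite ler_expR lerN2.
    have a2 : expR (- gromov o (g o) p) <= expR (- (len o x / 2 + ln 2 + 1 / 2) - ln 2).
      by rewrite ler_expR; lra.
    rewrite exp_ln2 in a2.
    rewrite -lerN2 -ler_expR (_ : - (_ + _ + _) = - (len o x / 2 + ln 2 + 1 / 2) - ln 2); last by ring.
    by rewrite exp_ln2; lra.
  have e2 : K + 2 * ln 2 <= gromov o ((x * g)%g o) (x o).
    rewrite isomM gromov_sym gromov_swap -/(len o x).
    have -> : gromov (x o) o (x (g o)) = gromov o (x^-1%g o) (g o).
      by rewrite -[in RHS](gromov_isom _ _ _ x) isomKV.
    lra.
  have e := exp_gromov_triangle catX o (x o) ((x * g)%g o) p.
  have a1 : expR (- (K + ln 2)) <= expR (- gromov o (x o) p) by rewrite ler_expR lerN2.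
  have a2 : expR (- gromov o ((x * g)%g o) (x o)) <= expR (- (K + ln 2) - ln 2).
    by rewrite ler_expR; lra.
  rewrite exp_ln2 (gromov_sym _ _ (x o)) in a2.
  rewrite -lerN2 -ler_expR (_ : - (_ + _) = - (K + ln 2) - ln 2); last by ring.
  by rewrite exp_ln2; lra.
have hN : (poincare o s N <= (expR (s * r))%:E * w)%E.
  apply: (@le_trans _ _ ((expR (s * r))%:E * \esum_(g in N) (expR (- s * len o (x * g)%g))%:E)%E).
    rewrite -esumZ ?lee_fin ?expR_ge0//; apply: le_esum => g Ng.
    rewrite -EFinM -expRD lee_fin ler_expR.
    have := metric_triangle o (x o) ((x * g)%g o); rewrite isomM isom_dist -isomM -!/(len _ _) => h.
    have : s * len o (x * g)%g <= s * (r + len o g) by rewrite ler_pM2l//; lra.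
    lra.
  apply: lee_wpmul2l; first by rewrite lee_fin expR_ge0.
  apply: (@esum_inj_le _ _ _ N _ (fun g => (x * g)%g) (fun g => (expR (- s * len o g))%:E)).
    exact: shift_inj.
  move=> g Ng; have := move_away g Ng; case: Ng => [[Gg gn] _] h; split; first exact: subM.
    have := metric_triangle o (x o) ((x * g)%g o); rewrite isomM isom_dist -isomM -!/(len _ _); lra.
  by apply: le_trans h _; rewrite /away_bound; lra.
apply: (@le_trans _ _ (C2%:E * w)%E); last first.
  by apply: lee_wpmul2r => //; rewrite lee_fin le_max lexx orbT.
apply: le_trans split_le _.
have c0 : (0 <= (expR (s * r))%:E)%E by rewrite lee_fin expR_ge0.
have c1 : (0 <= 1%:E :> \bar R)%E by rewrite lee_fin.
by rewrite /C2 EFinD ge0_muleDl// mul1e leeD2l.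
Qed.

(** If all annuli up to radius [n + r] were sparse away from [p], the part of the
   series at the exponent [s'] away from [p] would be bounded by a geometric
   series. By [away_sum] so would the series over long balls, which diverges. *)
Lemma away_annulus (s s' Q : R) (L : nat) : 0 < s -> s < s' -> 0 < Q ->
  (s'%:E < critical_exponent o G)%E ->
  (forall n : R, finite_set (orbit_ball n)) ->
  exists k : nat, forall p, exists j : nat, (j < k)%N /\
    Q * expR (s * (L + j)%:R) <=
    #|` fset_set [set g | [/\ G g, (L + j)%:R <= len o g < (L + j).+1%:R &
                          gromov o (g o) p <= away_bound]] |%:R.
Proof.
move=> s0 ss' Q0 s'd finb; have s'0 : 0 < s' by lra.
pose q := expR (- (s' - s)); have q1 : q < 1 by rewrite expR_lt1; lra.
have q0 : 0 < q := expR_gt0 _.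
pose f s (g : isom X) := (expR (- s * len o g))%:E.
have f0 u g : (0 <= f u g)%E by rewrite lee_fin expR_ge0.
have finP n : (poincare o s' (orbit_ball n) < +oo)%E.
  rewrite /poincare esum_fset// fsbig_finite//= sumEFin ltry //.
pose P0 := fine (poincare o s' (orbit_ball L%:R)).
have P0E : poincare o s' (orbit_ball L%:R) = P0%:E.
  by rewrite /P0 fineK// ge0_fin_numE ?finP// poincare_ge0.
pose C := Num.max (1 - expR (- s'))^-1 (1 + expR (s' * r)).
have C0 : 0 < C by rewrite /C lt_max addr_gt0 ?expR_gt0 ?orbT.
pose B := C * (P0 + Q / (1 - q)).
have := poincare_inf s'0 s'd => inf.
have : (B%:E < poincare o s' G)%E by rewrite inf ltry.
case/ereal_sup_gt => _ [F [finF FG] <-] BF.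
have [n [n0 hn]] := finite_len_bound o finF.
have BP : (B%:E < poincare o s' (orbit_ball n))%E.
  by apply: lt_le_trans BF _; apply: esum_ge; exists F => //; split => // g Fg; split; [exact: FG|exact: hn].
pose k := (Num.truncn (n + r)).+1.
exists k => p; apply: contrapT => /forallNP no.
pose An j := [set g | [/\ G g, (L + j)%:R <= len o g < (L + j).+1%:R & gromov o (g o) p <= away_bound]].
have finA j : finite_set (An j).
  by apply: sub_finite_set (finb (L + j).+1%:R) => g [Gg /andP[_ /ltW gj] _].
have annulus j : (j < k)%N -> (poincare o s' (An j) <= (Q * q ^+ j)%:E)%E.
  move=> jk; have lt : #|` fset_set (An j)|%:R < Q * expR (s * (L + j)%:R).
    by rewrite ltNge; apply/negP => h; apply: (no j).
  rewrite /poincare esum_fset// fsbig_finite//= sumEFin lee_fin.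
  apply: (@le_trans _ _ (\sum_(i <- fset_set (An j)) expR (- s' * (L + j)%:R))).
    rewrite big_seq [leRHS]big_seq; apply: ler_sum => g.
    rewrite in_fset_set// => /set_mem[_ /andP[gj _] _].
    by rewrite ler_expR !mulNr lerN2 ler_pM2l.
  rewrite big_const_seq count_predT iter_addr_0 -[X in X <= _]mulr_natl.
  apply: (@le_trans _ _ (Q * expR (s * (L + j)%:R) * expR (- s' * (L + j)%:R))).
    by rewrite ler_pM2r ?expR_gt0// ltW.
  rewrite -mulrA -expRD ler_pM2l// /q -expRM_natl ler_expR natrD.
  have : 0 <= (s' - s) * L%:R by rewrite mulr_ge0//; lra.
  lra.
have layers j : (j <= k)%N -> (poincare o s'
    [set g | [/\ G g, len o g < (L + j)%:R & gromov o (g o) p <= away_bound]%R] <=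
    (P0 + Q * \sum_(i < j) q ^+ i)%:E)%E.
  elim: j => [|j IH] jk.
    rewrite big_ord0 mulr0 addr0 addn0 -P0E; apply: esum_subset => g [Gg /ltW gL _].
    by split.
  rewrite /poincare (esumID (An j) _ (f s')); last by move=> *; exact: f0.
  rewrite big_ord_recr /= mulrDr addrA EFinD addeC; apply: leeD; last first.
    apply: (le_trans _ (IH (ltnW jk))); apply: esum_subset => g [[Gg gj gp] nA]; split => //.
    rewrite ltNge; apply/negP => h; apply: nA; split => //.
    by rewrite h /= -addnS.
  apply: (le_trans _ (annulus j jk)); apply: esum_subset => g [] //.
have geo : \sum_(i < k) q ^+ i <= (1 - q)^-1.
  have q1' : 0 < 1 - q by lra.
  rewrite -[leRHS]mul1r ler_pdivlMr//.
  by have := subrX1 q k; have := exprn_ge0 k (ltW q0); lra.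
have := away_sum p s'0 (finP n); rewrite leNgt => /negP; apply.
apply: le_lt_trans BP; rewrite /B EFinM; apply: lee_wpmul2l; first by rewrite lee_fin ltW.
apply: (@le_trans _ _ (P0 + Q * \sum_(i < k) q ^+ i)%:E); last first.
  by rewrite lee_fin lerD2l ler_pM2l.
apply: (le_trans _ (layers k (leqnn _))); apply: esum_subset => g [Gg gn gp]; split => //.
apply: le_lt_trans gn _.
have r0 : 0 <= r by rewrite /r le_max len_ge0.
have /Num.Theory.truncn_itv/andP[_ h] : 0 <= n + r by rewrite addr_ge0.
by apply: lt_le_trans h _; rewrite ler_nat leq_addl.
Qed.

End AwayPair.

(** Greedy choice: the elements discarded with a chosen one have orbit points
   within [l] of it, and translating back bounds their number by that of the orbit
   points within [l] of [o]. *)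
Lemma separated_subseq (l : R) (r : seq (isom X)) :
  0 <= l -> finite_set (orbit_ball l) -> uniq r -> (forall g, g \in r -> G g) ->
  exists r', [/\ uniq r', {subset r' <= r},
    (forall g h, g \in r' -> h \in r' -> g <> h -> l < mdist (g o) (h o)) &
    (size r <= #|` fset_set (orbit_ball l)| * size r')%N].
Proof.
move=> l0 finl; elim: {r}(size r) {-2}r (leqnn (size r)) => [|n IH] [|g r]//= sr.
- by move=> _ _; exists [::].
- by move=> _ _; exists [::].
move=> /andP[gr ur] rG.
pose t := [seq h : isom X <- r | l < mdist (g o) (h o)].
have [|||r' [ur' r't sep sz]] := IH t.
- by apply: leq_trans (_ : size r <= n)%N => //; rewrite size_filter count_size.
- exact: filter_uniq.
- by move=> h; rewrite mem_filter => /andP[_ hr]; apply: rG; rewrite inE hr orbT.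
exists (g :: r'); split => /=.
- rewrite ur' andbT; apply: contra gr => /r't; by rewrite mem_filter => /andP[].
- by move=> h; rewrite !inE => /orP[->//|/r't]; rewrite mem_filter => /andP[_ ->]; rewrite orbT.
- move=> h h'; rewrite !inE => /orP[/eqP ->|hr] /orP[/eqP ->|hr'] ne //; last exact: sep.
    by have := r't _ hr'; rewrite mem_filter => /andP[].
  by have := r't _ hr; rewrite mem_filter metric_sym => /andP[].
rewrite mulnS; pose c := [seq h : isom X <- r | ~~ (l < mdist (g o) (h o))].
have -> : (size r = size t + size c)%N by rewrite !size_filter count_predC.
rewrite -addnS [leqLHS]addnC; apply: leq_add => //.
have -> : (size c).+1 = size [seq (g^-1 * h)%g | h : isom X <- g :: c] by rewrite size_map.
apply: (@uniq_leq_size _ _ (enum_fset (fset_set (orbit_ball l)))).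
  rewrite map_inj_uniq; last by move=> h h' /(congr1 (fun k => (g * k)%g)); rewrite !mulVKg.
  by rewrite /= filter_uniq// mem_filter negb_and gr orbT.
move=> _ /mapP[h hc ->]; rewrite in_fset_set//; apply: mem_set.
have Gg : G g by apply: rG; rewrite inE eqxx.
move: hc; rewrite inE => /orP[/eqP ->|].
  by rewrite mulVg; split; [exact: sub1|rewrite /len isom1 mdistxx].
rewrite mem_filter -leNgt => /andP[gh hr]; split; last by rewrite -mdist_orbit.
by apply: subM => //; [exact: subV|apply: rG; rewrite inE hr orbT].
Qed.

End AwaySums.

(** * Lower bound for the dimension of the limit set *)

Section LowerBound.
Context {R : realType} {X : metricType R} (catX : cat_minus_one X).
Context (properX : proper_space X).
Context (o : X) (G : set (isom X)) (Gsub : is_subgroup G).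
Implicit Types (s : R) (g h x : isom X) (p : X) (xi eta : boundary X).

(** The right multipliers [l] lead from [gamma] to its children in a tree of orbit
   points; as seen from [gamma o], the base point lies in the direction of
   [gamma^-1 o]. *)
Definition kids (kappa ell : R) (gamma : isom X) (l : seq (isom X)) (m : nat) :=
  [/\ uniq l,
    forall g, g \in l -> [/\ G g, m%:R <= len o g < m.+1%:R &
                             gromov o (g o) (gamma^-1%g o) <= kappa] &
    forall g h, g \in l -> h \in l -> g <> h -> ell < mdist (g o) (h o)].

(** A dense annulus away from [gamma^-1 o], thinned out. *)
Lemma kids_exist s : 0 < s -> (s%:E < critical_exponent o G)%E ->
  (critical_exponent o G < +oo)%E -> non_elementary o G ->
  exists kappa : R, 0 <= kappa /\ forall (L : nat) (ell : R), 0 <= ell ->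
    exists M : nat, forall gamma, exists l m,
      [/\ (L <= m <= M)%N, kids kappa ell gamma l m & expR (s * m.+1%:R) <= (size l)%:R].
Proof.
move=> s0 sd dfin ne.
have [s' ss' s'd] : exists2 s' : R, s < s' & (s'%:E < critical_exponent o G)%E.
  move: sd dfin; case: (critical_exponent o G) => [d| |]// sd _.
  exists ((s + d) / 2); move: sd; rewrite !lte_fin; lra.
have finb n : finite_set (orbit_ball o G n).
  have [_ [t [t0 ht] <-] _] := ereal_inf_lt dfin.
  exact: (finite_ball _ t0 ht).
have [K hK] := separated_pair catX ne.
have [x1 [x2 [Gx1 Gx2 x12 l1 l2]]] := hK (2 * K + 8 * ln 2 + 1).
exists (away_bound o x1 x2); split; first exact: away_bound_ge0.
move=> L ell ell0; pose D := #|` fset_set (orbit_ball o G ell)|.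
(* the factor [D.+1] pays for the passage to a separated subset *)
have Q0 : 0 < expR s * D.+1%:R by rewrite mulr_gt0 ?expR_gt0// ltr0n.
have [k hk] := away_annulus catX Gsub Gx1 Gx2 x12 l1 l2 L s0 ss' Q0 s'd finb.
exists (L + k)%N => gamma; have [j [jk hj]] := hk (gamma^-1%g o).
set A := [set g | _] in hj.
have finA : finite_set A.
  by apply: sub_finite_set (finb (L + j).+1%:R) => g [Gg /andP[_ /ltW gj] _].
have Ak g : g \in enum_fset (fset_set A) -> A g.
  by move=> kr; apply/set_mem; rewrite -(in_fset_set finA).
have [||l [ul lA sep sz]] := separated_subseq Gsub ell0 (finb ell) (r := enum_fset (fset_set A)).
- exact: fset_uniq.
- by move=> g /Ak[].
exists l, (L + j)%N; split.
- by rewrite leq_addr leq_add2l ltnW.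
- by split => // g /lA /Ak.
have szR : (size (enum_fset (fset_set A)))%:R <= D.+1%:R * (size l)%:R :> R.
  by rewrite -natrM ler_nat (leq_trans sz)// leq_mul2r leqnSn orbT.
have D0 : 0 < D.+1%:R :> R by rewrite ltr0n.
rewrite -(ler_pM2l D0); apply: le_trans szR; apply: le_trans hj.
rewrite -(natr1 (L + j)) mulrDr mulr1 expRD; lra.
Qed.

Lemma len_mul gamma g :
  len o (gamma * g)%g = len o gamma + len o g - 2 * gromov o (g o) (gamma^-1%g o).
Proof. by rewrite len_mul_gromov gromov_sym. Qed.

Lemma gromov_child (gamma g : isom X) :
  gromov o (gamma o) ((gamma * g)%g o) = len o gamma - gromov o (g o) (gamma^-1%g o).
Proof.
rewrite gromov_swap -/(len o gamma) gromov_sym; congr (_ - _).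
by rewrite -[in RHS](gromov_isom _ _ _ gamma) isomKV isomM.
Qed.

Let exp1_ge2 : 2 <= expR 1 :> R. Proof. by have := expR_ge1Dx (1 : R); lra. Qed.

Let expB1 (u : R) : 2 * expR (u - 1) <= expR u.
Proof.
by rewrite expRD expRN mulrCA -[leRHS]mulr1 ler_pM2l ?expR_gt0// ler_pdivrMr ?mul1r ?expR_gt0.
Qed.

Section Branch.
Context (kappa : R) (kappa0 : 0 <= kappa).
Context (c : nat -> isom X).
Hypothesis cstep : forall k, exists g, [/\ c k.+1 = (c k * g)%g,
   gromov o (g o) ((c k)^-1%g o) <= kappa & 2 * kappa + 1 <= len o g].

Lemma branch_len_step k : len o (c k) + 1 <= len o (c k.+1).
Proof. by have [g [-> h1 h2]] := cstep k; rewrite len_mul; lra. Qed.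

Lemma branch_len_ge k : k%:R <= len o (c k).
Proof.
elim: k => [|k IH]; first exact: len_ge0.
by apply: le_trans (branch_len_step k); rewrite -natr1 lerD2r.
Qed.

(** Along a branch the visual sizes of the edges decrease geometrically. *)
Lemma branch_gromov k l : (k <= l)%N ->
  expR (- gromov o (c k o) (c l o)) <= 2 * expR (kappa - len o (c k)).
Proof.
move=> kl; rewrite -(subnK kl); move: (l - k)%N => j; elim: j k {kl} => [|j IH] k.
  rewrite add0n /gromov mdistxx subr0 -/(len o (c k)) (_ : (_ + _) / 2 = len o (c k)); last by field.
  have : expR (- len o (c k)) <= expR (kappa - len o (c k)).
    by have k0 := kappa0; rewrite ler_expR; lra.
  by have := expR_gt0 (kappa - len o (c k)); lra.
apply: le_trans (exp_gromov_triangle catX o _ (c k.+1 o) _) _.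
have := IH k.+1; rewrite addSnnS => h.
have [g [e h1 h2]] := cstep k.
have h3 : expR (- gromov o (c k o) (c k.+1 o)) <= expR (kappa - len o (c k)).
  by rewrite e gromov_child ler_expR; lra.
have h4 : 2 * expR (kappa - len o (c k.+1)) <= expR (kappa - len o (c k)).
  apply: le_trans (expB1 _); rewrite ler_pM2l// ler_expR.
  by have := branch_len_step k; lra.
lra.
Qed.

Definition shadow (gamma : isom X) : set (boundary X) :=
  [set xi | forall d, rays xi d ->
     \forall t \near +oo, expR (- gromov o (gamma o) (d t)) <= 3 * expR (kappa - len o gamma)].

Lemma branch_limit : (forall k, G (c k)) ->
  exists xi, limit_set o G xi /\ forall k, shadow (c k) xi.
Proof.
move=> Gc; have [xi cxi] : exists xi, converges_to_bd o (fun k => c k o) xi.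
  apply: gromov_cauchy_limit => // M.
  pose N := (Num.truncn `|M + kappa + ln 2|).+1.
  have hN : M + kappa + ln 2 <= N%:R.
    have /Num.Theory.truncn_itv/andP[_ h] := normr_ge0 (M + kappa + ln 2).
    by have := ler_norm (M + kappa + ln 2); rewrite -/N in h; lra.
  exists N => k l.
  wlog kl : k l / (k <= l)%N.
    move=> hw Nk Nl; case: (leqP k l) => [kl|/ltnW lk]; first exact: hw.
    by rewrite gromov_sym; exact: hw.
  move=> Nk Nl; rewrite -lerN2 -ler_expR; apply: le_trans (branch_gromov kl) _.
  have -> : 2 = expR (ln 2) :> R by rewrite lnK ?posrE.
  rewrite -expRD ler_expR.
  have := branch_len_ge k; have : N%:R <= k%:R :> R by rewrite ler_nat.
  lra.
exists xi; split; first by exists c.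
move=> k d xd; have [N [T hN]] := converges_to_bdP (len o (c k) - kappa) cxi xd.
have := branch_gromov (leq_maxl k N) => h1.
near=> t; have tT : T <= t by near: t; apply: nbhs_pinfty_ge; exact: num_real.
have h2 := hN _ _ (leq_maxr k N) tT.
apply: le_trans (exp_gromov_triangle catX o _ (c (maxn k N) o) _) _.
have : expR (- gromov o (c (maxn k N) o) (d t)) <= expR (kappa - len o (c k)).
  by rewrite ler_expR; lra.
lra.
Unshelve. all: by end_near.
Qed.

End Branch.

(** Orbit points of distinct children are at distance more than [ell], which bounds
   their Gromov product from above; [ell] is chosen so that their visual distance
   exceeds the sizes of the two shadows. *)
Lemma kids_shadow_separated (kappa ell : R) gamma l m g h xi eta : 0 <= kappa ->
  2 * (1 + ln (6 * expR (3 * kappa) + 1)) <= ell ->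
  kids kappa ell gamma l m -> g \in l -> h \in l -> g <> h ->
  shadow kappa (gamma * g)%g xi -> shadow kappa (gamma * h)%g eta ->
  expR (- (len o gamma + m%:R)) <= bourdon o xi eta.
Proof.
move=> kappa0 hell [ul lK sep] gl hl gh sg sh.
have [Gg /andP[g1 g2] g3] := lK g gl; have [Gh /andP[h1 h2] h3] := lK h hl.
rewrite -natr1 in g2 h2.
have gg0 := gromov_ge0 o (g o) (gamma^-1%g o); have gh0 := gromov_ge0 o (h o) (gamma^-1%g o).
have eg := len_mul gamma g; have eh := len_mul gamma h.
apply: (bourdon_ge_near catX (expR_gt0 _) sg sh).
have a1 : 3 * expR (kappa - len o (gamma * g)%g) <= 3 * (expR (3 * kappa) * expR (- (len o gamma + m%:R))).
  by rewrite ler_pM2l// -expRD ler_expR; lra.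
have a2 : 3 * expR (kappa - len o (gamma * h)%g) <= 3 * (expR (3 * kappa) * expR (- (len o gamma + m%:R))).
  by rewrite ler_pM2l// -expRD ler_expR; lra.
have E0 : 0 < 6 * expR (3 * kappa) + 1 by have := expR_gt0 (3 * kappa); lra.
apply: (@le_trans _ _ ((6 * expR (3 * kappa) + 1) * expR (- (len o gamma + m%:R)))); first by lra.
rewrite -[X in X * _]lnK ?posrE// -expRD ler_expR /gromov -!/(len o _).
have -> : mdist ((gamma * g)%g o) ((gamma * h)%g o) = mdist (g o) (h o).
  by rewrite !isomM isom_dist.
have := sep g h gl hl gh; lra.
Qed.

(** If a cover had small total size, one could descend the tree, at each vertex
   into a child whose shadow is met by little of the cover, and the limit of the
   branch would escape the cover: distinct children are so far apart that each
   relevant set of the cover meets the shadow of at most one of them. *)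
Lemma limit_set_measure_neq0 s : 0 < s -> (s%:E < critical_exponent o G)%E ->
  (critical_exponent o G < +oo)%E -> non_elementary o G ->
  hausdorff_measure (bourdon o) s (limit_set o G) <> 0%E.
Proof.
move=> s0 sd dfin ne H0.
have [kappa [kappa0 hk]] := kids_exist s0 sd dfin ne.
pose L := (Num.truncn (2 * kappa + 1)).+1.
have hL : 2 * kappa + 1 <= L%:R.
  have : 0 <= 2 * kappa + 1 by lra.
  by move=> /Num.Theory.truncn_itv/andP[_ /ltW].
pose ell := 2 * (1 + ln (6 * expR (3 * kappa) + 1)).
have ell0 : 0 <= ell.
  have : 0 <= ln (6 * expR (3 * kappa) + 1) by rewrite ln_ge0//; have := expR_gt0 (3 * kappa); lra.
  by rewrite /ell; lra.
have [M hM] := hk L ell ell0.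
have /choice[lm hlm] : forall gamma, exists lm : seq (isom X) * nat,
    [/\ (L <= lm.2 <= M)%N, kids kappa ell gamma lm.1 lm.2 & expR (s * lm.2.+1%:R) <= (size lm.1)%:R].
  by move=> gamma; have [l [m h]] := hM gamma; exists (l, m).
pose phi (gamma : isom X) : R := expR (- s * len o gamma).
pose C : R := expR (s * M%:R); have C0 : 0 < C := expR_gt0 _.
have [U [Ucov Usum]] : exists U : nat -> set (boundary X), limit_set o G `<=` \bigcup_n U n /\
    (\sum_(0 <= n <oo) poweR (diameter (bourdon o) (U n)) s < (2^-1 / C)%:E)%E.
  have : (hausdorff_content (bourdon o) s 1 (limit_set o G) <= 0)%E.
    by rewrite -H0; apply: ereal_sup_ubound; exists 1 => //=.
  move=> h; have : (hausdorff_content (bourdon o) s 1 (limit_set o G) < (2^-1 / C)%:E)%E.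
    by apply: le_lt_trans h _; rewrite lte_fin divr_gt0.
  by case/ereal_inf_lt => _ [U [Ucov _] <-] hU; exists U.
(* The extra geometric series makes every set of the cover cost something, also
   those of diameter zero, so that none survives the whole descent. *)
pose b n := (C%:E * poweR (diameter (bourdon o) (U n)) s)%E.
pose a n := (b n + (4^-1 / (2 ^ n.+1)%:R)%:E)%E.
have b0 n : (0 <= b n)%E by rewrite mule_ge0 ?poweR_ge0// lee_fin ltW.
have e0 n : 0 < 4^-1 / (2 ^ n.+1)%:R :> R by rewrite divr_gt0// ltr0n expn_gt0.
have a0 n : (0 <= a n)%E by rewrite adde_ge0// lee_fin ltW.
have sum_a : (\esum_(n in [set: nat]) a n < (phi 1%g)%:E)%E.
  rewrite -nneseries_esumT// /phi /len isom1 mdistxx mulr0 expR0.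
  apply: le_lt_trans (epsilon_trick xpredT b0 _) _; first by rewrite invr_ge0.
  rewrite nneseriesZl; last by move=> *; exact: poweR_ge0.
  have S0 : (0 <= \sum_(0 <= n <oo) poweR (diameter (bourdon o) (U n)) s)%E.
    by apply: nneseries_ge0 => *; exact: poweR_ge0.
  move: S0 Usum; case: (\sum_(0 <= n <oo) _)%E => [S| |]//.
  rewrite lee_fin lte_fin ltr_pdivlMr// => _ hS.
  by rewrite -EFinM -EFinD lte_fin; lra.
have supermult gamma : phi gamma <= \sum_(g <- (lm gamma).1) phi (gamma * g)%g.
  have [_ [ul lK sep] sz] := hlm gamma.
  apply: (@le_trans _ _ (\sum_(g <- (lm gamma).1) phi gamma * expR (- (s * (lm gamma).2.+1%:R)))).
    rewrite big_const_seq count_predT iter_addr_0 -[leRHS]mulr_natr.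
    rewrite -mulrA -[leLHS]mulr1 ler_pM2l ?expR_gt0// expRN mulrC ler_pdivlMr ?expR_gt0//.
    by rewrite mul1r.
  rewrite big_seq [leRHS]big_seq; apply: ler_sum => g gl; rewrite /phi -expRD ler_expR.
  have [Gg /andP[_ gm] g3] := lK g gl; rewrite len_mul.
  have := gromov_ge0 o (g o) (gamma^-1%g o).
  set q := gromov _ _ _ => q0.
  have := mulr_ge0 (ltW s0) q0; have := ltW gm; rewrite -(ler_pM2l s0); lra.
(* A state of the descent is a vertex together with the indices of the sets of
   the cover that meet the shadows of all vertices below the root on the way to
   it. *)
pose St := {p : isom X * set nat | G p.1 /\ (\esum_(n in p.2) a n < (phi p.1)%:E)%E}.
pose cut (J : set nat) gamma : set nat := [set n | J n /\ exists xi, U n xi /\ shadow kappa gamma xi].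
pose next (p q : St) := exists g, [/\ g \in (lm (sval p).1).1,
   (sval q).1 = ((sval p).1 * g)%g & (sval q).2 = cut (sval p).2 (sval q).1].
have step (p : St) : {q : St | next p q}.
  apply: cid; case: p => -[gamma J] /= [Gg hJ].
  have [range [ul lK sep] sz] := hlm gamma.
  suff [g [gl hg]] : exists g, g \in (lm gamma).1 /\
      (\esum_(n in cut J (gamma * g)%g) a n < (phi (gamma * g)%g)%:E)%E.
    have Ggg : G (gamma * g)%g by apply: (subM Gsub) => //; have [] := lK g gl.
    by exists (exist _ ((gamma * g)%g, cut J (gamma * g)%g) (conj Ggg hg)); exists g.
  apply: contrapT => /forallNP no.
  have : ((phi gamma)%:E <= \esum_(n in J) a n)%E; last by rewrite leNgt hJ.
  apply: (@le_trans _ _ (\sum_(g <- (lm gamma).1) (phi (gamma * g)%g)%:E)%E).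
    by rewrite sumEFin lee_fin.
  apply: (@le_trans _ _ (\sum_(g <- (lm gamma).1) \esum_(n in cut J (gamma * g)%g) a n)%E).
    rewrite big_seq [leRHS]big_seq; apply: lee_sum => g gl.
    by rewrite leNgt; apply/negP => h; apply: (no g).
  apply: sum_esum_disjoint_le => //; first by move=> g gl n [].
  move=> g h n gl hl [Jn [xi [Uxi sxi]]] [_ [eta [Ueta seta]]].
  apply: contrapT => gh.
  have sepd := kids_shadow_separated kappa0 (lexx ell) (And3 ul lK sep) gl hl gh sxi seta.
  have : (a n < (phi gamma)%:E)%E.
    by apply: le_lt_trans hJ; exact: (@esum_ge1 _ _ J a).
  rewrite ltNge => /negP; apply.
  apply: (@le_trans _ _ (b n)); last by rewrite leeDl// lee_fin ltW.
  have -> : (phi gamma)%:E = (C%:E * poweR (expR (- (len o gamma + M%:R)))%:E s)%E.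
    by rewrite poweR_EFin -expRM -EFinM -expRD; congr (expR _)%:E; ring.
  apply: lee_wpmul2l; first by rewrite lee_fin ltW.
  apply: gt0_ler_poweR; rewrite ?(ltW s0)//.
  - by rewrite in_itv/= leey andbT lee_fin expR_ge0.
  - by rewrite in_itv/= leey andbT; apply: ereal_sup_ubound; left.
  apply: (@le_trans _ _ (bourdon o xi eta)%:E).
    rewrite lee_fin; apply: le_trans sepd; rewrite ler_expR lerN2 lerD2l ler_nat.
    by case/andP: range.
  by apply: ereal_sup_ubound; right; exists (xi, eta).
have start : G 1%g /\ (\esum_(n in [set: nat]) a n < (phi 1%g)%:E)%E.
  by split => //; exact: sub1.
have [f [f0 fS]] := dependent_choice step (exist _ (1%g, setT) start).
pose c k := (sval (f k)).1; pose J k := (sval (f k)).2.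
have Gc k : G (c k) by rewrite /c; case: (f k) => p [].
have hJ k : (\esum_(n in J k) a n < (phi (c k))%:E)%E by rewrite /c /J; case: (f k) => p [].
have cstep k : exists g, [/\ c k.+1 = (c k * g)%g,
    gromov o (g o) ((c k)^-1%g o) <= kappa & 2 * kappa + 1 <= len o g].
  have [g [gl e _]] := fS k; exists g; split => //.
    by have [_ [_ lK _] _] := hlm (c k); have [] := lK g gl.
  have [/andP[hm _] [_ lK _] _] := hlm (c k); have [_ /andP[h _] _] := lK g gl.
  by apply: le_trans hL _; apply: le_trans h; rewrite ler_nat.
have [xi [lxi sxi]] := branch_limit kappa0 cstep Gc.
have [n _ Un] := Ucov _ lxi.
have Jn k : J k n.
  elim: k => [|k IH]; first by rewrite /J f0.
  have [g [_ _ e]] := fS k; rewrite /J e; split; first exact: IH.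
  by exists xi; split => //; exact: sxi.
pose k := (Num.truncn (- ln (4^-1 / (2 ^ n.+1)%:R) / s)).+1.
have : ((4^-1 / (2 ^ n.+1)%:R)%:E < (phi (c k))%:E)%E.
  apply: le_lt_trans (hJ k); apply: le_trans (@esum_ge1 _ _ _ a n a0 (Jn k)).
  by rewrite /a leeDr.
rewrite lte_fin ltNge => /negP; apply.
rewrite -[leRHS]lnK ?posrE// ler_expR mulNr lerNl.
have hk' : - ln (4^-1 / (2 ^ n.+1)%:R) / s <= k%:R.
  apply/ltW; rewrite /k.
  case: (leP 0 (- ln (4^-1 / (2 ^ n.+1)%:R) / s : R)) => [/Num.Theory.truncn_itv/andP[]//|lt].
  by apply: lt_le_trans lt _; rewrite ler0n.
move: hk'; rewrite ler_pdivrMr// mulrC => hk'; have := branch_len_ge cstep k; rewrite -(ler_pM2l s0); lra.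
Qed.

Lemma critical_exponent_le_dim : (critical_exponent o G < +oo)%E -> non_elementary o G ->
  (critical_exponent o G <= hausdorff_dim (bourdon o) (limit_set o G))%E.
Proof.
move=> dfin ne; apply: le_ereal_inf_tmp => _ [s [s0 hs] <-].
rewrite leNgt; apply/negP => sd; exact: (limit_set_measure_neq0 s0 sd).
Qed.

End LowerBound.

(** * Dimension of the limit set *)

Section Dimension.
Context {R : realType} {X : metricType R} (catX : cat_minus_one X).
Context (properX : proper_space X) (o : X) (G : set (isom X)) (Gsub : is_subgroup G).

Lemma limit_set_dim_eq : finitely_generated G -> non_elementary o G ->
  (critical_exponent o G < +oo)%E ->
  (critical_exponent o G < 1)%E \/ convex_cobounded o G ->
  critical_exponent o G = hausdorff_dim (bourdon o) (limit_set o G).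
Proof.
move=> [S finS GS] ne dfin cases; apply/eqP; rewrite eq_le; apply/andP; split.
  exact: critical_exponent_le_dim.
have d0 := critical_exponent_ge0 o G.
case: cases => [d1|cc]; last first.
  apply: hausdorff_dim_le => // s ds s0.
  apply: convex_cobounded_measure0 => //; exact: poincare_fin.
(* subadditivity asks for exponents at most [1], and these approach the critical
   exponent because it is below [1] *)
move: d0 d1 dfin (@poincare_fin _ _ o ^~ G).
case: (critical_exponent o G) => [d| |] // d0 d1 _ hfin.
rewrite lte_fin in d1; rewrite lee_fin in d0.
apply/lee_addgt0Pr => e e0.
pose s := Num.min (d + e) ((d + 1) / 2).
have ds : d < s by rewrite lt_min ltrDl e0; lra.
have s1 : s <= 1 by rewrite ge_min; apply/orP; right; lra.
apply: (@le_trans _ _ s%:E); last by rewrite -EFinD lee_fin ge_min lexx.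
apply: ereal_inf_lbound; exists s => //; split; first by lra.
apply: (small_exponent_measure0 catX Gsub finS GS) => //; first by lra.
by apply: hfin; rewrite lte_fin.
Qed.

End Dimension.

Theorem corollary1p7 (R : realType) (X : metricType R)
  (Gamma : set (isom X)) (A B : boundary X) (o : X)
  (I : Type) (D : I -> gog X)
  (m : forall b, gE (D b) -> set (isom X) -> isom X)
  (properX : proper_space X) (catX : cat_minus_one X)
  (Gamma_grp : is_subgroup Gamma) (Gamma_fg : finitely_generated Gamma)
  (Gamma_ne : non_elementary o Gamma) (Gamma_disc : discrete_isoms Gamma)
  (delta_gt0 : (0 < critical_exponent o Gamma)%E)
  (delta_fin : (critical_exponent o Gamma < +oo)%E)
  (A_lim : limit_set o Gamma A) (B_lim : limit_set o Gamma B) (AB : A <> B)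
  (oAB : on_line_between o A B)
  (I_ne : inhabited I) (D_sub : forall b, grp (D b) `<=` Gamma)
  (m_min : forall b, minimizing_choice o (m b)) :
  [/\ (forall (b : I) (s : R), 0 < s -> trim (D b) = finset.set0 ->
         bs_series o (m b) s = vertex_series (D b) o s),
      (forall (b : I) (s : R), 0 < s -> trim (D b) != finset.set0 ->
         (trim_series_finite (D b) o s ->
          spectral_radius (transfer_mx (D b) o s) < 1 ->
          bs_series o (m b) s =
            (vertex_series (D b) o s * (resolvent_factor (D b) o s)%:E)%E) /\
         ((bs_series o (m b) s < +oo)%E ->
          trim_series_finite (D b) o s /\
          spectral_radius (transfer_mx (D b) o s) < 1)) &
      ((critical_exponent o Gamma < 1)%E \/ convex_cobounded o Gamma ->
       [/\ (ereal_sup (axial_exponents (fun E => exists b, E = D b)) <=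
              critical_exponent o Gamma)%E,
           (forall t : hierarchy X, hierarchy_in Gamma t ->
             (ereal_sup (axial_exponents (node_of t)) <=
              critical_exponent o Gamma)%E) &
           critical_exponent o Gamma =
             hausdorff_dim (bourdon o) (limit_set o Gamma)])].
Proof.
split.
- by move=> b s _; exact: bs_series_trim0.
- move=> b s _ _; split; first exact: bs_series_resolvent.
  exact: bs_series_finite.
move=> cases; split.
- by apply: (axial_exponents_le catX) => _ [b ->]; exact: D_sub.
- move=> t [wf tG]; apply: (axial_exponents_le catX) => E nE.
  by apply: subset_trans tG; exact: node_grp_sub.
- exact: limit_set_dim_eq.
Qed.
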